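(* Let $(\mathcal H,\Delta)$ be a Hopf algebra over $\mathbb C$ with invertible antipode and let $\mathcal B$ be a unital right $\mathcal H$-module algebra. For every $n\ge 0$ there exist (bi-additive, well-defined) pairings $$\langle\cdot,\cdot\rangle\colon HC^{2n}_{\mathcal H}(\mathcal B)\times K_0^{\mathcal H}(\mathcal B)\to R(\mathcal H)\quad\text{and}\quad \langle\cdot,\cdot\rangle\colon HC^{2n+1}_{\mathcal H}(\mathcal B)\times K_1^{\mathcal H}(\mathcal B)\to R(\mathcal H)$$ such that: for every cyclic cocycle $f\in C^{2n}_{\mathcal H}(\mathcal B)$, every finite dimensional right $\mathcal H$-module $X$ and every $\mathcal H$-invariant idempotent $p\in \mathrm{End}(X)\otimes\mathcal B$, $$\langle[f],[p]\rangle(\omega)=(\Psi^{2n}f)(\omega\otimes p\otimes\dots\otimes p)\qquad(\omega\in\mathcal H),$$ and for every cyclic cocycle $f\in C^{2n+1}_{\mathcal H}(\mathcal B)$, every finite dimensional right $\mathcal H$-module $X$ and every invertible $\mathcal H$-invariant element $u\in\mathrm{End}(X)\otimes\mathcal B$, $$\langle[f],[u]\rangle(\omega)=(\Psi^{2n+1}f)(\omega\otimes(u^{-1}-1)\otimes(u-1)\otimes\dots\otimes(u^{-1}-1)\otimes(u-1))\qquad(\omega\in\mathcal H).$$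
   Context: All spaces are over $\mathbb C$. $\mathcal H$ has comultiplication $\Delta$, counit $\varepsilon$, invertible antipode $S$; Sweedler notation starts at $0$: $\Delta^n(\omega)=\omega_{(0)}\otimes\dots\otimes\omega_{(n)}$. A unital right $\mathcal H$-module algebra $\mathcal B$ is a unital algebra with a right $\mathcal H$-action $\triangleleft$ such that $(b_1b_2)\triangleleft\omega=(b_1\triangleleft\omega_{(0)})(b_2\triangleleft\omega_{(1)})$ and $1\triangleleft\omega=\varepsilon(\omega)1$. An element $y$ of a right $\mathcal H$-module is $\mathcal H$-invariant if $y\triangleleft\omega=\varepsilon(\omega)y$ for all $\omega$. Tensor products of right $\mathcal H$-modules carry the action $(x_1\otimes x_2)\triangleleft\omega=x_1\triangleleft\omega_{(0)}\otimes x_2\triangleleft\omega_{(1)}$. Equivariant cyclic cohomology. Regard $\mathcal H$ as a right $\mathcal H$-module by $\eta\triangleleft\omega=S^{-1}(\omega_{(0)})\eta\omega_{(1)}$, and $\mathcal H\otimes\mathcal B^{\otimes(n+1)}$ as the tensor product module. $C^n_{\mathcal H}(\mathcal B)$ is the space of linear functionals $f$ on $\mathcal H\otimes\mathcal B^{\otimes(n+1)}$ with $f(z\triangleleft\omega)=\varepsilon(\omega)f(z)$ for all $z,\omega$. Put $(t_nf)(\omega\otimes b_0\otimes\dots\otimes b_n)=f(\omega_{(0)}\otimes b_n\triangleleft\omega_{(1)}\otimes b_0\otimes\dots\otimes b_{n-1})$; for $0\le i<n$, $(d_i^nf)(\omega\otimes b_0\otimes\dots\otimes b_n)=f(\omega\otimes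 b_0\otimes\dots\otimes b_ib_{i+1}\otimes\dots\otimes b_n)$ ($f\in C^{n-1}_{\mathcal H}(\mathcal B)$); $d_n^n=t_nd_0^n$; and $s_i^n\colon C^{n+1}_{\mathcal H}(\mathcal B)\to C^n_{\mathcal H}(\mathcal B)$ inserts $1$ after $b_i$. This is a cocyclic vector space. Let $b_n=\sum_{i=0}^n(-1)^id_i^n$ and $\lambda_n=(-1)^nt_n$. $HC^\bullet_{\mathcal H}(\mathcal B)$ is its cyclic cohomology; since the ground field is $\mathbb C$, it is the cohomology of the complex $(\mathrm{Ker}(\iota-\lambda),b)$. A cyclic cocycle is $f$ with $\lambda f=f$, $bf=0$; $[f]$ is its class. $R(\mathcal H)$ is the space of linear functionals $g$ on $\mathcal H$ with $g(S^{-1}(\omega_{(0)})\eta\omega_{(1)})=\varepsilon(\omega)g(\eta)$ for all $\omega,\eta$. For a right $\mathcal H$-module $X$ let $\pi_X\colon\mathcal H\to\mathrm{End}(X)$ be the antihomomorphism $\pi_X(\omega)x=x\triangleleft\omega$. $\mathrm{End}(X)\otimes\mathcal B$ is a right $\mathcal H$-module algebra via $(T\otimes b)\blacktriangleleft\omega=\pi_X(\omega_{(0)})T\pi_X(S^{-1}(\omega_{(2)}))\otimes b\triangleleft\omega_{(1)}$, and invariance in $\mathrm{End}(X)\otimes\mathcal B$ refers to this action. For $X,X'$ the space $\mathrm{Hom}_{\mathbb C}(X,X')\otimes\mathcal B$ is a submodule of $\mathrm{End}(X\oplus X')\otimes\mathcal B$. For $X$ finite dimensional, $$(\Psi^nf)(\omega\otimes(T_0\otimes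 b_0)\otimes\dots\otimes(T_n\otimes b_n))=f(\omega_{(0)}\otimes b_0\otimes\dots\otimes b_n)\,\mathrm{Tr}(\pi_X(S^{-1}(\omega_{(1)}))T_0\cdots T_n).$$ $K_0^{\mathcal H}(\mathcal B)$: the Grothendieck group of the semigroup (under direct sum) of equivalence classes of $\mathcal H$-invariant idempotents $p\in\mathrm{End}(X)\otimes\mathcal B$, $X$ any finite dimensional right $\mathcal H$-module, where $p\sim p'$ ($p'\in \mathrm{End}(X')\otimes\mathcal B$) if there are $\mathcal H$-invariant $\gamma\in\mathrm{Hom}_{\mathbb C}(X,X')\otimes\mathcal B$, $\gamma'\in\mathrm{Hom}_{\mathbb C}(X',X)\otimes\mathcal B$ with $\gamma\gamma'=p'$, $\gamma'\gamma=p$. $K_1^{\mathcal H}(\mathcal B)$: the abelian group generated by isomorphism classes $[u]$ of invertible $\mathcal H$-invariant elements $u\in\mathrm{End}(X)\otimes\mathcal B$ ($X$ finite dimensional; these are the $\mathcal H$-equivariant $\mathcal B$-module automorphisms of $X\otimes\mathcal B$, and isomorphism means conjugation by an equivariant $\mathcal B$-module isomorphism $X\otimes\mathcal B\cong X'\otimes\mathcal B$), with relations $[u]+[v]=[uv]$ for $u,v\in\mathrm{End}(X)\otimes\mathcal B$, and $[u_1]+[u_2]=\left[\begin{pmatrix}u_1&T\\0&u_2\end{pmatrix}\right]$ for every $\mathcal H$-invariant $T\in\mathrm{Hom}_{\mathbb C}(X_2,X_1)\otimes\mathcal B$. *)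

(* Defs.v *)
From HB Require Import structures.
From mathcomp Require Import all_boot all_order all_algebra.
From mathcomp Require Import generic_quotient ring_quotient complex.
From mathcomp Require Import boolp functions reals.

Set Implicit Arguments.
Unset Strict Implicit.
Unset Printing Implicit Defensive.

Import GRing.Theory.
Local Open Scope ring_scope.
Local Open Scope quotient_scope.

(* Quotients of free commutative monoids. A word is a finite formal sum of
   letters; [abcong base] is the smallest congruence containing [base] for
   which concatenation is commutative. Tensor products and abelian groups given
   by generators and relations are both instances. *)
Inductive abcong (L : Type) (base : seq L -> seq L -> Prop) :
    seq L -> seq L -> Prop :=
| abc_base s t : base s t -> abcong base s t
| abc_refl s : abcong base s s
| abc_sym s t : abcong base s t -> abcong base t s
| abc_trans s t u : abcong base s t -> abcong base t u -> abcong base s u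
| abc_cat s t s' t' :
    abcong base s t -> abcong base s' t' -> abcong base (s ++ s') (t ++ t')
| abc_comm s t : abcong base (s ++ t) (t ++ s).

Section AbQuotient.
Variables (L : Type) (base : seq L -> seq L -> Prop).

Definition word := {classic seq L}.
Definition abrel (s t : word) : bool := `[< abcong base s t >].

Lemma abrel_equiv : equiv_class_of abrel.
Proof.
split.
- by move=> s; apply/asboolP/abc_refl.
- by move=> s t; apply/asboolP/asboolP; apply: abc_sym.
- by move=> t s u /asboolP st /asboolP tu; apply/asboolP/(abc_trans st tu).
Qed.

Canonical abrel_equiv_rel := EquivRelPack abrel_equiv.

Definition abquot := {eq_quot abrel_equiv_rel}.
HB.instance Definition _ := Choice.on abquot.
HB.instance Definition _ := EqQuotient.on abquot.

Definition abclass (s : seq L) : abquot := \pi_abquot (s : word).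

Lemma abclassP (s t : seq L) : abclass s = abclass t <-> abcong base s t.
Proof.
split=> [/eqmodP/asboolP//|st].
by apply/eqmodP/asboolP.
Qed.

Lemma abclass_repr (x : abquot) : abclass (repr x) = x.
Proof. exact: reprK. Qed.

Lemma abcong_repr (s : seq L) : abcong base (repr (abclass s)) s.
Proof. by apply/abclassP; rewrite abclass_repr. Qed.

Definition abadd (x y : abquot) : abquot :=
  abclass ((repr x : seq L) ++ (repr y : seq L)).

Lemma abaddE (s t : seq L) : abadd (abclass s) (abclass t) = abclass (s ++ t).
Proof. by apply/abclassP/abc_cat; apply: abcong_repr. Qed.

Lemma abaddA : associative abadd.
Proof.
move=> x y z; rewrite -(abclass_repr x) -(abclass_repr y) -(abclass_repr z).
by rewrite !abaddE catA.
Qed.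

Lemma abaddC : commutative abadd.
Proof. by move=> x y; apply/abclassP/abc_comm. Qed.

Lemma abadd0 : left_id (abclass [::]) abadd.
Proof. by move=> x; rewrite -(abclass_repr x) abaddE. Qed.

HB.instance Definition _ := GRing.isNmodule.Build abquot abaddA abaddC abadd0.

Lemma abclass_cat (s t : seq L) : abclass (s ++ t) = abclass s + abclass t.
Proof. by rewrite -abaddE. Qed.

Lemma abclass_sum (s : seq L) : abclass s = \sum_(l <- s) abclass [:: l].
Proof.
elim: s => [|l s IH]; first by rewrite big_nil.
by rewrite big_cons -cat1s abclass_cat IH.
Qed.

Section Opposite.
Variable neg : L -> L.
Hypothesis negP : forall l, abcong base [:: l; neg l] [::].

Definition abopp (x : abquot) : abquot := abclass (map neg (repr x : seq L)).

Lemma abaddN : left_inverse 0 abopp +%R.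
Proof.
move=> x; rewrite -[in X in _ + X](abclass_repr x) /abopp.
elim: (repr x : seq L) => [|l s IH] /=; first by rewrite -abclass_cat.
have cons m t : abclass (m :: t) = abclass [:: m] + abclass t.
  by rewrite -abclass_cat.
rewrite (cons (neg l)) (cons l) addrACA IH addr0 addrC -abclass_cat.
exact/abclassP/negP.
Qed.

End Opposite.
End AbQuotient.

Section Bilinear.
Variables (K : fieldType) (V W U : lmodType K).

Definition bilin (F : V -> W -> U) : Prop :=
  (forall w, linear (F ^~ w)) /\ (forall v, linear (F v)).

End Bilinear.

(* The algebraic tensor product: formal sums of pairs modulo bilinearity. *)
Section Tensor.
Variables (K : fieldType) (V W : lmodType K).

Inductive tens_base : seq (V * W) -> seq (V * W) -> Prop :=
| tens_base_addl v v' w : tens_base [:: (v + v', w)] [:: (v, w); (v', w)]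
| tens_base_addr v w w' : tens_base [:: (v, w + w')] [:: (v, w); (v, w')]
| tens_base_scale k v w : tens_base [:: (k *: v, w)] [:: (v, k *: w)]
| tens_base_zero w : tens_base [:: (0, w)] [::].

Definition tensor := abquot tens_base.
HB.instance Definition _ := GRing.Nmodule.on tensor.

Definition tens (v : V) (w : W) : tensor := abclass tens_base [:: (v, w)].

Let neg (p : V * W) := (- p.1, p.2).

Lemma tens_negP p : abcong tens_base [:: p; neg p] [::].
Proof.
case: p => v w; apply: abc_trans (abc_base (tens_base_zero w)).
by apply/abc_sym/abc_base; rewrite -(subrr v); apply: tens_base_addl.
Qed.

HB.instance Definition _ :=
  GRing.Nmodule_isZmodule.Build tensor (abaddN tens_negP).

(* [tlift F] is the linear map induced by a bilinear [F]: the sum of [F v w]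
   over a chosen representative of the argument. It is a total function of [F],
   but only meaningful for bilinear [F] (see [tlift_tens], [tlift_linear]). *)
Definition tlift (U : nmodType) (F : V -> W -> U) (t : tensor) : U :=
  \sum_(p <- (repr t : seq (V * W))) F p.1 p.2.

Lemma tlift_class (U : lmodType K) (F : V -> W -> U) (s : seq (V * W)) :
  bilin F -> tlift F (abclass tens_base s) = \sum_(p <- s) F p.1 p.2.
Proof.
case=> Fl Fr.
suff cong s1 s2 : abcong tens_base s1 s2 ->
    \sum_(p <- s1) F p.1 p.2 = \sum_(p <- s2) F p.1 p.2.
  exact/cong/abcong_repr.
have Fl0 w : F 0 w = 0.
  by have := Fl w (-1) 0 0; rewrite /= scaler0 addr0 scaleN1r addNr.
have Fr0 v : F v 0 = 0.
  by have := Fr v (-1) 0 0; rewrite scaler0 addr0 scaleN1r addNr.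
elim=> {s1 s2} [s1 s2 []|//|//|s1 s2 s3 _ -> _ ->//||].
- move=> v v' w; rewrite !big_cons !big_nil /= !addr0.
  by have := Fl w 1 v v'; rewrite /= !scale1r.
- move=> v w w'; rewrite !big_cons !big_nil /= !addr0.
  by have := Fr v 1 w w'; rewrite /= !scale1r.
- move=> k v w; rewrite !big_cons !big_nil /= !addr0.
  have := Fl w k v 0; have := Fr v k w 0.
  by rewrite /= Fl0 Fr0 !addr0 => -> ->.
- by move=> w; rewrite big_cons !big_nil /= Fl0 addr0.
- by move=> s1 s2 s3 s4 _ IH1 _ IH2; rewrite !big_cat /= IH1 IH2.
- by move=> s1 s2; rewrite !big_cat /= addrC.
Qed.

Lemma tlift_tens (U : lmodType K) (F : V -> W -> U) v w :
  bilin F -> tlift F (tens v w) = F v w.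
Proof. by move=> Fb; rewrite tlift_class// big_seq1. Qed.

Lemma tens_sum (t : tensor) :
  t = \sum_(p <- (repr t : seq (V * W))) tens p.1 p.2.
Proof.
rewrite -[LHS]abclass_repr [LHS]abclass_sum.
by apply: eq_bigr => -[].
Qed.

Definition tscale (k : K) (t : tensor) : tensor :=
  abclass tens_base [seq (k *: p.1, p.2) | p <- (repr t : seq (V * W))].

Lemma tscale_class k (s : seq (V * W)) :
  tscale k (abclass tens_base s) =
  abclass tens_base [seq (k *: p.1, p.2) | p <- s].
Proof.
suff cong s1 s2 : abcong tens_base s1 s2 -> abcong tens_base
    [seq (k *: p.1, p.2) | p <- s1] [seq (k *: p.1, p.2) | p <- s2].
  exact/abclassP/cong/abcong_repr.
elim=> {s s1 s2}.
- move=> s t [] /=.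
  + by move=> v v' w; rewrite scalerDr; apply/abc_base/tens_base_addl.
  + by move=> v w w'; apply/abc_base/tens_base_addr.
  + move=> l v w; rewrite scalerA mulrC -scalerA.
    exact/abc_base/tens_base_scale.
  + by move=> w; rewrite scaler0; apply/abc_base/tens_base_zero.
- by move=> s; apply: abc_refl.
- by move=> s t _; apply: abc_sym.
- by move=> s t u _ + _; apply: abc_trans.
- by move=> s t s' t' _ + _; rewrite !map_cat; apply: abc_cat.
- by move=> s t; rewrite !map_cat; apply: abc_comm.
Qed.

Lemma tscaleA k l t : tscale k (tscale l t) = tscale (k * l) t.
Proof.
rewrite -(abclass_repr t) !tscale_class -map_comp.
by congr abclass; apply: eq_map => p /=; rewrite scalerA.
Qed.

Lemma tscale1 : left_id 1 tscale.
Proof.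
move=> t; rewrite -(abclass_repr t) tscale_class; congr abclass.
by rewrite -[RHS]map_id; apply: eq_map => -[v w] /=; rewrite scale1r.
Qed.

Lemma tscaleDr : right_distributive tscale +%R.
Proof.
move=> k s t; rewrite -(abclass_repr s) -(abclass_repr t) -abclass_cat.
by rewrite !tscale_class map_cat abclass_cat.
Qed.

Lemma tscaleDl t : {morph tscale^~ t : k l / k + l}.
Proof.
move=> k l; rewrite -(abclass_repr t) !tscale_class.
elim: (repr t : seq (V * W)) => [|[v w] s IH] /=; first by rewrite -abclass_cat.
have cons p r : abclass tens_base (p :: r) =
    abclass tens_base [:: p] + abclass tens_base r by rewrite -abclass_cat.
rewrite ![abclass _ (_ :: map _ s)]cons IH addrACA; congr (_ + _).
rewrite -abclass_cat.
apply/abclassP/abc_base; rewrite scalerDl; apply: tens_base_addl.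
Qed.

HB.instance Definition _ := GRing.Zmodule_isLmodule.Build K tensor
  tscaleA tscale1 tscaleDr tscaleDl.

Lemma tens_bilin : bilin tens.
Proof.
split=> [w k v v'|v k w w'].
  rewrite -[k *: tens v w]/(tscale k (tens v w)) tscale_class -abclass_cat /=.
  exact/abclassP/abc_base/tens_base_addl.
rewrite -[k *: tens v w]/(tscale k (tens v w)) tscale_class /=.
have -> : abclass tens_base [:: (k *: v, w)] = tens v (k *: w).
  exact/abclassP/abc_base/tens_base_scale.
rewrite /tens -abclass_cat /=.
exact/abclassP/abc_base/tens_base_addr.
Qed.

Lemma tlift_linear (U : lmodType K) (F : V -> W -> U) :
  bilin F -> linear (tlift F).
Proof.
move=> Fb k s t; rewrite -(abclass_repr s) -(abclass_repr t).
have -> : k *: (abclass tens_base (repr s) : tensor) =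
    abclass tens_base [seq (k *: p.1, p.2) | p <- repr s] := tscale_class k _.
have -> (r r' : seq (V * W)) :
    (abclass tens_base r : tensor) + abclass tens_base r' =
    abclass tens_base (r ++ r') by rewrite abclass_cat.
rewrite !tlift_class// big_cat /= big_map scaler_sumr; congr (_ + _).
apply: eq_bigr => -[v w] _ /=; case: Fb => Fl _.
have Fl0 : F 0 w = 0.
  by have := Fl w (-1) 0 0; rewrite /= scaler0 addr0 scaleN1r addNr.
by have := Fl w k v 0; rewrite /= Fl0 !addr0.
Qed.

End Tensor.

Notation "v \ox w" := (tens v w) (at level 40, left associativity).

Section TensorMaps.
Variable K : fieldType.

(* (v1 (x) w1, v2 (x) w2) |-> F v1 v2 (x) G w1 w2 *)
Definition tmap2 (V1 V2 V W1 W2 W : lmodType K)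
    (F : V1 -> V2 -> V) (G : W1 -> W2 -> W)
    (s : tensor V1 W1) (t : tensor V2 W2) : tensor V W :=
  tlift (fun v1 w1 => tlift (fun v2 w2 => F v1 v2 \ox G w1 w2) t) s.

(* [tpow V n] is V^{(x)(n+1)}, bracketed to the right. *)
Fixpoint tpow (V : lmodType K) (n : nat) : lmodType K :=
  if n is m.+1 then tensor V (tpow V m) else V.

(* s_0 (x) ... (x) s_n, for a sequence [s] of size n+1 *)
Fixpoint tpure (V : lmodType K) (n : nat) (s : seq V) : tpow V n :=
  if n is m.+1 return tpow V n
  then head 0 s \ox tpure m (behead s) else head 0 s.

(* The linear map on V^{(x)(n+1)} induced by a multilinear function, given as a
   function of the sequence of its n+1 arguments. *)
Fixpoint tpow_lift (V : lmodType K) (U : nmodType) (n : nat) :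
    (seq V -> U) -> tpow V n -> U :=
  if n is m.+1 return (seq V -> U) -> tpow V n -> U
  then fun F => tlift (fun v => tpow_lift (fun s => F (v :: s)))
  else fun F v => F [:: v].

(* The multilinear extension to sequences of elements of V (x) W of a function
   of sequences of pairs (v_i, w_i). *)
Fixpoint tens_mlift (V W : lmodType K) (U : nmodType)
    (F : seq (V * W) -> U) (ts : seq (tensor V W)) : U :=
  if ts is t :: ts'
  then tlift (fun v w => tens_mlift (fun s => F ((v, w) :: s)) ts') t
  else F [::].

End TensorMaps.

(* Unital associative algebras, possibly zero (unlike [algType]) *)
Record unitalAlg (K : fieldType) := UnitalAlg {
  ualg_mod :> lmodType K;
  umul : ualg_mod -> ualg_mod -> ualg_mod;
  uone : ualg_mod;
  umul_bilin : bilin umul;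
  umulA : associative umul;
  umul1l : left_id uone umul;
  umul1r : right_id uone umul }.

Arguments umul {K u}.
Arguments uone {K u}.

Record hopfAlg (K : fieldType) := HopfAlg {
  hopf_alg :> algType K;
  comul : {linear hopf_alg -> tensor hopf_alg hopf_alg};
  counit : {linear hopf_alg -> K^o};
  antipode : {linear hopf_alg -> hopf_alg};
  antipodeV : hopf_alg -> hopf_alg;
  comul1 : comul 1 = 1 \ox 1;
  comulM : forall x y, comul (x * y) = tmap2 *%R *%R (comul x) (comul y);
  counit1 : counit 1 = 1;
  counitM : forall x y, counit (x * y) = counit x * counit y;
  comulA : forall x,
    tlift (fun y c => tlift (fun a b => a \ox (b \ox c)) (comul y)) (comul x)
    = tlift (fun a y => a \ox comul y) (comul x);
  comul_counitl : forall x, tlift (fun a b => counit a *: b) (comul x) = x;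
  comul_counitr : forall x, tlift (fun a b => counit b *: a) (comul x) = x;
  antipodel : forall x,
    tlift (fun a b => antipode a * b) (comul x) = counit x *: 1;
  antipoder : forall x,
    tlift (fun a b => a * antipode b) (comul x) = counit x *: 1;
  antipodeK : cancel antipode antipodeV;
  antipodeVK : cancel antipodeV antipode }.

Arguments comul {K h}.
Arguments counit {K h}.
Arguments antipode {K h}.
Arguments antipodeV {K h}.

Section Sweedler.
Variables (K : fieldType) (H : hopfAlg K) (U : nmodType).

Definition sweedler2 (F : H -> H -> U) (x : H) : U := tlift F (comul x).

Definition sweedler3 (F : H -> H -> H -> U) (x : H) : U :=
  sweedler2 (fun x0 y => sweedler2 (F x0) y) x.

End Sweedler.

Section Modules.
Variables (K : fieldType) (H : hopfAlg K).

Record rmodule_axioms (V : lmodType K) (act : V -> H -> V) : Prop := {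
  rmod_bilin : bilin act;
  rmod_act1 : forall v, act v 1 = v;
  rmod_actM : forall v x y, act v (x * y) = act (act v x) y }.

Record modAlg := ModAlg {
  modalg_alg :> unitalAlg K;
  modalg_act : modalg_alg -> H -> modalg_alg;
  modalg_rmod : rmodule_axioms modalg_act;
  modalg_actM : forall b1 b2 x, modalg_act (umul b1 b2) x =
    sweedler2 (fun x0 x1 => umul (modalg_act b1 x0) (modalg_act b2 x1)) x;
  modalg_act1 : forall x, modalg_act uone x = counit x *: (uone : modalg_alg) }.

Record fdMod := FdMod {
  fdmod_vect :> vectType K;
  fdmod_act : fdmod_vect -> H -> fdmod_vect;
  fdmod_rmod : rmodule_axioms fdmod_act }.

Definition rinvariant (V : lmodType K) (act : V -> H -> V) (v : V) : Prop :=
  forall x, act v x = counit x *: v.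

Definition tensor_act (V W : lmodType K) (aV : V -> H -> V) (aW : W -> H -> W)
    (t : tensor V W) (x : H) : tensor V W :=
  tlift (fun v w => sweedler2 (fun x0 x1 => aV v x0 \ox aW w x1) x) t.

Fixpoint tpow_act (V : lmodType K) (aV : V -> H -> V) (n : nat) :
    tpow V n -> H -> tpow V n :=
  if n is m.+1 return tpow V n -> H -> tpow V n
  then tensor_act aV (tpow_act aV (n := m)) else aV.

(* The right H-module structure on H used throughout:
   y <| x = S^-1(x_0) y x_1. *)
Definition adj_act (y x : H) : H :=
  sweedler2 (fun x0 x1 => antipodeV x0 * y * x1) x.

End Modules.

Arguments modalg_act {K H m}.
Arguments fdmod_act {K H} f.

Section CyclicCohomology.
Variables (K : fieldType) (H : hopfAlg K).

(* H (x) V^{(x)(n+1)} *)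
Definition chain (V : lmodType K) (n : nat) : lmodType K :=
  tensor H (tpow V n).

Definition chain_pure (V : lmodType K) (n : nat) (x : H) (s : seq V) :
    chain V n := x \ox tpure n s.

(* The linear map on H (x) V^{(x)(n+1)} with value [F x [:: v_0; ..; v_n]]
   at x (x) v_0 (x) ... (x) v_n *)
Definition chain_lift (V : lmodType K) (n : nat) (U : nmodType)
    (F : H -> seq V -> U) : chain V n -> U :=
  tlift (fun x => tpow_lift (F x)).

Variable B : modAlg H.

Definition chain_act (n : nat) : chain B n -> H -> chain B n :=
  tensor_act (@adj_act K H) (tpow_act (@modalg_act K H B) (n := n)).

Definition is_cochain (n : nat) (f : chain B n -> K) : Prop :=
  linear (f : chain B n -> K^o) /\
  forall z x, f (chain_act z x) = counit x * f z.

(* t_n *)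
Definition cyc (n : nat) (f : chain B n -> K) : chain B n -> K :=
  chain_lift (fun x s => sweedler2 (fun x0 x1 =>
    f (chain_pure n x0 (modalg_act (last 0 s) x1 :: take n s))) x).

(* d_i^{n+1} for i <= n: multiply the arguments i and i+1 *)
Definition face_mul (n i : nat) (f : chain B n -> K) : chain B n.+1 -> K :=
  chain_lift (fun x s =>
    f (chain_pure n x (take i s ++ umul s`_i s`_i.+1 :: drop i.+2 s))).

(* d_i^{n+1} for i <= n+1 *)
Definition face (n i : nat) (f : chain B n -> K) : chain B n.+1 -> K :=
  if (i <= n)%N then face_mul i f else cyc (face_mul 0 f).

Definition hochb (n : nat) (f : chain B n -> K) : chain B n.+1 -> K :=
  \sum_(i < n.+2) (fun z => (-1) ^+ i * face i f z).

(* lambda_n *)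
Definition cyclam (n : nat) (f : chain B n -> K) : chain B n -> K :=
  fun z => (-1) ^+ n * cyc f z.

Definition is_cyclic_cochain (n : nat) (f : chain B n -> K) : Prop :=
  is_cochain f /\ cyclam f = f.

Definition is_cyclic_cocycle (n : nat) (f : chain B n -> K) : Prop :=
  is_cyclic_cochain f /\ hochb f = 0.

Definition is_cyclic_coboundary (n : nat) : (chain B n -> K) -> Prop :=
  if n is m.+1 return (chain B n -> K) -> Prop
  then fun f => exists h : chain B m -> K, is_cyclic_cochain h /\ f = hochb h
  else fun f => f = 0.

Lemma chain_liftB (V : lmodType K) n (U : zmodType) (F G : H -> seq V -> U) z :
  chain_lift (n := n) (fun x s => F x s - G x s) z =
  chain_lift F z - chain_lift G z.
Proof.
have tpow_liftB m (F' G' : seq V -> U) (y : tpow V m) :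
    tpow_lift (fun s => F' s - G' s) y = tpow_lift F' y - tpow_lift G' y.
  elim: m => [//|m IH] in F' G' y *; rewrite /= /tlift -sumrB.
  by apply: eq_bigr => p _; rewrite IH.
by rewrite /chain_lift /tlift -sumrB; apply: eq_bigr => p _; rewrite tpow_liftB.
Qed.

Lemma cycB n (f g : chain B n -> K) : cyc (f - g) = cyc f - cyc g.
Proof.
apply/funext => z; transitivity (cyc f z - cyc g z) => //.
rewrite /cyc -chain_liftB.
congr chain_lift; apply/funext => x; apply/funext => s.
by rewrite /sweedler2 /tlift -sumrB.
Qed.

Lemma face_mulB n i (f g : chain B n -> K) :
  face_mul i (f - g) = face_mul i f - face_mul i g.
Proof.
apply/funext => z.
transitivity (face_mul i f z - face_mul i g z) => //.
by rewrite /face_mul -chain_liftB.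
Qed.

Lemma hochbB n (f g : chain B n -> K) : hochb (f - g) = hochb f - hochb g.
Proof.
rewrite /hochb -sumrB; apply: eq_bigr => i _; apply/funext => z.
transitivity ((-1) ^+ i * face i f z - (-1) ^+ i * face i g z) => //.
rewrite -mulrBr; congr (_ * _).
by rewrite /face; case: ifP => _; rewrite face_mulB ?cycB.
Qed.

Lemma hochb0 n : hochb (0 : chain B n -> K) = 0.
Proof. by rewrite -[X in hochb X](subrr 0) hochbB subrr. Qed.

Lemma is_cyclic_cochain0 n : is_cyclic_cochain (0 : chain B n -> K).
Proof.
split; first split.
- by move=> k s t; rewrite /= scaler0 addr0.
- by move=> z x; rewrite mulr0.
- apply/funext => z; rewrite /cyclam -[X in cyc X](subrr 0) cycB subrr.
  by rewrite mulr0.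
Qed.

Lemma is_cyclic_cochainB n (f g : chain B n -> K) :
  is_cyclic_cochain f -> is_cyclic_cochain g -> is_cyclic_cochain (f - g).
Proof.
move=> [[fl fi] fc] [[gl gi] gc]; split; first split.
- move=> k s t; rewrite -[LHS]/(f _ - g _) fl gl opprD addrACA.
  by congr (_ + _); rewrite -[RHS]/(k * (f s - g s)) mulrBr.
- by move=> z x; rewrite -[LHS]/(f _ - g _) fi gi -mulrBr.
- apply/funext => z; rewrite /cyclam cycB.
  transitivity (cyclam f z - cyclam g z); last by rewrite fc gc.
  by rewrite /cyclam -mulrBr.
Qed.

Lemma is_cyclic_coboundary0 n : is_cyclic_coboundary (0 : chain B n -> K).
Proof.
by case: n => [//|n]; exists 0; split; [exact: is_cyclic_cochain0|rewrite hochb0].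
Qed.

Lemma is_cyclic_coboundaryB n (f g : chain B n -> K) :
  is_cyclic_coboundary f -> is_cyclic_coboundary g ->
  is_cyclic_coboundary (f - g).
Proof.
case: n f g => [|n] f g /=; first by move=> -> ->; rewrite subrr.
move=> [h [hc ->]] [k [kc ->]]; exists (h - k); split.
  exact: is_cyclic_cochainB.
by rewrite hochbB.
Qed.

(* HC^n is the n-th cohomology group of (Ker(1 - lambda), b). *)
Section Cohomology.
Variable n : nat.

Definition cocycle_pred : {pred chain B n -> K} :=
  fun f => `[< is_cyclic_cocycle f >].

Lemma cocycle_zmod_closed : zmod_closed cocycle_pred.
Proof.
split=> [|f g /asboolP[fc bf] /asboolP[gc bg]]; apply/asboolP.
  by split; [exact: is_cyclic_cochain0|exact: hochb0].
by split; [exact: is_cyclic_cochainB|rewrite hochbB bf bg subrr].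
Qed.

HB.instance Definition _ :=
  GRing.isZmodClosed.Build _ cocycle_pred cocycle_zmod_closed.

Record cocycle := Cocycle {
  cocycle_fun :> chain B n -> K;
  cocycleP : cocycle_fun \in cocycle_pred }.

HB.instance Definition _ := [isSub for cocycle_fun].
HB.instance Definition _ := [Choice of cocycle by <:].
HB.instance Definition _ := [SubChoice_isSubZmodule of cocycle by <:].

Definition coboundary_pred : {pred cocycle} :=
  fun f => `[< is_cyclic_coboundary (f : chain B n -> K) >].

Lemma coboundary_zmod_closed : zmod_closed coboundary_pred.
Proof.
split=> [|f g /asboolP fb /asboolP gb]; apply/asboolP.
  exact: is_cyclic_coboundary0.
exact: is_cyclic_coboundaryB fb gb.
Qed.

HB.instance Definition _ :=
  GRing.isZmodClosed.Build _ coboundary_pred coboundary_zmod_closed.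

Definition HC := {ideal_quot coboundary_pred}.
HB.instance Definition _ := GRing.Zmodule.on HC.

Definition HC_class (f : cocycle) : HC := \pi_HC f.

End Cohomology.
End CyclicCohomology.

Section RH.
Variables (K : fieldType) (H : hopfAlg K).

Definition RH_pred : {pred H -> K} := fun g => `[<
  linear (g : H -> K^o) /\
  forall x y, g (adj_act y x) = counit x * g y >].

Lemma RH_zmod_closed : zmod_closed RH_pred.
Proof.
split=> [|f g /asboolP[fl fi] /asboolP[gl gi]]; apply/asboolP; split.
- by move=> k s t; rewrite /= scaler0 addr0.
- by move=> z x; rewrite mulr0.
- move=> k s t; rewrite -[LHS]/(f _ - g _) fl gl opprD addrACA.
  by congr (_ + _); rewrite -[RHS]/(k * (f s - g s)) mulrBr.
- by move=> z x; rewrite -[LHS]/(f _ - g _) fi gi -mulrBr.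
Qed.

HB.instance Definition _ := GRing.isZmodClosed.Build _ RH_pred RH_zmod_closed.

Record RH := MkRH { RH_fun :> H -> K; RH_funP : RH_fun \in RH_pred }.

HB.instance Definition _ := [isSub for RH_fun].
HB.instance Definition _ := [Choice of RH by <:].
HB.instance Definition _ := [SubChoice_isSubZmodule of RH by <:].

End RH.

(* The abelian group with generators G, subject to the relations
   [sum of s = sum of t] whenever [rel s t]. The letter (true, g) stands for
   the opposite of the generator g. K_0 and K_1 are generated by classes of
   arbitrary finite dimensional modules, a type too large for the universe of
   [zmodType]; hence the group is a plain type of congruence classes. *)
Section PresentedGroup.
Variables (G : Type) (rel : seq G -> seq G -> Prop).

Inductive pres_base : seq (bool * G) -> seq (bool * G) -> Prop :=
| pres_base_rel s t : rel s t ->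
    pres_base [seq (false, g) | g <- s] [seq (false, g) | g <- t]
| pres_base_opp b g : pres_base [:: (b, g); (~~ b, g)] [::].

Definition presgroup : Type :=
  {P : seq (bool * G) -> Prop | exists s, P = abcong pres_base s}.

Definition presclass (s : seq (bool * G)) : presgroup :=
  exist _ (abcong pres_base s) (ex_intro _ s erefl).

Definition presrepr (x : presgroup) : seq (bool * G) := sval (cid (svalP x)).

Lemma presclassP s t : presclass s = presclass t <-> abcong pres_base s t.
Proof.
split=> [[->]|st]; first exact: abc_refl.
apply/eq_exist; apply/funext => u; apply/propext; split; apply: abc_trans => //.
exact: abc_sym.
Qed.

Lemma presclass_repr x : presclass (presrepr x) = x.
Proof.
rewrite /presrepr; case: cid => s /=; case: x => P hP /= sx.
by rewrite /presclass; apply/eq_exist.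
Qed.

Definition presadd (x y : presgroup) : presgroup :=
  presclass (presrepr x ++ presrepr y).
Definition presopp (x : presgroup) : presgroup :=
  presclass [seq (~~ p.1, p.2) | p <- presrepr x].
Definition pres0 : presgroup := presclass [::].
Definition presgen (g : G) : presgroup := presclass [:: (false, g)].

Lemma presaddE s t : presadd (presclass s) (presclass t) = presclass (s ++ t).
Proof. by apply/presclassP/abc_cat; apply/presclassP; exact: presclass_repr. Qed.

Lemma presaddA : associative presadd.
Proof.
move=> x y z.
rewrite -(presclass_repr x) -(presclass_repr y) -(presclass_repr z).
by rewrite !presaddE catA.
Qed.

Lemma presaddC : commutative presadd.
Proof. by move=> x y; apply/presclassP/abc_comm. Qed.

Lemma presadd0 : left_id pres0 presadd.
Proof. by move=> x; rewrite -(presclass_repr x) presaddE. Qed.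

Lemma presaddN : left_inverse pres0 presopp presadd.
Proof.
move=> x; rewrite -[in X in presadd _ X](presclass_repr x) /presopp.
have cons p t : presclass (p :: t) = presadd (presclass [:: p]) (presclass t).
  by rewrite presaddE.
elim: (presrepr x) => [|[b g] s IH] /=; first by rewrite presaddE.
rewrite (cons (~~ b, g)) (cons (b, g)) -presaddA.
rewrite [presadd _ (presadd _ (presclass s))]presaddA.
rewrite [presadd _ (presclass [:: (b, g)])]presaddC -presaddA IH presaddA.
rewrite presaddC presadd0 presaddE; apply/presclassP.
case: b; apply/abc_base.
  exact: (pres_base_opp false).
exact: (pres_base_opp true).
Qed.

End PresentedGroup.

Section DirectSum.
Variables (K : fieldType) (H : hopfAlg K) (X1 X2 : fdMod H).

Definition dsum_act (v : X1 * X2) (x : H) : X1 * X2 :=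
  (fdmod_act X1 v.1 x, fdmod_act X2 v.2 x).

Lemma dsum_rmod : rmodule_axioms dsum_act.
Proof.
have [[b1l b1r] a1 m1] := fdmod_rmod X1; have [[b2l b2r] a2 m2] := fdmod_rmod X2.
split=> [|[v1 v2]|[v1 v2] x y]; rewrite /dsum_act /= ?a1 ?a2 ?m1 ?m2//.
split=> [x k v v'|v k x y] /=.
  by rewrite (b1l x k) (b2l x k).
by rewrite (b1r v.1 k) (b2r v.2 k).
Qed.

Definition dsum : fdMod H := FdMod dsum_rmod.

Definition dsum_in1 : 'Hom(X1, dsum) := linfun (fun v : X1 => (v, 0) : X1 * X2).
Definition dsum_in2 : 'Hom(X2, dsum) := linfun (fun v : X2 => (0, v) : X1 * X2).
Definition dsum_pr1 : 'Hom(dsum, X1) := linfun (fun v : X1 * X2 => v.1).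
Definition dsum_pr2 : 'Hom(dsum, X2) := linfun (fun v : X1 * X2 => v.2).

End DirectSum.

Section KTheory.
Variables (K : fieldType) (H : hopfAlg K) (B : modAlg H).

(* pi_X(x) *)
Definition rmod_rep (X : fdMod H) (x : H) : 'End(X) :=
  linfun (fdmod_act X ^~ x).

(* Hom(X, X') (x) B *)
Definition homB (X X' : fdMod H) : lmodType K := tensor 'Hom(X, X') B.

Definition homB_mul (X X' X'' : fdMod H) (s : homB X' X'') (t : homB X X') :
  homB X X'' := tmap2 (fun T T' => (T \o T')%VF) umul s t.

Definition homB1 (X : fdMod H) : homB X X := \1%VF \ox uone.

Definition homB_act (X X' : fdMod H) (t : homB X X') (x : H) : homB X X' :=
  tlift (fun T b => sweedler3 (fun x0 x1 x2 =>
    (rmod_rep X' x0 \o T \o rmod_rep X (antipodeV x2))%VF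
      \ox modalg_act b x1) x) t.

Definition homB_inv (X X' : fdMod H) (t : homB X X') : Prop :=
  rinvariant (@homB_act X X') t.

(* T (x) b |-> A T A' (x) b *)
Definition homB_conj (X X' Y Y' : fdMod H) (A : 'Hom(X', Y')) (A' : 'Hom(Y, X))
    (t : homB X X') : homB Y Y' :=
  tlift (fun T b => (A \o T \o A')%VF \ox b) t.

(* The block matrices diag(s1, s2) and (s1 t; 0 s2) *)
Definition homB_diag (X1 X2 : fdMod H) (s1 : homB X1 X1) (s2 : homB X2 X2) :
    homB (dsum X1 X2) (dsum X1 X2) :=
  homB_conj (dsum_in1 X1 X2) (dsum_pr1 X1 X2) s1 +
  homB_conj (dsum_in2 X1 X2) (dsum_pr2 X1 X2) s2.

Definition homB_upper (X1 X2 : fdMod H) (s1 : homB X1 X1) (t : homB X2 X1)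
    (s2 : homB X2 X2) : homB (dsum X1 X2) (dsum X1 X2) :=
  homB_diag s1 s2 + homB_conj (dsum_in1 X1 X2) (dsum_pr2 X1 X2) t.

Record invIdem (X : fdMod H) := InvIdem {
  invIdem_val :> homB X X;
  invIdem_idem : homB_mul invIdem_val invIdem_val = invIdem_val;
  invIdem_inv : homB_inv invIdem_val }.

Definition idem_equiv (X X' : fdMod H) (p : homB X X) (p' : homB X' X') : Prop :=
  exists (g : homB X X') (g' : homB X' X),
    [/\ homB_inv g, homB_inv g', homB_mul g g' = p' & homB_mul g' g = p].

(* The Grothendieck group of the semigroup of classes of invariant idempotents
   is the abelian group generated by these classes, with the direct sums of the
   semigroup as relations. *)
Inductive K0_rel : seq {X : fdMod H & invIdem X} ->
    seq {X : fdMod H & invIdem X} -> Prop :=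
| K0_rel_equiv (X X' : fdMod H) (p : invIdem X) (p' : invIdem X') :
    idem_equiv p p' -> K0_rel [:: existT _ X p] [:: existT _ X' p']
| K0_rel_sum (X1 X2 : fdMod H) (p1 : invIdem X1) (p2 : invIdem X2)
    (p : invIdem (dsum X1 X2)) : homB_diag p1 p2 = p ->
    K0_rel [:: existT _ (dsum X1 X2) p] [:: existT _ X1 p1; existT _ X2 p2].

Definition K0 := presgroup K0_rel.

Definition K0_class (X : fdMod H) (p : invIdem X) : K0 :=
  presgen K0_rel (existT _ X p).

Definition homB_inverse (X : fdMod H) (u v : homB X X) : Prop :=
  homB_mul u v = homB1 X /\ homB_mul v u = homB1 X.

Record invUnit (X : fdMod H) := InvUnit {
  invUnit_val :> homB X X;
  invUnit_unit : exists v, homB_inverse invUnit_val v;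
  invUnit_inv : homB_inv invUnit_val }.

(* The action of Hom(X, X') (x) B on X (x) B *)
Definition homB_app (X X' : fdMod H) (s : homB X X') (z : tensor X B) :
  tensor X' B := tmap2 (fun (T : 'Hom(X, X')) (v : X) => T v) umul s z.

Definition is_equiv_iso (X X' : fdMod H) (phi : tensor X B -> tensor X' B) :
    Prop :=
  [/\ linear phi, bijective phi,
      forall z b, phi (tlift (fun v c => v \ox umul c b) z) =
                  tlift (fun v c => v \ox umul c b) (phi z) &
      forall z x, phi (tensor_act (fdmod_act X) modalg_act z x) =
                  tensor_act (fdmod_act X') modalg_act (phi z) x].

Definition unit_iso (X X' : fdMod H) (u : homB X X) (u' : homB X' X') : Prop :=
  exists phi : tensor X B -> tensor X' B, is_equiv_iso phi /\
    forall z, phi (homB_app u z) = homB_app u' (phi z).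

Inductive K1_rel : seq {X : fdMod H & invUnit X} ->
    seq {X : fdMod H & invUnit X} -> Prop :=
| K1_rel_iso (X X' : fdMod H) (u : invUnit X) (u' : invUnit X') :
    unit_iso u u' -> K1_rel [:: existT _ X u] [:: existT _ X' u']
| K1_rel_mul (X : fdMod H) (u v w : invUnit X) : homB_mul u v = w ->
    K1_rel [:: existT _ X u; existT _ X v] [:: existT _ X w]
| K1_rel_upper (X1 X2 : fdMod H) (u1 : invUnit X1) (u2 : invUnit X2)
    (t : homB X2 X1) (w : invUnit (dsum X1 X2)) :
    homB_inv t -> homB_upper u1 t u2 = w ->
    K1_rel [:: existT _ X1 u1; existT _ X2 u2] [:: existT _ (dsum X1 X2) w].

Definition K1 := presgroup K1_rel.

Definition K1_class (X : fdMod H) (u : invUnit X) : K1 :=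
  presgen K1_rel (existT _ X u).

Definition lfun_tr (V : vectType K) (T : 'End(V)) : K :=
  \sum_(i < \dim {:V}) coord (vbasis {:V}) i (T (vbasis {:V})`_i).

Definition Psi (X : fdMod H) (n : nat) (f : chain H B n -> K) :
    chain H (homB X X) n -> K :=
  chain_lift (fun x => tens_mlift (fun s => sweedler2 (fun x0 x1 =>
    f (chain_pure n x0 [seq p.2 | p <- s]) *
    lfun_tr (rmod_rep X (antipodeV x1) \o
             foldr (fun p T => p.1 \o T) \1 s)%VF) x)).

End KTheory.

(* Main.v *)
From HB Require Import structures.
Require Import Defs.
From mathcomp Require Import all_boot all_order all_algebra.
From mathcomp Require Import zify ring complex boolp functions reals.

(* On H-invariant elements a_i of End(X) (x) B the Hopf-twisted rotation of
   [Psi f] is the usual one, since x_1 S^-1(x_0) contracts to a counit. Hence,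
   for each x in H, [Psi f] restricted to the algebra of invariants is an
   ordinary cyclic cocycle, and well-definedness is Connes' classical argument.
   Idempotents and invertibles are moved in End(X (+) X') (x) B along products of
   elementary matrices 1 + tN with N^2 = 0; along such a path the pairing is a
   polynomial in t whose derivative is a value of the coboundary b of the
   cocycle, hence 0. That x |-> Psi f (x, a_0, .., a_n) lies in R(H) follows from
   the invariance of f and of the product of the a_i, as all antipodes cancel. *)

Set Implicit Arguments.
Unset Strict Implicit.
Unset Printing Implicit Defensive.

Import GRing.Theory.
Local Open Scope ring_scope.
Local Open Scope complex_scope.

(** * Linearity and Sweedler calculus *)

Section Linear.
Variable K : fieldType.
Implicit Types U V W : lmodType K.

(** Square-zero elements come from direct sums: a block g from X to X', placed off the diagonal of X
    (+) X', satisfies g^2 = 0, so 1 + tg is invertible with inverse 1 - tg and every path used below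
    has degree at most 2 in t. Along 1 + tN the derivative of an idempotent e_t is the commutator of
    N and e_t, while for an invertible u_t the quotient u_t^-1 u_t' is constant in t; these are the
    two shapes in which the cocycle identity is applied. In odd degree the shift by 1 matters twice.
    The elements x = u - 1 and y = u^-1 - 1 satisfy xy = yx = -(x + y), which makes the alternating
    sums telescope; and u = 1 pairs to 0, so that diag(u, 1) has the same value as u. An isomorphism
    in the definition of K_1 is only a module map. It must first be turned into an element of Hom(X,
    X') (x) B, which is possible because X has a finite basis, and B-linearity fixes the map by its
    values on that basis. Characteristic 0 enters twice: a polynomial with zero derivative is
    constant, and a number equal to its opposite vanishes. *)

Definition lin V W (f : V -> W) : Prop :=
  forall k x y, f (k *: x + y) = k *: f x + f y.

Lemma linD V W (f : V -> W) : lin f -> {morph f : x y / x + y}.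
Proof. by move=> fl x y; have := fl 1 x y; rewrite !scale1r. Qed.

Lemma lin0 V W (f : V -> W) : lin f -> f 0 = 0.
Proof. by move=> fl; apply: (addrI (f 0)); rewrite -linD// !addr0. Qed.

Lemma linZ V W (f : V -> W) : lin f -> forall k x, f (k *: x) = k *: f x.
Proof. by move=> fl k x; have := fl k x 0; rewrite !addr0 lin0// addr0. Qed.

Lemma lin_sum V W (f : V -> W) : lin f ->
  forall (I : Type) (r : seq I) (F : I -> V),
  f (\sum_(i <- r) F i) = \sum_(i <- r) f (F i).
Proof.
move=> fl I r F; elim: r => [|i r IH]; first by rewrite !big_nil lin0.
by rewrite !big_cons linD// IH.
Qed.

Lemma lin_id V : lin (fun v : V => v).
Proof. by []. Qed.

Lemma lin_comp U V W (f : V -> W) (g : U -> V) :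
  lin f -> lin g -> lin (fun x => f (g x)).
Proof. by move=> fl gl k x y; rewrite gl fl. Qed.

Lemma lin_add V W (f g : V -> W) : lin f -> lin g -> lin (fun x => f x + g x).
Proof. by move=> fl gl k x y; rewrite fl gl scalerDr addrACA. Qed.

Lemma lin_scale V W c (f : V -> W) : lin f -> lin (fun x => c *: f x).
Proof. by move=> fl k x y; rewrite fl scalerDr !scalerA mulrC. Qed.

Lemma lin_scaler V W (c : V -> K) (w : W) :
  lin (c : V -> K^o) -> lin (fun x => c x *: w).
Proof. by move=> cl k x y; rewrite cl scalerDl scalerA. Qed.

Lemma lin_sumf V W (I : Type) (r : seq I) (F : I -> V -> W) :
  (forall i, lin (F i)) -> lin (fun x => \sum_(i <- r) F i x).
Proof.
move=> Fl k x y; rewrite scaler_sumr -big_split.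
by apply: eq_bigr => i _; rewrite Fl.
Qed.

Lemma lin_mulKl V (a : V -> K) (b : K) :
  lin (a : V -> K^o) -> lin (fun x => a x * b : K^o).
Proof.
by move=> al k x y; rewrite al [LHS]mulrDl -[_ *: _ in LHS]/(_ * _) -mulrA.
Qed.

Lemma lin_mulKr V (a : K) (b : V -> K) :
  lin (b : V -> K^o) -> lin (fun x => a * b x : K^o).
Proof. by move=> bl k x y; rewrite bl [LHS]mulrDr [X in X + _]mulrCA. Qed.

Lemma lin_mull V (A : algType K) (a : V -> A) (b : A) :
  lin a -> lin (fun x => a x * b).
Proof. by move=> al k x y; rewrite al mulrDl scalerAl. Qed.

Lemma lin_mulr V (A : algType K) (a : A) (b : V -> A) :
  lin b -> lin (fun x => a * b x).
Proof. by move=> bl k x y; rewrite bl mulrDr scalerAr. Qed.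

Lemma lin_compl V (U1 U2 U3 : vectType K) (a : V -> 'Hom(U2, U3))
    (b : 'Hom(U1, U2)) : lin a -> lin (fun x => (a x \o b)%VF).
Proof. by move=> al k x y; rewrite al comp_lfunDl comp_lfunZl. Qed.

Lemma lin_compr V (U1 U2 U3 : vectType K) (a : 'Hom(U2, U3))
    (b : V -> 'Hom(U1, U2)) : lin b -> lin (fun x => (a \o b x)%VF).
Proof. by move=> bl k x y; rewrite bl comp_lfunDr comp_lfunZr. Qed.

Lemma lin_app V (U1 U2 : vectType K) (a : V -> 'Hom(U1, U2)) (b : U1) :
  lin a -> lin (fun x => a x b).
Proof. by move=> al k x y; rewrite al add_lfunE scale_lfunE. Qed.

Lemma lin_lfun (U1 U2 : vectType K) (f : 'Hom(U1, U2)) : lin f.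
Proof. by move=> k x y; rewrite linearP. Qed.

Lemma lin_bilinl V (U1 U2 U3 : lmodType K) (F : U1 -> U2 -> U3) (a : V -> U1) b :
  bilin F -> lin a -> lin (fun x => F (a x) b).
Proof. by move=> [Fl _] al k x y; rewrite al; exact: Fl. Qed.

Lemma lin_bilinr V (U1 U2 U3 : lmodType K) (F : U1 -> U2 -> U3) a (b : V -> U2) :
  bilin F -> lin b -> lin (fun x => F a (b x)).
Proof. by move=> [_ Fr] bl k x y; rewrite bl; exact: Fr. Qed.

Lemma lin_tensl V (U1 U2 : lmodType K) (a : V -> U1) (b : U2) :
  lin a -> lin (fun x => a x \ox b).
Proof. exact/lin_bilinl/tens_bilin. Qed.

Lemma lin_tensr V (U1 U2 : lmodType K) (a : U1) (b : V -> U2) :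
  lin b -> lin (fun x => a \ox b x).
Proof. exact/lin_bilinr/tens_bilin. Qed.

Lemma lin_tlift V (U1 U2 U3 : lmodType K) (F : U1 -> U2 -> U3)
    (t : V -> tensor U1 U2) :
  bilin F -> lin t -> lin (fun x => tlift F (t x)).
Proof. by move=> Fb tl; apply: lin_comp tl => k x y; exact: tlift_linear. Qed.

Lemma lin_tlift_fun V (U1 U2 U3 : lmodType K) (F : V -> U1 -> U2 -> U3) t :
  (forall a b, lin (fun x => F x a b)) -> lin (fun x => tlift (F x) t).
Proof. by move=> Fl; apply: lin_sumf => p; exact: Fl. Qed.

Lemma bilinP (U1 U2 U3 : lmodType K) (F : U1 -> U2 -> U3) :
  (forall b, lin (fun a => F a b)) -> (forall a, lin (fun b => F a b)) ->
  bilin F.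
Proof. by move=> Fl Fr; split=> [b|a] k x y; [exact: Fl|exact: Fr]. Qed.

Lemma lin_linear V W (f : {linear V -> W}) : lin f.
Proof. by move=> k x y; rewrite linearP. Qed.

Definition trilin (U1 U2 U3 U : lmodType K) (F : U1 -> U2 -> U3 -> U) : Prop :=
  [/\ forall b c, lin (fun a => F a b c), forall a c, lin (fun b => F a b c)
    & forall a b, lin (F a b)].

Lemma lin_trilin1 V (U1 U2 U3 U : lmodType K) (F : U1 -> U2 -> U3 -> U)
    (a : V -> U1) b c : trilin F -> lin a -> lin (fun x => F (a x) b c).
Proof. by case=> F1 _ _ al; exact: lin_comp (F1 b c) al. Qed.

Lemma lin_trilin2 V (U1 U2 U3 U : lmodType K) (F : U1 -> U2 -> U3 -> U)
    a (b : V -> U2) c : trilin F -> lin b -> lin (fun x => F a (b x) c).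
Proof. by case=> _ F2 _ bl; exact: lin_comp (F2 a c) bl. Qed.

Lemma lin_trilin3 V (U1 U2 U3 U : lmodType K) (F : U1 -> U2 -> U3 -> U)
    a b (c : V -> U3) : trilin F -> lin c -> lin (fun x => F a b (c x)).
Proof. by case=> _ _ F3 cl; exact: lin_comp (F3 a b) cl. Qed.

(** Every tensor is a finite sum of pure ones. Most identities between maps out of tensor products
    are reduced to pure tensors through this lemma. *)
Lemma lin_tens_ext (V1 V2 W : lmodType K) (f g : tensor V1 V2 -> W) :
  lin f -> lin g -> (forall v w, f (v \ox w) = g (v \ox w)) -> f =1 g.
Proof.
move=> fl gl fg t; rewrite (tens_sum t) (lin_sum fl) (lin_sum gl).
by apply: eq_bigr => p _; exact: fg.
Qed.

End Linear.

(* Extension point: redefined below once the module actions are available. *)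
Ltac lin_hook := fail.
(** Each pattern isolates one argument that may contain the bound variable. The last case
    eta-expands a bare function so that the patterns apply to it. *)
Ltac lin_step := match goal with
  | |- _ => assumption
  | |- _ => lin_hook
  | |- bilin _ => apply: bilinP => ? /=
  | |- trilin _ => split=> ? ? /=
  | |- lin (fun x => x) => exact: lin_id
  | |- lin (fun x => @tens _ _ _ (@?a x) ?b) => apply: (lin_tensl (a := a))
  | |- lin (fun x => @tens _ _ _ ?a (@?b x)) => apply: (lin_tensr _ (b := b))
  | |- lin (fun x => @GRing.mul _ (@?a x) ?b) => apply: (lin_mull (a := a))
  | |- lin (fun x => @GRing.mul _ (@?a x) ?b) => apply: (lin_mulKl (a := a))
  | |- lin (fun x => @GRing.mul _ ?a (@?b x)) => apply: (lin_mulr _ (b := b))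
  | |- lin (fun x => @GRing.mul _ ?a (@?b x)) => apply: (lin_mulKr _ (b := b))
  | |- @lin ?K ?V ?W (fun x => @GRing.add _ (@?a x) (@?b x)) =>
      apply: (@lin_add K V W a b)
  | |- @lin ?K ?V ?W (fun x => @GRing.scale _ _ ?a (@?b x)) =>
      apply: (@lin_scale K V W a b)
  | |- lin (fun x => @GRing.scale _ _ (@?a x) ?b) =>
      apply: (lin_scaler (c := a))
  | |- lin (fun x => @comp_lfun _ _ _ _ (@?a x) ?b) =>
      apply: (lin_compl (a := a))
  | |- lin (fun x => @comp_lfun _ _ _ _ ?a (@?b x)) =>
      apply: (lin_compr _ (b := b))
  | |- @lin ?K ?V ?W (fun x => @tlift _ _ _ _ (@?F x) ?t) =>
      apply: (@lin_tlift_fun K V _ _ W F t) => ? ? /=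
  | |- @lin ?K ?V ?W (fun x => @tlift _ _ _ _ ?F (@?t x)) =>
      apply: (@lin_tlift K V _ _ W F t)
  | H : trilin ?F |- lin (fun x => ?F (@?a x) ?b ?c) =>
      apply: (lin_trilin1 (a := a) b c H)
  | H : trilin ?F |- lin (fun x => ?F ?a (@?b x) ?c) =>
      apply: (lin_trilin2 (b := b) a c H)
  | H : trilin ?F |- lin (fun x => ?F ?a ?b (@?c x)) =>
      apply: (lin_trilin3 (c := c) a b H)
  | H : bilin ?F |- lin (fun x => ?F (@?a x) ?b) =>
      apply: (lin_bilinl (a := a) b H)
  | H : bilin ?F |- lin (fun x => ?F ?a (@?b x)) =>
      apply: (lin_bilinr (b := b) a H)
  | H : lin ?f |- lin (fun x => ?f (@?a x)) => apply: (lin_comp (g := a) H)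
  | |- lin (fun x => @fun_of_lfun _ _ _ (@?f x) ?a) => apply: (lin_app (a := f))
  | |- _ => exact: lin_linear
  | |- lin (fun x => GRing.Linear.sort ?f (@?a x)) =>
      apply: (lin_comp (g := a) (lin_linear f))
  | |- lin (fun x => @fun_of_lfun _ _ _ ?f (@?a x)) =>
      apply: (lin_comp (g := a) (lin_lfun f))
  | |- lin ?f => lazymatch f with
      | fun _ => _ => fail
      | _ => change (lin (fun x => f x)) end
  end.
Ltac lin_tac := rewrite /sweedler3 /sweedler2; repeat lin_step.
Section SweedlerCalculus.
Variables (K : fieldType) (H : hopfAlg K).
Implicit Types U V W : lmodType K.

Lemma sweedlerZ U (F : H -> H -> U) k x :
  k *: sweedler2 F x = sweedler2 (fun a b => k *: F a b) x.
Proof. exact: scaler_sumr. Qed.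

Lemma eq_sweedler (U : nmodType) (F G : H -> H -> U) x :
  (forall a b, F a b = G a b) -> sweedler2 F x = sweedler2 G x.
Proof. by move=> FG; apply: eq_bigr => p _; exact: FG. Qed.

Lemma sweedler_exchange (U : nmodType) (F : H -> H -> H -> H -> U) x y :
  sweedler2 (fun a b => sweedler2 (F a b) y) x =
  sweedler2 (fun c d => sweedler2 (fun a b => F a b c d) x) y.
Proof. exact: exchange_big. Qed.

Lemma sweedler_lin U V (f : U -> V) (F : H -> H -> U) x :
  lin f -> f (sweedler2 F x) = sweedler2 (fun a b => f (F a b)) x.
Proof. by move=> fl; exact: (lin_sum fl). Qed.

(** A trilinear [F] factors through a linear map [G] on H (x) (H (x) H), and the two sides are the
    images under [G] of the two sides of [comulA]. *)
Lemma sweedler_coassoc U (F : H -> H -> H -> U) x : trilin F ->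
  sweedler2 (fun y c => sweedler2 (fun a b => F a b c) y) x =
  sweedler2 (fun a y => sweedler2 (fun b c => F a b c) y) x.
Proof.
move=> Ft.
pose G := tlift (fun a (t : tensor H H) => tlift (F a) t).
have Gl : lin G by rewrite /G; lin_tac.
have Gb : bilin (fun a (t : tensor H H) => tlift (F a) t) by lin_tac.
have Gt a b c : G (a \ox (b \ox c)) = F a b c.
  by rewrite /G tlift_tens// tlift_tens//; lin_tac.
transitivity (G (tlift (fun y c =>
    tlift (fun a b => a \ox (b \ox c)) (comul y)) (comul x))).
  rewrite [RHS](lin_sum Gl); apply: eq_bigr => p _.
  by rewrite [RHS](lin_sum Gl); apply: eq_bigr => q _; rewrite Gt.
rewrite comulA [LHS](lin_sum Gl); apply: eq_bigr => p _.
by rewrite /G tlift_tens.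
Qed.

Lemma sweedler_counitl U (f : H -> U) x : lin f ->
  sweedler2 (fun a b => counit a *: f b) x = f x.
Proof.
move=> fl; rewrite -[in RHS](comul_counitl x) (lin_sum fl).
by apply: eq_bigr => p _; rewrite linZ.
Qed.

Lemma sweedler_counitr U (f : H -> U) x : lin f ->
  sweedler2 (fun a b => counit b *: f a) x = f x.
Proof.
move=> fl; rewrite -[in RHS](comul_counitr x) (lin_sum fl).
by apply: eq_bigr => p _; rewrite linZ.
Qed.

Lemma sweedler_antipodel U (f : H -> U) x : lin f ->
  sweedler2 (fun a b => f (antipode a * b)) x = counit x *: f 1.
Proof. by move=> fl; rewrite -linZ// -antipodel (lin_sum fl). Qed.

Lemma sweedler_antipoder U (f : H -> U) x : lin f ->
  sweedler2 (fun a b => f (a * antipode b)) x = counit x *: f 1.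
Proof. by move=> fl; rewrite -linZ// -antipoder (lin_sum fl). Qed.

Lemma sweedler1 U (F : H -> H -> U) : bilin F -> sweedler2 F 1 = F 1 1.
Proof. by move=> Fb; rewrite /sweedler2 comul1 tlift_tens. Qed.

Lemma sweedlerM U (F : H -> H -> U) x y : bilin F ->
  sweedler2 F (x * y) = sweedler2 (fun x0 x1 =>
    sweedler2 (fun y0 y1 => F (x0 * y0) (x1 * y1)) y) x.
Proof.
move=> Fb; rewrite /sweedler2 comulM.
rewrite (lin_sum (f := tlift F)); last by lin_tac.
apply: eq_bigr => p _; rewrite (lin_sum (f := tlift F)); last by lin_tac.
by apply: eq_bigr => q _; rewrite tlift_tens.
Qed.

(** Both sides are convolution inverses of the multiplication H (x) H -> H. Concretely, S(x_0 y_0)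
    x_1 y_1 S(y_2) S(x_2) is contracted once from the right and once from the left. *)
Lemma antipodeM x y : antipode (x * y : H) = antipode y * antipode x.
Proof.
pose S := antipode (h := H).
transitivity (sweedler2 (fun x0 x1 => counit x1 *: sweedler2 (fun y0 y1 =>
    counit y1 *: S (x0 * y0)) y) x).
  rewrite sweedler_counitr; last by rewrite /S; lin_tac.
  by rewrite sweedler_counitr // /S; lin_tac.
transitivity (sweedler2 (fun x0 x' => sweedler2 (fun x1 x2 =>
    sweedler2 (fun y0 y' => sweedler2 (fun y1 y2 =>
    S (x0 * y0) * (x1 * (y1 * S y2) * S x2)) y') y) x') x).
  apply: eq_sweedler => x0 x'.
  transitivity (sweedler2 (fun x1 x2 => sweedler2 (fun y0 y' => counit y' *:
    (S (x0 * y0) * (x1 * S x2))) y) x').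
    rewrite (sweedler_antipoder (f := fun z => sweedler2 (fun y0 y' =>
      counit y' *: (S (x0 * y0) * z)) y)); last by lin_tac.
    by congr (_ *: _); apply: eq_sweedler => y0 y1; rewrite mulr1.
  apply: eq_sweedler => x1 x2; apply: eq_sweedler => y0 y'.
  rewrite (sweedler_antipoder (f := fun z => S (x0 * y0) * (x1 * z * S x2))).
    by rewrite mulr1.
  by lin_tac.
transitivity (sweedler2 (fun x0 x' => sweedler2 (fun x1 x2 =>
    sweedler2 (fun y' y2 => sweedler2 (fun y0 y1 =>
    (S (x0 * y0) * (x1 * y1)) * (S y2 * S x2)) y') y) x') x).
  apply: eq_sweedler => x0 x'; apply: eq_sweedler => x1 x2.
  rewrite -(sweedler_coassoc (F := fun y0 y1 y2 =>
    S (x0 * y0) * (x1 * (y1 * S y2) * S x2))); last by rewrite /S; lin_tac.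
  by apply: eq_sweedler => ? ?; apply: eq_sweedler => ? ?; rewrite !mulrA.
rewrite -(sweedler_coassoc (F := fun x0 x1 x2 =>
    sweedler2 (fun y' y2 => sweedler2 (fun y0 y1 =>
    (S (x0 * y0) * (x1 * y1)) * (S y2 * S x2)) y') y)); last first.
  by rewrite /S; lin_tac.
transitivity (sweedler2 (fun x' x2 => sweedler2 (fun y' y2 =>
   counit x' *: (counit y' *: (S y2 * S x2))) y) x); last first.
  rewrite -(sweedler_counitl (f := fun x2 => S y * S x2)).
    apply: eq_sweedler => x' x2.
    rewrite -(sweedler_counitl (f := fun y2 => S y2 * S x2) y).
      by rewrite [RHS]scaler_sumr.
    by rewrite /S; lin_tac.
  by rewrite /S; lin_tac.
apply: eq_sweedler => x' x2.
transitivity (sweedler2 (fun y' y2 => sweedler2 (fun x0 x1 => sweedler2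
    (fun y0 y1 => (S (x0 * y0) * (x1 * y1)) * (S y2 * S x2)) y') x') y).
  exact: sweedler_exchange.
apply: eq_sweedler => y' y2.
rewrite -(sweedlerM (F := fun a b => S a * b * (S y2 * S x2))); last first.
  by rewrite /S; lin_tac.
rewrite (sweedler_antipodel (f := fun z => z * (S y2 * S x2))); last by lin_tac.
by rewrite mul1r counitM scalerA.
Qed.

Lemma antipode1 : antipode (1 : H) = 1.
Proof.
have := sweedler_antipodel (1 : H) (@lin_id _ H).
rewrite counit1 scale1r sweedler1 ?mulr1//; lin_tac.
Qed.

(** The dual of [antipodeM]: both sides are convolution inverses of the comultiplication, as maps
    from H to H (x) H. The interpolating expression has the two components u x_1 S(x_4) and v x_2
    S(x_3), where u (x) v is the coproduct of S(x_0). *)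
Lemma sweedler_antipode U (F : H -> H -> U) x : bilin F ->
  sweedler2 F (antipode x) =
  sweedler2 (fun a b => F (antipode b) (antipode a)) x.
Proof.
move=> Fb; pose S := antipode (h := H).
transitivity (sweedler2 (fun x0 x' => counit x' *: sweedler2 F (S x0)) x).
  by rewrite sweedler_counitr// /S; lin_tac.
transitivity (sweedler2 (fun x0 x' => sweedler2 (fun y x4 => sweedler2
    (fun x1 z => sweedler2 (fun x2 x3 => sweedler2 (fun u v =>
    F (u * x1 * S x4) (v * (x2 * S x3))) (S x0)) z) y) x') x).
  apply: eq_sweedler => x0 x'.
  transitivity (sweedler2 (fun y x4 => sweedler2 (fun u v =>
      F (u * (y * S x4)) v) (S x0)) x').
    rewrite (sweedler_antipoder (f := fun z => sweedler2 (fun u v =>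
      F (u * z) v) (S x0))); last by lin_tac.
    by congr (_ *: _); apply: eq_sweedler => u v; rewrite mulr1.
  apply: eq_sweedler => y x4.
  rewrite -(sweedler_counitr (f := fun y => sweedler2 (fun u v =>
      F (u * (y * S x4)) v) (S x0)) y); last by lin_tac.
  apply: eq_sweedler => x1 z.
  rewrite (sweedler_antipoder (f := fun r => sweedler2 (fun u v =>
    F (u * x1 * S x4) (v * r)) (S x0))); last by lin_tac.
  by congr (_ *: _); apply: eq_sweedler => u v; rewrite mulr1 mulrA.
transitivity (sweedler2 (fun x0 x' => sweedler2 (fun w q => sweedler2
    (fun x3 x4 => sweedler2 (fun x1 x2 => sweedler2 (fun u v =>
    F (u * x1 * S x4) (v * x2 * S x3)) (S x0)) w) q) x') x).
  apply: eq_sweedler => x0 x'.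
  rewrite -(sweedler_coassoc (F := fun w x3 x4 => sweedler2 (fun x1 x2 =>
    sweedler2 (fun u v => F (u * x1 * S x4) (v * x2 * S x3)) (S x0)) w));
    last by rewrite /S; lin_tac.
  apply: eq_sweedler => y x4.
  rewrite -(sweedler_coassoc (F := fun x1 x2 x3 => sweedler2 (fun u v =>
    F (u * x1 * S x4) (v * (x2 * S x3))) (S x0))); last by rewrite /S; lin_tac.
  do 3![apply: eq_sweedler => ? ?].
  by rewrite mulrA.
rewrite -(sweedler_coassoc (F := fun x0 w q => sweedler2
    (fun x3 x4 => sweedler2 (fun x1 x2 => sweedler2 (fun u v =>
    F (u * x1 * S x4) (v * x2 * S x3)) (S x0)) w) q)); last first.
  by rewrite /S; lin_tac.
transitivity (sweedler2 (fun r q => counit r *: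
    sweedler2 (fun x3 x4 => F (S x4) (S x3)) q) x); last first.
  by rewrite sweedler_counitl// /S; lin_tac.
apply: eq_sweedler => r q.
transitivity (sweedler2 (fun x3 x4 => sweedler2 (fun x0 w => sweedler2
    (fun u v => sweedler2 (fun x1 x2 => F (u * x1 * S x4) (v * x2 * S x3))
    w) (S x0)) r) q).
  rewrite sweedler_exchange; do 2![apply: eq_sweedler => ? ?].
  exact: sweedler_exchange.
rewrite sweedlerZ; apply: eq_sweedler => x3 x4.
transitivity (sweedler2 (fun x0 w =>
    sweedler2 (fun a b => F (a * S x4) (b * S x3)) (S x0 * w)) r).
  apply: eq_sweedler => x0 w.
  by rewrite (sweedlerM (F := fun a b => F (a * S x4) (b * S x3)))//; lin_tac.
have Fl : lin (sweedler2 (fun a b => F (a * S x4) (b * S x3))) by lin_tac.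
rewrite (sweedler_antipodel _ Fl) sweedler1; last by lin_tac.
by rewrite !mul1r.
Qed.

Local Notation T := (@antipodeV K H).

(** The inverse antipode is given as a bare function; it inherits linearity, and below
    antimultiplicativity, from the antipode by cancellation. *)
Lemma lin_antipodeV : lin T.
Proof.
move=> k x y; rewrite -{1}(antipodeVK x) -{1}(antipodeVK y) -linearP.
by rewrite antipodeK.
Qed.

Lemma antipodeVM x y : T (x * y) = T y * T x.
Proof. by rewrite -{1}(antipodeVK x) -{1}(antipodeVK y) -antipodeM antipodeK. Qed.

Lemma antipodeV1 : T 1 = 1.
Proof. by rewrite -{1}antipode1 antipodeK. Qed.

(** Applying the antimultiplicative S^-1 to S(x_0) x_1 = eps(x) reverses the product: S^-1(x_1) x_0
    = eps(x). This reversal dictates which neighbouring legs can cancel in all later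
    computations. *)
Lemma sweedler_antipodeVl U (f : H -> U) x : lin f ->
  sweedler2 (fun a b => f (T b * a)) x = counit x *: f 1.
Proof.
move=> fl; rewrite -[in f 1]antipodeV1.
have fT : lin (fun x => f (T x)) := lin_comp fl lin_antipodeV.
rewrite -(sweedler_antipodel x fT); apply: eq_sweedler => a b.
by rewrite antipodeVM antipodeK.
Qed.

Lemma sweedler_antipodeVr U (f : H -> U) x : lin f ->
  sweedler2 (fun a b => f (b * T a)) x = counit x *: f 1.
Proof.
move=> fl; rewrite -[in f 1]antipodeV1.
have fT : lin (fun x => f (T x)) := lin_comp fl lin_antipodeV.
rewrite -(sweedler_antipoder x fT); apply: eq_sweedler => a b.
by rewrite antipodeVM antipodeK.
Qed.

Lemma sweedler_antipodeV U (F : H -> H -> U) x : bilin F ->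
  sweedler2 F (T x) = sweedler2 (fun a b => F (T b) (T a)) x.
Proof.
move=> Fb; have Tl := lin_antipodeV.
rewrite -{2}(antipodeVK x) sweedler_antipode; last by lin_tac.
by apply: eq_sweedler => a b; rewrite !antipodeK.
Qed.

(* The four legs of [y] are split as ((q0, q1), (a, z)); the inner pair
   (q1, a) is contracted. *)
Lemma sweedler_contract U (Z : H -> H -> H -> H -> U) (Z' : H -> H -> U) y :
  (forall q1 a z, lin (fun q0 => Z q0 q1 a z)) ->
  (forall q0, trilin (Z q0)) -> bilin Z' ->
  (forall q0 v z,
     sweedler2 (fun q1 a => Z q0 q1 a z) v = counit v *: Z' q0 z) ->
  sweedler2 (fun q r => sweedler2 (fun q0 q1 =>
    sweedler2 (fun a z => Z q0 q1 a z) r) q) y = sweedler2 Z' y.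
Proof.
move=> Z1 Z3 Z'b ZZ'.
rewrite (sweedler_coassoc (F := fun q0 q1 r =>
    sweedler2 (fun a z => Z q0 q1 a z) r)); last first.
  split=> b c; rewrite /sweedler2.
  - apply: lin_tlift_fun => *; exact: Z1.
  - by have := Z3 b => ?; lin_tac.
  - by have := Z3 b => ?; lin_tac.
apply: eq_sweedler => q0 y'.
have Zq := Z3 q0.
rewrite -(sweedler_coassoc (F := fun q1 a z => Z q0 q1 a z))//.
rewrite -[RHS](sweedler_counitl (f := Z' q0)); last by lin_tac.
by apply: eq_sweedler => v z.
Qed.

Lemma sweedler_antipodeV_adj U (G : H -> H -> U) p w q : bilin G ->
  sweedler2 G (T p * w * q) =
  sweedler2 (fun p0 p1 => sweedler2 (fun w0 w1 => sweedler2 (fun q0 q1 =>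
    G (T p1 * w0 * q0) (T p0 * w1 * q1)) q) w) p.
Proof.
move=> Gb; have Tl := lin_antipodeV.
rewrite sweedlerM// sweedlerM; last by lin_tac.
rewrite sweedler_antipodeV//; lin_tac.
Qed.

(* [F] stands for the invariant cochain and [t] for the trace against a fixed
   operator; the antipodes cancel in the pairs (q1, a), (p1, (q0, b)), (p0, d). *)
Lemma sweedler_adj_trace (F : H -> H -> K^o) (c t : H -> K^o) w y :
  bilin F -> lin c -> lin t ->
  (forall w y, sweedler2 (fun p1 v =>
    sweedler2 (fun q0 b => F (T p1 * w * q0) b) v) y = counit y *: c w) ->
  sweedler2 (fun y0 y1 => sweedler2 (fun p q => sweedler2 (fun w0 w1 =>
    sweedler3 (fun a b d => F w0 b * t (a * T w1 * T d) : K^o) y1)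
    (T p * w * q)) y0) y =
  counit y *: sweedler2 (fun w0 w1 => c w0 * t (T w1) : K^o) w.
Proof.
move=> Fb cl tl Fc; have Tl := lin_antipodeV.
(* The second leg [T p0 * w1 * q1] sits under [T] and becomes [T q1 * T w1 * T (T p0)]. Its last
   factor is merged with [T d] into [T (d * T p0)], which prepares the cancellation of [d] against
   [p0]. *)
transitivity (sweedler2 (fun w0 w1 => sweedler2 (fun y0 y1 =>
    sweedler2 (fun p q => sweedler2 (fun p0 p1 => sweedler2 (fun q0 q1 =>
    sweedler2 (fun a z => sweedler2 (fun b d =>
    F (T p1 * w0 * q0) b * t (a * T q1 * (T w1 * T (d * T p0))) : K^o)
    z) y1) q) p) y0) y) w).
  rewrite [RHS]sweedler_exchange; apply: eq_sweedler => y0 y1.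
  rewrite [RHS]sweedler_exchange; apply: eq_sweedler => p q.
  rewrite sweedler_antipodeV_adj; last by lin_tac.
  rewrite [LHS]sweedler_exchange; apply: eq_sweedler => w0 w1.
  do 4![apply: eq_sweedler => ? ?]; rewrite /= !antipodeVM.
  by rewrite !mulrA.
rewrite sweedlerZ; apply: eq_sweedler => w0 w1.
transitivity (sweedler2 (fun p y' => sweedler2 (fun p0 p1 => sweedler2
    (fun q0 z => sweedler2 (fun b d => 
    F (T p1 * w0 * q0) b * t (T w1 * T (d * T p0)) : K^o) z) y') p) y).
  rewrite (sweedler_coassoc (F := fun p q y1 => sweedler2 (fun p0 p1 =>
    sweedler2 (fun q0 q1 => sweedler2 (fun a z => sweedler2 (fun b d =>
    F (T p1 * w0 * q0) b * t (a * T q1 * (T w1 * T (d * T p0))) : K^o)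
    z) y1) q) p)); last by lin_tac.
  apply: eq_sweedler => p y'.
  rewrite [LHS]sweedler_exchange; apply: eq_sweedler => p0 p1.
  apply: (sweedler_contract (Z := fun q0 q1 a z => sweedler2 (fun b d =>
    F (T p1 * w0 * q0) b * t (a * T q1 * (T w1 * T (d * T p0))) : K^o) z)
    (Z' := fun q0 z => sweedler2 (fun b d =>
    F (T p1 * w0 * q0) b * t (T w1 * T (d * T p0)) : K^o) z));
    [by move=> *; lin_tac|by move=> *; lin_tac|by lin_tac|].
  move=> q0 v z.
  rewrite (sweedler_antipodeVr (f := fun r : H => sweedler2 (fun b d =>
    F (T p1 * w0 * q0) b * t (r * (T w1 * T (d * T p0))) : K^o) z));
    last by lin_tac.
  by congr (_ *: _); apply: eq_sweedler => b d; rewrite mul1r.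
transitivity (sweedler2 (fun p0 d => c w0 * t (T w1 * T (d * T p0)) : K^o) y).
  transitivity (sweedler2 (fun p y' => sweedler2 (fun p0 p1 => sweedler2
    (fun v d => sweedler2 (fun q0 b =>
    F (T p1 * w0 * q0) b * t (T w1 * T (d * T p0)) : K^o) v) y') p) y).
    do 2![apply: eq_sweedler => ? ?].
    by rewrite (sweedler_coassoc (F := fun q0 b d => 
      F (T _ * w0 * q0) b * t (T w1 * T (d * T _)) : K^o))//; lin_tac.
  apply: (sweedler_contract (Z := fun p0 p1 v d => sweedler2 (fun q0 b =>
    F (T p1 * w0 * q0) b * t (T w1 * T (d * T p0)) : K^o) v)
    (Z' := fun p0 d => c w0 * t (T w1 * T (d * T p0)) : K^o));
    [by move=> *; lin_tac|by move=> *; lin_tac|by lin_tac|].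
  move=> p0 v d.
  set r := t _; have rl : lin (fun x : K^o => (x : K) * r : K^o) by lin_tac.
  transitivity (((sweedler2 (fun p1 v => 
    sweedler2 (fun q0 b => F (T p1 * w0 * q0) b) v) v : K^o) : K) * r : K^o).
    rewrite (sweedler_lin _ _ rl); apply: eq_sweedler => p1 v'.
    by rewrite (sweedler_lin _ _ rl).
  by rewrite Fc; exact: (esym (mulrA _ _ _)).
rewrite (sweedler_antipodeVr (f := fun r => c w0 * t (T w1 * T r) : K^o));
  last by lin_tac.
by rewrite antipodeV1 mulr1.
Qed.

End SweedlerCalculus.

(** * Cyclic cocycles on a ring *)

Section PolynomialDerivative.
Variable K : fieldType.
Hypothesis char0 : [pchar K] =i pred0.

Definition polyder (F F' : nat -> K) : Prop :=
  exists P : {poly K},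
    (forall t, F t = P.[t%:R]) /\ (forall t, F' t = P^`().[t%:R]).

(** In characteristic 0 the first [size P] naturals are distinct in [K], which is one root more than
    the degree of a nonzero [P] allows. *)
Lemma poly_nat_roots (P : {poly K}) : (forall t : nat, P.[t%:R] = 0) -> P = 0.
Proof.
move=> Pr; apply/eqP/negPn/negP => P0.
suff : (size [seq i%:R : K | i <- iota 0 (size P)] < size P)%N.
  by rewrite size_map size_iota ltnn.
apply: max_poly_roots => //; first by apply/allP => _ /mapP[i _ ->]; apply/rootP.
rewrite map_inj_uniq ?iota_uniq// => i j /eqP.
wlog ij : i j / (i <= j)%N => [hw|].
  case/orP: (leq_total i j) => [/hw//|/hw h] e.
  by apply/esym/h; rewrite eq_sym.
rewrite eq_sym -subr_eq0 -natrB// ((pcharf0P K).1 char0) => /eqP ji.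
by apply/eqP; rewrite eqn_leq ij -subn_eq0 ji.
Qed.

Lemma polyder0 (F F' : nat -> K) : polyder F F' -> (forall t, F' t = 0) ->
  F 0%N = F 1%N.
Proof.
case=> P [FP F'P] F'0; rewrite !FP.
have dP : P^`() = 0 by apply: poly_nat_roots => t; rewrite -F'P.
suff -> : P = (P`_0)%:P by rewrite !hornerC.
apply/polyP => -[|i]; rewrite coefC//=.
have /eqP : P^`()`_i = 0 by rewrite dP coef0.
by rewrite coef_deriv -mulr_natr mulf_eq0 ((pcharf0P K).1 char0) orbF => /eqP.
Qed.

Section QuadraticPaths.
Variables (A : zmodType) (n : nat) (phi : seq A -> K).

(** Here [n] is the cochain degree, one less than the number of arguments. Since [phi] takes
    sequences of any length, the condition is restricted to those of length n + 1. *)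
Definition multiadditive : Prop := forall s1 s2, (size s1 + size s2)%N = n ->
  {morph (fun v => phi (s1 ++ v :: s2)) : x y / x + y}.

Hypothesis phiD : multiadditive.

Lemma multiadd0 s1 s2 : (size s1 + size s2)%N = n -> phi (s1 ++ 0 :: s2) = 0.
Proof.
move=> sz; apply: (addrI (phi (s1 ++ 0 :: s2))).
by rewrite -(phiD sz) !addr0.
Qed.

Lemma multiaddN s1 s2 v : (size s1 + size s2)%N = n ->
  phi (s1 ++ - v :: s2) = - phi (s1 ++ v :: s2).
Proof. by move=> sz; apply/eqP; rewrite -addr_eq0 -(phiD sz) addNr multiadd0. Qed.

Lemma multiaddMn s1 s2 v k : (size s1 + size s2)%N = n ->
  phi (s1 ++ v *+ k :: s2) = k%:R * phi (s1 ++ v :: s2).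
Proof.
move=> sz; elim: k => [|k IH]; first by rewrite mul0r multiadd0.
by rewrite mulrS (phiD sz) IH -natr1 mulrDl mul1r addrC.
Qed.

(* The triple (a, b, c) is the path t |-> a + t b + t^2 c; parameters t in
   [nat] are enough to determine a polynomial and avoid scalars in [A]. *)
Definition qpath : Type := A * A * A.
Definition qval (t : nat) (q : qpath) : A := q.1.1 + q.1.2 *+ t + q.2 *+ (t ^ 2).
Definition qder (t : nat) (q : qpath) : A := q.1.2 + q.2 *+ (2 * t).

(** The Leibniz sum: one term for each entry of [Q], with that entry differentiated and the others
    evaluated at t. The entries already passed accumulate in [pre]. *)
Fixpoint qtotal (pre : seq A) (Q : seq qpath) (t : nat) : K :=
  if Q is q :: Q' then
    phi (pre ++ qder t q :: map (qval t) Q') + qtotal (rcons pre (qval t q)) Q' t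
  else 0.

Lemma qtotalD s1 s2 Q t : (size s1 + size s2 + size Q)%N = n ->
  {morph (fun v => qtotal (s1 ++ v :: s2) Q t) : x y / x + y}.
Proof.
elim: Q s2 => [|q Q IH] s2 /= sz x y; first by rewrite addr0.
rewrite !rcons_cat /= IH; last by rewrite size_rcons !addnS addSn -sz !addnS.
rewrite -!catA /= phiD; last by rewrite size_cat /= size_map -sz addnA.
by rewrite addrACA.
Qed.

Lemma qtotalMn s1 s2 Q t v k : (size s1 + size s2 + size Q)%N = n ->
  qtotal (s1 ++ v *+ k :: s2) Q t = k%:R * qtotal (s1 ++ v :: s2) Q t.
Proof.
move=> sz; have D := qtotalD t sz.
elim: k => [|k IH].
  by rewrite mul0r; apply: (addrI (qtotal (s1 ++ 0 :: s2) Q t)); rewrite -D !addr0.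
by rewrite mulrS D IH -natr1 mulrDl mul1r addrC.
Qed.

(** Freezing the first path at each of its coefficients a, b, c gives by induction polynomials Pa,
    Pb, Pc. Additivity yields Pa + X Pb + X^2 Pc for the whole, and the product rule is the
    recursion of [qtotal]. *)
Lemma qtotalP pre Q : (size pre + size Q)%N = n.+1 ->
  polyder (fun t => phi (pre ++ map (qval t) Q)) (qtotal pre Q).
Proof.
elim: Q pre => [|[[a b] c] Q IH] pre /= sz.
  exists (phi pre)%:P; split=> t /=; first by rewrite cats0 hornerC.
  by rewrite derivC hornerC.
have szr v : (size (rcons pre v) + size Q)%N = n.+1.
  by rewrite size_rcons addSn -addnS.
have [Pa [Pa1 Pa2]] := IH _ (szr a); have [Pb [Pb1 Pb2]] := IH _ (szr b).
have [Pc [Pc1 Pc2]] := IH _ (szr c).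
have sz' t : (size pre + size (map (qval t) Q))%N = n.
  by rewrite size_map; apply: succn_inj; rewrite -sz addnS.
have sz'' : (size pre + size ([::] : seq A) + size Q)%N = n.
  by rewrite addn0; apply: succn_inj; rewrite -sz addnS.
exists (Pa + 'X * Pb + 'X^2 * Pc); split=> t.
  rewrite /= {1}/qval /= !(phiD (sz' t)) !(multiaddMn _ _ (sz' t)).
  rewrite -!cat_rcons Pa1 Pb1 Pc1.
  by rewrite !hornerE natrX.
rewrite /= /qder /= (phiD (sz' t)) (multiaddMn _ _ (sz' t)).
rewrite -!cats1 (qtotalD _ sz'') (qtotalD _ sz'') !(qtotalMn _ _ _ sz'') !cats1.
rewrite Pa2 Pb2 Pc2 -!cat_rcons Pb1 Pc1.
rewrite !derivD !derivM !derivX !hornerE natrX natrM.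
rewrite /=; ring.
Qed.

End QuadraticPaths.
End PolynomialDerivative.

Section CyclicCocycles.
Variables (K : fieldType) (A : pzRingType).
Hypothesis char0 : [pchar K] =i pred0.
Implicit Types (phi psi : seq A -> K) (n : nat).

(* The Hochschild coboundary of [phi] without its wrap-around term; [pre] is
   the part of the argument already traversed. *)
Fixpoint bar phi (pre s : seq A) : K :=
  if s is a :: s' then
    if s' is b :: r then phi (pre ++ a * b :: r) - bar phi (rcons pre a) s'
    else 0
  else 0.

Definition cyclic n phi : Prop := forall a s, size s = n ->
  phi (rcons s a) = (-1) ^+ n * phi (a :: s).

(** The full Hochschild coboundary at (a, s, b). The first and last arguments are singled out
    because the wrap-around term multiplies them. *)
Definition hoch n phi (a : A) (s : seq A) (b : A) : K :=
  bar phi [::] (a :: rcons s b) + (-1) ^+ n.+1 * phi (b * a :: s).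

Definition hclosed n phi : Prop :=
  forall a s b, size s = n -> hoch n phi a s b = 0.

Lemma cyclic_rot n phi s1 s2 : cyclic n phi -> (size s1 + size s2)%N = n.+1 ->
  phi (s2 ++ s1) = (-1) ^+ (n * size s1) * phi (s1 ++ s2).
Proof.
move=> phic; elim: s1 s2 => [|a s1 IH] s2 sz.
  by rewrite cats0 muln0 mul1r.
rewrite -cat_rcons IH; last by rewrite size_rcons addnS.
rewrite -rcons_cat phic; last first.
  by apply: succn_inj; rewrite size_cat -sz.
by rewrite mulrA -exprD mulnS addnC.
Qed.

Lemma cyclic_rot_even n phi s1 s2 : cyclic n phi -> ~~ odd n ->
  (size s1 + size s2)%N = n.+1 -> phi (s2 ++ s1) = phi (s1 ++ s2).
Proof.
move=> phic nev sz; rewrite (cyclic_rot phic sz) -signr_odd oddM.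
by rewrite (negbTE nev) mul1r.
Qed.

Lemma nseqS k (e : A) : nseq k.+1 e = e :: nseq k e.
Proof. by []. Qed.

(** Each of the k contractions of (e, ..., e) gives the same value, with alternating signs starting
    from plus, so all or all but one cancel. *)
Lemma bar_nseq phi (pre : seq A) e k : e * e = e ->
  bar phi pre (nseq k.+1 e) = (odd k)%:R * phi (pre ++ nseq k e).
Proof.
move=> ee; elim: k pre => [|k IH] pre; first by rewrite mul0r.
rewrite -[LHS]/(phi (pre ++ e * e :: nseq k e) - bar phi (rcons pre e) (nseq k.+1 e)).
rewrite IH ee cat_rcons -nseqS /=.
by case: (odd k); rewrite /= ?mul1r ?mul0r ?subr0 ?subrr.
Qed.

Lemma rcons_nseq k (e : A) : rcons (nseq k e) e = nseq k.+1 e.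
Proof. by elim: k => //= k ->. Qed.

(** * Even degree: conjugation and equivalence of idempotents *)

Section EvenPairing.
Variables (n : nat) (phi : seq A -> K).
Hypotheses (phiD : multiadditive n.*2 phi) (phic : cyclic n.*2 phi).

(** The inner contractions are even in number and cancel. What remains is a multiple of psi(e, ...,
    e), which equals its own opposite because a rotation in odd degree changes the sign. *)
Lemma pair0_coboundary psi (e : A) : e * e = e -> cyclic n.*2.+1 psi ->
  hoch n.*2.+1 psi e (nseq n.*2.+1 e) e = 0.
Proof.
move=> ee psic; have := psic e (nseq n.*2.+1 e); rewrite size_nseq => /(_ erefl).
rewrite /hoch !rcons_nseq -!nseqS bar_nseq//= odd_double mul0r add0r ee.
rewrite -signr_odd /= odd_double mulN1r => /eqP.
rewrite -addr_eq0 -mulr2n -mulr_natr mulf_eq0 ((pcharf0P K).1 char0) orbF.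
by move=> /eqP ->; rewrite mulr0.
Qed.

Hypothesis phiz : hclosed n.*2 phi.

(** In the coboundary at (x, e, ..., e) the contractions among the e cancel in pairs; only the first
    one, with x e, and the wrap-around one, with e x, survive, with opposite signs. *)
Lemma pair0_commutator (e x : A) : e * e = e ->
  phi (x * e - e * x :: nseq n.*2 e) = 0.
Proof.
move=> ee; have := phiz x (s := nseq n.*2 e) e; rewrite size_nseq => /(_ erefl).
rewrite /hoch rcons_nseq.
rewrite -[bar _ _ _]/(phi (x * e :: nseq n.*2 e) - bar phi [:: x] (nseq n.*2.+1 e)).
rewrite bar_nseq// odd_double mul0r subr0 exprS -signr_odd odd_double mulr1.
rewrite mulN1r => h; have sz : (size ([::] : seq A) + size (nseq n.*2 e))%N = n.*2.
  by rewrite size_nseq.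
by rewrite (phiD sz (x * e)) (multiaddN phiD _ sz).
Qed.

Definition pair0 e := phi (nseq n.*2.+1 e).

(** The path e_t = (1 + tN) e (1 - tN) stays idempotent and its derivative is N e_t - e_t N, so each
    Leibniz term vanishes by [pair0_commutator]. *)
Lemma pair0_conj (e N : A) : e * e = e -> N * N = 0 ->
  pair0 ((1 + N) * e * (1 - N)) = pair0 e.
Proof.
move=> ee NN.
pose q : qpath A := (e, N * e - e * N, - (N * e * N)).
have qE t : qval t q = (1 + N *+ t) * e * (1 - N *+ t).
  rewrite /qval /= mulrBr mulr1 mulrDl mul1r mulrnAl mulrnAr mulrDl mulrnAl.
  by rewrite !mulrnDl -mulrnA mulnn !mulNrn opprD !addrA.
have qq t : qval t q * qval t q = qval t q.
  have inv : (1 - N *+ t) * (1 + N *+ t) = 1.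
    rewrite mulrBl mul1r mulrDr mulr1 mulrnAr mulrnAl NN !mul0rn addr0.
    by rewrite addrK.
  rewrite qE -!mulrA [(1 - _) * _]mulrA inv mul1r [e * (e * _)]mulrA ee.
  by [].
have qd t : qder t q = N * qval t q - qval t q * N.
  have -> : N * qval t q = N * e - (N * e * N) *+ t.
    rewrite /qval /= !mulrDr !mulrnAr !mulrDr !mulrN !mulrA NN.
    by rewrite !mul0r sub0r oppr0 mul0rn addr0 mulNrn.
  have -> : qval t q * N = e * N + (N * e * N) *+ t.
    rewrite /qval /= !mulrDl !mulrnAl !mulrDl !mulNr -!mulrA NN.
    by rewrite !mulr0 subr0 oppr0 mul0rn addr0.
  rewrite /qder /= opprD addrACA; congr (_ + _).
  by rewrite -opprD -mulr2n -mulrnA mulnC mulNrn.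
have der := qtotalP (pre := [::]) (Q := nseq n.*2.+1 q) phiD.
rewrite size_nseq in der; have {}der := polyder0 char0 (der erefl).
have qt t i k : (i + k)%N = n.*2.+1 ->
    qtotal phi (nseq i (qval t q)) (nseq k q) t = 0.
  elim: k i => [//|k IH] i /= ik.
  rewrite rcons_nseq IH ?addSnnS// addr0.
  rewrite map_nseq.
  (* In even degree the differentiated entry is rotated to the front without a sign. *)
  rewrite (cyclic_rot_even (s1 := qder t q :: nseq k (qval t q)) phic); first last.
  - by rewrite /= !size_nseq addSn addnC -addnS.
  - by rewrite odd_double.
  rewrite cat_cons -nseqD qd.
  have -> : (k + i = n.*2)%N by apply: succn_inj; rewrite -ik addnS addnC.
  exact: pair0_commutator.
have := der (fun t => qt t 0%N n.*2.+1 erefl).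
rewrite !cat0s !map_nseq !qE mulr0n mulr1n /pair0 => <-.
by rewrite addr0 subr0 mul1r mulr1.
Qed.

(** Two chains of elementary conjugations meet. From g'g, the factor 1 + g leads to g'g + g and then
    1 - g' leads to g + gg'; from gg', the factor 1 - g leads to the same idempotent. *)
Lemma pair0_mulC (g g' : A) : g * g' * g = g -> g' * g * g' = g' ->
  g * g = 0 -> g' * g' = 0 -> pair0 (g' * g) = pair0 (g * g').
Proof.
move=> ggg ggg' gg gg'.
have e1 : g' * g * (g' * g) = g' * g by rewrite mulrA ggg'.
have e2 : g * g' * (g * g') = g * g' by rewrite mulrA ggg.
have NN (a : A) : a * a = 0 -> - a * - a = 0 by move=> aa; rewrite mulrNN.
have e3 : (g' * g + g) * (g' * g + g) = g' * g + g.
  rewrite !mulrDl !mulrDr e1 -mulrA gg mulr0 addr0 mulrA ggg.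
  by rewrite addr0.
rewrite -(pair0_conj e1 gg).
have -> : (1 + g) * (g' * g) * (1 - g) = g' * g + g.
  rewrite mulrDl mul1r mulrA ggg mulrBr mulr1 mulrDl -mulrA gg mulr0 addr0.
  by rewrite subr0.
rewrite -(pair0_conj e3 (NN _ gg')) -(pair0_conj e2 (NN _ gg)) !opprK.
congr pair0; transitivity (g * (1 + g')).
  congr (_ * _); rewrite mulrDl mul1r mulNr mulrDr mulrA gg' mul0r add0r.
  by rewrite addrAC subrr add0r.
rewrite mulrDl mul1r mulNr mulrA gg mul0r oppr0 addr0.
by rewrite !mulrDr !mulr1 ggg addrC.
Qed.

(** Idempotency of both products does not give gg'g = g. Replacing g by gg'g and g' by g'gg' keeps
    the two products and the vanishing squares, and provides the relations that [pair0_mulC] asks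
    for. *)
Lemma pair0_equiv (g g' : A) : g * g = 0 -> g' * g' = 0 ->
  g' * g * (g' * g) = g' * g -> g * g' * (g * g') = g * g' ->
  pair0 (g' * g) = pair0 (g * g').
Proof.
move=> gg gg' e e'.
have h1 : g * g' * g * (g' * g * g') = g * g' by rewrite -{2}e' -{2}e' !mulrA.
have h2 : g' * g * g' * (g * g' * g) = g' * g by rewrite -{2}e -{2}e !mulrA.
rewrite -[in RHS]h1 -[in LHS]h2; apply: pair0_mulC.
- by rewrite h1 !mulrA -[_ * g * g']mulrA e'.
- by rewrite h2 !mulrA -[_ * g' * g]mulrA e.
- by rewrite !mulrA -[_ * g * g]mulrA gg mulr0 !mul0r.
- by rewrite !mulrA -[_ * g' * g']mulrA gg' mulr0 !mul0r.
Qed.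

End EvenPairing.

(** * Odd degree: multiplication of invertibles by elementary matrices *)

Section OddPairing.

Definition inverses (u u' : A) : Prop := u * u' = 1 /\ u' * u = 1.

Lemma inverses_sym u u' : inverses u u' -> inverses u' u.
Proof. by case. Qed.

Lemma inversesM u u' v v' :
  inverses u u' -> inverses v v' -> inverses (u * v) (v' * u').
Proof.
move=> [uu' u'u] [vv' v'v]; split; rewrite mulrA.
  by rewrite -(mulrA u) vv' mulr1.
by rewrite -(mulrA v') u'u mulr1.
Qed.

Lemma inverses_nilp (N : A) : N * N = 0 -> inverses (1 + N) (1 - N).
Proof.
move=> NN; split.
  by rewrite mulrBr mulr1 mulrDl mul1r NN addr0 addrK.
by rewrite mulrBl mul1r mulrDr mulr1 NN addr0 addrK.
Qed.

(** The sequence begins with the second parameter, so that x = u - 1 and y = u^-1 - 1 give the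
    arguments of the odd pairing in the required order. *)
Definition alt (x y : A) n : seq A := flatten (nseq n [:: y; x]).

Lemma size_alt x y n : size (alt x y n) = n.*2.
Proof. by elim: n => //= n ->. Qed.

Lemma altD x y m n : alt x y m ++ alt x y n = alt x y (m + n).
Proof. by rewrite /alt nseqD flatten_cat. Qed.

Lemma rcons_alt x y n : rcons (alt x y n) y = y :: alt y x n.
Proof. by elim: n => //= n ->. Qed.

Lemma altS x y n : alt x y n.+1 = y :: rcons (alt y x n) x.
Proof. by rewrite rcons_alt. Qed.

(** Contracting a neighbouring pair yields minus the two sequences in which the pair is replaced by
    x or by y. Consecutive contractions share one of these sequences with opposite signs, so the
    alternating sum telescopes to its two ends. *)
Lemma bar_alt n phi (x y : A) pre k : multiadditive n phi ->
  x * y = - (x + y) -> y * x = - (x + y) -> (size pre + k.*2)%N = n ->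
  bar phi pre (alt x y k.+1) =
  - phi (pre ++ x :: alt x y k) - phi (pre ++ rcons (alt x y k) y).
Proof.
move=> phiD xy yx; elim: k pre => [|k IH] pre sz.
  have sz' : (size pre + size ([::] : seq A))%N = n by [].
  by rewrite /= subr0 yx (multiaddN phiD _ sz') (phiD _ _ sz') opprD.
rewrite -[LHS]/(phi (pre ++ y * x :: alt x y k.+1) -
  (phi (rcons pre y ++ x * y :: x :: alt x y k) -
    bar phi (rcons (rcons pre y) x) (alt x y k.+1))).
rewrite IH; last by rewrite !size_rcons -sz doubleS !addSn !addnS.
rewrite xy yx (multiaddN phiD); last by rewrite size_alt.
rewrite phiD; last by rewrite size_alt.
have sz1 : (size (rcons pre y) + size (x :: alt x y k))%N = n.
  by rewrite /= size_alt size_rcons -sz doubleS !addSn !addnS.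
rewrite (multiaddN phiD _ sz1) (phiD _ _ sz1) !cat_rcons.
rewrite -[alt x y k.+1]/(y :: x :: alt x y k) !rcons_cons.
ring.
Qed.

Variables (n : nat) (phi : seq A -> K).
Hypotheses (phiD : multiadditive n.*2.+1 phi) (phic : cyclic n.*2.+1 phi).
Hypothesis phiz : hclosed n.*2.+1 phi.

(** The two terms left by [bar_alt] are, up to a rotation that is free of sign in even degree, the
    two summands of the wrap-around term at xy = -(x + y), with opposite sign. *)
Lemma pair1_coboundary psi (x y : A) : multiadditive n.*2 psi -> cyclic n.*2 psi ->
  x * y = - (x + y) -> y * x = - (x + y) ->
  hoch n.*2 psi y (alt y x n) x = 0.
Proof.
move=> psiD psic xy yx.
have rot a s : size s = n.*2 -> psi (rcons s a) = psi (a :: s).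
  by move=> /psic ->; rewrite -signr_odd odd_double mul1r.
have sz : (size ([::] : seq A) + size (alt y x n))%N = n.*2 by rewrite size_alt.
rewrite /hoch -altS (bar_alt psiD xy yx)// !cat0s rcons_alt -[x :: alt x y n]rcons_alt.
rewrite rot ?size_alt// exprS -signr_odd odd_double mulr1 mulN1r xy.
rewrite -[- (x + y) :: _]cat0s (multiaddN psiD _ sz) (psiD _ _ sz) !cat0s.
by rewrite opprK -opprD addNr.
Qed.

(** The cocycle identity at (h, y, x, ..., y, x), with its inner terms telescoped by [bar_alt]. The
    entries -(h + hy) and h + xh are the derivatives of u^-1 - 1 and u - 1 when u' = uh. *)
Lemma pair1_commutator (x y h : A) : x * y = - (x + y) -> y * x = - (x + y) ->
  phi (- (h + h * y) :: x :: alt x y n) =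
  phi (h + x * h :: rcons (alt x y n) y).
Proof.
move=> xy yx.
have := phiz h (s := rcons (alt x y n) y) x.
rewrite size_rcons size_alt => /(_ erefl).
rewrite /hoch rcons_alt rcons_cons -altS -rcons_alt.
rewrite -[bar _ _ _]/(phi (h * y :: x :: alt x y n) -
  bar phi [:: h] (alt x y n.+1)) (bar_alt phiD xy yx); last by rewrite add1n.
rewrite -signr_odd; have -> : odd n.*2.+2 = false by rewrite /= odd_double.
rewrite mul1r !cat1s.
have sz1 : (size ([::] : seq A) + size (x :: alt x y n))%N = n.*2.+1.
  by rewrite /= size_alt.
have sz2 : (size ([::] : seq A) + size (rcons (alt x y n) y))%N = n.*2.+1.
  by rewrite size_rcons size_alt.
rewrite -[- _ :: _]cat0s -[h + x * h :: _]cat0s.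
rewrite (multiaddN phiD _ sz1) (phiD sz1) (phiD sz2) !cat0s => e.
by apply/eqP; rewrite -subr_eq0 -oppr_eq0 -e; apply/eqP; ring.
Qed.

Definition pair1 (u u' : A) := phi (alt (u - 1) (u' - 1) n.+1).

Lemma alt_pair_mul (u u' : A) : u * u' = 1 ->
  (u - 1) * (u' - 1) = - ((u - 1) + (u' - 1)).
Proof.
move=> uu'; rewrite mulrBl mulrBr uu' mulr1 mul1r.
by rewrite [RHS]opprD [- (u - 1)]opprB.
Qed.

(** An elementary factor may be dropped anywhere inside a product: the value is constant along u (1
    + tN) d. The right factor [d] is what [pair1_swap] needs to strip factors from the middle. *)
Lemma pair1_mul (u u' d d' N : A) : inverses u u' -> inverses d d' -> N * N = 0 ->
  pair1 (u * (1 + N) * d) (d' * (1 - N) * u') = pair1 (u * d) (d' * u').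
Proof.
move=> [uu' u'u] [dd' d'd] NN.
pose q : qpath A := (u * d - 1, u * N * d, 0).
pose q' : qpath A := (d' * u' - 1, - (d' * N * u'), 0).
have qE t : qval t q = u * (1 + N *+ t) * d - 1.
  rewrite /qval /= mul0rn addr0 mulrDr mulr1 mulrDl mulrnAr mulrnAl.
  by rewrite addrAC.
have q'E t : qval t q' = d' * (1 - N *+ t) * u' - 1.
  rewrite /qval /= mul0rn addr0 mulrBr mulr1 mulrBl mulrnAr mulrnAl.
  by rewrite addrAC mulNrn.
have tt t : (1 + N *+ t) * (1 - N *+ t) = 1.
  rewrite mulrBr mulr1 mulrDl mul1r mulrnAr mulrnAl NN !mul0rn addr0.
  by rewrite addrK.
have tt' t : (1 - N *+ t) * (1 + N *+ t) = 1.
  rewrite mulrBl mul1r mulrDr mulr1 mulrnAr mulrnAl NN !mul0rn addr0.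
  by rewrite addrK.
have qq' t : qval t q * qval t q' = - (qval t q + qval t q').
  rewrite qE q'E alt_pair_mul// !mulrA -[_ * d * d']mulrA dd' mulr1.
  by rewrite -[_ * _ * (1 - _)]mulrA tt mulr1.
have q'q t : qval t q' * qval t q = - (qval t q + qval t q').
  rewrite qE q'E alt_pair_mul; first by rewrite addrC.
  rewrite !mulrA -[_ * u' * u]mulrA u'u mulr1.
  by rewrite -[_ * _ * (1 + _)]mulrA tt' mulr1.
(* This is u_t^-1 u_t' for u_t = u (1 + tN) d, independent of t because N^2 = 0. *)
pose h := d' * N * d.
have dq t : qder t q = h + qval t q * h.
  rewrite /qder /= mul0rn addr0 qE mulrBl mul1r addrCA subrr addr0 /h !mulrA.
  rewrite -[_ * d * d']mulrA dd' mulr1 -[u * _ * N]mulrA mulrDl mul1r.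
  by rewrite mulrnAl NN mul0rn addr0.
have dq' t : qder t q' = - (h + h * qval t q').
  rewrite /qder /= mul0rn addr0 q'E mulrBr mulr1 addrCA subrr addr0 /h !mulrA.
  rewrite -[_ * d * d']mulrA dd' mulr1 -[_ * N * (1 - _)]mulrA mulrBr mulr1.
  by rewrite mulrnAr NN mul0rn subr0.
pose Q k := flatten (nseq k [:: q'; q]).
have QE k t : map (qval t) (Q k) = alt (qval t q) (qval t q') k.
  by rewrite /Q map_flatten map_nseq.
have szQ k : size (Q k) = k.*2 by rewrite /Q; elim: k => //= k ->.
have qt t i k : (i + k)%N = n.+1 ->
    qtotal phi (alt (qval t q) (qval t q') i) (Q k) t = 0.
  elim: k i => [//|k IH] i /= ik.
  rewrite cat_rcons rcons_alt rcons_cons -altS IH ?addSnnS// addr0 QE.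
  set y := qval t q'; set x := qval t q.
  have ik' : (k + i = n)%N by apply: succn_inj; rewrite -ik addnS addnC.
  (* The block passed has even length 2i, so this rotation has sign plus although the degree is
     odd. *)
  have ev s : size s = (k.*2).+2 -> phi (alt x y i ++ s) = phi (s ++ alt x y i).
    move=> ss; rewrite (cyclic_rot phic) ?size_alt ?ss.
      by rewrite -signr_odd oddM /= !odd_double /= mul1r.
    by rewrite -ik' doubleD !addSn.
  rewrite !ev /= ?size_alt// altD ik'.
  (* The terms that differentiate a y and the x after it are treated together: [pair1_commutator]
     rewrites the first, and moving the leading y of the second to the end, with sign minus in odd
     degree, shows that they are opposite. *)
  rewrite dq dq' -/x -/y (pair1_commutator _ (qq' t) (q'q t)) -/x -/y.
  have := phic y (s := qder t q :: alt x y n); rewrite /= size_alt.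
  rewrite -signr_odd /= odd_double mulN1r dq -/x => -> //.
  by rewrite addNr.
have der := qtotalP (pre := [::]) (Q := Q n.+1) phiD.
rewrite szQ in der; have {}der := polyder0 char0 (der erefl).
have := der (fun t => qt t 0%N n.+1 erefl).
rewrite !cat0s !QE !qE !q'E mulr0n mulr1n /pair1 => <-.
by rewrite addr0 subr0 !mulr1.
Qed.

Lemma pair1_mulr (u u' N : A) : inverses u u' -> N * N = 0 ->
  pair1 (u * (1 + N)) ((1 - N) * u') = pair1 u u'.
Proof.
move=> uu' NN; have i1 : inverses 1 1 by split; rewrite mulr1.
by have := pair1_mul uu' i1 NN; rewrite !mulr1 !mul1r.
Qed.

(* diag(v, 1) and diag(1, g v g') are conjugate under the product
   (1 + g)(1 - g')(1 + g) of elementary matrices. *)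
Lemma pair1_swap (u u' e1 e2 v v' g g' : A) : inverses u u' ->
  e1 + e2 = 1 -> g' * g = e1 -> g * g' = e2 -> g * g = 0 -> g' * g' = 0 ->
  e1 * v = v -> v * e1 = v -> e1 * v' = v' -> v' * e1 = v' ->
  v * v' = e1 -> v' * v = e1 ->
  pair1 (u * (g * v * g' + e1)) ((g * v' * g' + e1) * u') =
  pair1 (u * (v + e2)) ((v' + e2) * u').
Proof.
move=> uu' e12 g'g gg' gg g'g' ev ve ev' v'e vv' v'v.
have e1g : e1 * g = 0 by rewrite -g'g -mulrA gg mulr0.
have ge1 : g * e1 = g.
  by rewrite -[RHS]mulr1 -e12 mulrDr -gg' mulrA gg mul0r addr0.
have e2g : e2 * g = g by rewrite -[RHS]mul1r -e12 mulrDl e1g add0r.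
have e1g' : e1 * g' = g'.
  by rewrite -[RHS]mul1r -e12 mulrDl -[e2]gg' -mulrA g'g' mulr0 addr0.
have g'e1 : g' * e1 = 0 by rewrite -g'g mulrA g'g' mul0r.
have g'e2 : g' * e2 = g' by rewrite -[RHS]mulr1 -e12 mulrDr g'e1 add0r.
have ge2 : g * e2 = 0 by rewrite -gg' mulrA gg mul0r.
have e11 : e1 * e1 = e1 by rewrite -{2}g'g mulrA e1g' g'g.
have e22 : e2 * e2 = e2 by rewrite -{2}gg' mulrA e2g gg'.
have e1e2 : e1 * e2 = 0 by rewrite -gg' mulrA e1g mul0r.
have e2e1 : e2 * e1 = 0.
  by rewrite -g'g mulrA -[e2]gg' -[g * g' * g']mulrA g'g' mulr0 mul0r.
(* The Weyl element: for off-diagonal a and b, inverse to each other on the two summands, the three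
   elementary factors multiply to a - b, which exchanges the summands up to sign. *)
have WE (a b : A) : a * b = e2 -> b * a = e1 -> e1 * a = 0 -> a * a = 0 ->
    (1 + a) * (1 - b) * (1 + a) = a - b.
  move=> ab ba e1a aa.
  have -> : (1 + a) * (1 - b) = e1 + (a - b).
    rewrite mulrDl mul1r mulrBr mulr1 ab -{1}e12 -!addrA; congr (_ + _).
    by rewrite addrC -!addrA addNr addr0 addrC.
  rewrite mulrDr mulr1 mulrDl e1a mulrBl aa ba add0r sub0r.
  by rewrite addrC addrA addNr add0r.
have conj w : e1 * w = w -> w * e1 = w ->
    (g - g') * (w + e2) * (g' - g) = g * w * g' + e1.
  move=> ew we.
  have g'w : g' * w = 0 by rewrite -ew mulrA g'e1 mul0r.
  have wg : w * g = 0 by rewrite -we -mulrA e1g mulr0.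
  have -> : (g - g') * (w + e2) = g * w - g'.
    by rewrite mulrDr !mulrBl g'w ge2 g'e2 subr0 sub0r.
  rewrite mulrBr !mulrBl -(mulrA g w g) wg g'g' g'g mulr0.
  by rewrite subr0 !sub0r opprK.
have De w w' : w * e1 = w -> e1 * w' = w' -> w * w' = e1 ->
    (w + e2) * (w' + e2) = 1.
  move=> we ew ww; rewrite mulrDl !mulrDr ww e22.
  rewrite -{1}we -{1}ew -mulrA e1e2 mulr0 addr0 mulrA e2e1 mul0r add0r.
  exact: e12.
have NN (a : A) : a * a = 0 -> - a * - a = 0 by move=> aa; rewrite mulrNN.
have iD : inverses (v + e2) (v' + e2) by split; exact: De.
have ig : inverses (1 + g) (1 - g) := inverses_nilp gg.
have ig' : inverses (1 - g') (1 + g').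
  by have := inverses_nilp (NN _ g'g'); rewrite opprK.
rewrite -!conj// -(WE g g' gg' g'g e1g gg).
have -> : g' - g = (1 - g) * (1 + g') * (1 - g).
  rewrite -{1}[g']opprK addrC -{2}[g']opprK; apply/esym/WE.
  - by rewrite mulrNN.
  - by rewrite mulrNN.
  - by rewrite mulrN e1g oppr0.
  - by rewrite mulrNN.
pose D := v + e2; pose D' := v' + e2; rewrite -/D -/D' in iD *.
have R a a' N N' : inverses a a' -> N * N = 0 -> N' = - N ->
    pair1 (a * (1 + N)) ((1 + N') * a') = pair1 a a'.
  by move=> ia NN0 ->; rewrite pair1_mulr.
have M a a' N N' d d' : inverses a a' -> inverses d d' -> N * N = 0 ->
    N' = - N ->
    pair1 (a * (1 + N) * d) (d' * ((1 + N') * a')) = pair1 (a * d) (d' * a').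
  by move=> ia id NN0 ->; rewrite mulrA pair1_mul.
set W := (1 + g) * (1 - g') * (1 + g); set W' := (1 - g) * (1 + g') * (1 - g).
have iW : inverses W W'.
  by rewrite /W /W' -[in X in inverses _ X]mulrA; do 2?apply: inversesM.
(* The factors of [W'] stand at the right end and are removed first, by [R]; those of [W] stand to
   the left of [D] and are removed by [M]. *)
transitivity (pair1 (u * W * D) (D' * (W' * u'))).
  have ia : inverses (u * W * D) (D' * (W' * u')).
    by apply: inversesM iD; apply: inversesM.
  have -> : u * (W * D * W') = u * W * D * (1 - g) * (1 + g') * (1 - g).
    by rewrite /W' !mulrA.
  have -> : W * D' * W' * u' =
      (1 + g) * ((1 - g') * ((1 + g) * (D' * (W' * u')))) by rewrite /W !mulrA.
  have ig1 := inversesM ia (inverses_sym ig).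
  have ig2 := inversesM ig1 (inverses_sym ig').
  rewrite R ?opprK ?NN// R ?opprK ?NN// R ?opprK ?NN//.
have -> : u * W * D = u * (1 + g) * (1 - g') * (1 + g) * D by rewrite /W !mulrA.
have -> : W' * u' = (1 - g) * ((1 + g') * ((1 - g) * u')).
  by rewrite /W' !mulrA.
have ig1 := inversesM uu' ig; have ig2 := inversesM ig1 ig'.
by rewrite M// M ?opprK ?NN// M.
Qed.

End OddPairing.
End CyclicCocycles.

(** * Multilinear functions and traces *)

Section Multilinear.
Variable K : fieldType.
Implicit Types U V W : lmodType K.

(** Multilinearity in n + 1 arguments, with the indexing of [multiadditive]; it says nothing about
    sequences of other lengths. *)
Definition mlin V U n (F : seq V -> U) : Prop := forall s1 s2,
  (size s1 + size s2)%N = n -> lin (fun v => F (s1 ++ v :: s2)).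

Lemma eq_lin V W (f g : V -> W) : f =1 g -> lin f -> lin g.
Proof. by move=> /funext ->. Qed.

Lemma mlin_cons V U n (F : seq V -> U) v :
  mlin n.+1 F -> mlin n (fun s => F (v :: s)).
Proof. by move=> Fl s1 s2 sz; apply: (Fl (v :: s1)); rewrite /= addSn sz. Qed.

Lemma mlin_head V U n (F : seq V -> U) s :
  mlin n F -> size s = n -> lin (fun v => F (v :: s)).
Proof. by move=> Fl sz; apply: (Fl [::]). Qed.

Lemma mlinS V U n (F : seq V -> U) : (forall v, mlin n (fun s => F (v :: s))) ->
  (forall s, size s = n.+1 -> lin (fun v => F (v :: s))) -> mlin n.+1 F.
Proof. by move=> F1 F2 [|u s1] s2 sz; [apply: F2|apply: (F1 u s1 s2); case: sz]. Qed.

Lemma eq_mlin V U n (F G : seq V -> U) :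
  (forall s, size s = n.+1 -> F s = G s) -> mlin n F -> mlin n G.
Proof.
move=> FG Fl s1 s2 sz k x y.
have sz' v : size (s1 ++ v :: s2) = n.+1 by rewrite size_cat /= addnS sz.
by rewrite -!FG//; apply: Fl.
Qed.

Lemma mlin_comp V U W n (F : seq V -> U) (f : U -> W) :
  lin f -> mlin n F -> mlin n (fun s => f (F s)).
Proof. by move=> fl Fl s1 s2 sz; apply: lin_comp fl (Fl _ _ sz). Qed.

Lemma mlin_sum V U n (I : Type) (r : seq I) (F : I -> seq V -> U) :
  (forall i, mlin n (F i)) -> mlin n (fun s => \sum_(i <- r) F i s).
Proof. by move=> Fl s1 s2 sz; apply: lin_sumf => i; apply: Fl. Qed.

Lemma mlin_contract V U n (F : seq V -> U) (m : V -> V -> V) i :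
  bilin m -> mlin n F -> (i <= n)%N -> mlin n.+1 (fun s =>
    F (take i s ++ m s`_i s`_i.+1 :: drop i.+2 s)).
Proof.
move=> mb; elim: i n F => [|i IH] n F Fl lin_.
  move=> [|a [|b s1]] s2 sz /=.
  - case: s2 sz => [//|b s2] /= [sz]; rewrite ?drop0.
    by apply: lin_comp (mlin_head Fl sz) _; apply: lin_bilinl mb (@lin_id _ V).
  - rewrite /= ?drop0; case: sz => sz.
    by apply: lin_comp (mlin_head Fl sz) _; apply: lin_bilinr mb (@lin_id _ V).
  - apply: (eq_lin (f := fun v => F ((m a b :: s1) ++ v :: s2))) => [u|].
      by rewrite /= drop0.
    by apply: Fl; move: sz => /= [].
case: n F Fl lin_ => [//|n] F Fl lin_.
apply: mlinS => [v|s sz] /=.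
  exact: (IH n (fun s => F (v :: s)) (mlin_cons v Fl)).
apply: (mlin_head Fl).
by rewrite size_cat /= size_take size_drop sz; case: ifP; lia.
Qed.

Lemma mlin_cycle V U n (F : seq V -> U) (A : V -> V) :
  lin A -> mlin n F -> mlin n (fun s => F (A (last 0 s) :: take n s)).
Proof.
move=> Al Fl s1 s2 sz; case/lastP: s2 sz => [|s2 z] sz.
  rewrite addn0 in sz; apply: eq_lin (lin_comp (mlin_head Fl sz) Al) => v.
  by rewrite last_cat /= take_size_cat.
rewrite size_rcons addnS in sz.
apply: eq_lin (Fl (A z :: s1) s2 sz) => v.
rewrite last_cat /= last_rcons -rcons_cons -rcons_cat.
by rewrite -cats1 take_size_cat// size_cat /= addnS.
Qed.

Lemma tpow_lift_fun V W U n (G : W -> seq V -> U) w :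
  (forall s, size s = n.+1 -> lin (fun x => G x s)) ->
  lin (fun x => tpow_lift (n := n) (G x) w).
Proof.
elim: n G w => [|n IH] G w Gl; first exact: Gl.
apply: (lin_tlift_fun (F := fun x v => tpow_lift (fun s => G x (v :: s)))).
by move=> a b; apply: (IH (fun x s => G x (a :: s))) => s sz; apply: Gl; rewrite /= sz.
Qed.

Lemma tpow_liftP V U n (F : seq V -> U) : mlin n F ->
  lin (tpow_lift (n := n) F) /\
  forall s, size s = n.+1 -> tpow_lift F (tpure n s) = F s.
Proof.
elim: n F => [|n IH] F Fl.
  by split=> [|[|v [|]]//]; apply: (Fl [::] [::]).
have Fb : bilin (fun v => tpow_lift (n := n) (fun s => F (v :: s))).
  apply: bilinP => [w|v]; last by case: (IH _ (mlin_cons v Fl)).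
  apply: (@tpow_lift_fun _ _ _ _ (fun v s => F (v :: s))) => s sz.
  exact: mlin_head Fl sz.
split=> [k x y|[//|v s] [sz]] /=; first exact: tlift_linear.
by rewrite tlift_tens//; case: (IH _ (mlin_cons v Fl)) => _ ->.
Qed.

Lemma mlin_tpure V n : mlin n (tpure (V := V) n).
Proof.
elim: n => [|n IH]; first by move=> [|//] [|//] _.
apply: mlinS => [v|s sz] /=.
  by move=> s1 s2 sz; have := IH _ _ sz => Hl; lin_tac.
by lin_tac.
Qed.

(** The multilinear form of [lin_tens_ext]; it reduces the compatibilities of [Psi] to sequences of
    pure tensors, where the trace formula is explicit. *)
Lemma mlin_tens_ext V W U n (F G : seq (tensor V W) -> U) :
  mlin n F -> mlin n G ->
  (forall ps, size ps = n.+1 -> F [seq p.1 \ox p.2 | p <- ps] =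
                               G [seq p.1 \ox p.2 | p <- ps]) ->
  forall s, size s = n.+1 -> F s = G s.
Proof.
elim: n F G => [|n IH] F G Fl Gl FG [//|t s] [sz].
  case: s sz => // _; move: t; apply: lin_tens_ext.
  - exact: mlin_head Fl _.
  - exact: mlin_head Gl _.
  - by move=> v w; apply: (FG [:: (v, w)]).
move: t; apply: lin_tens_ext.
- exact: mlin_head Fl sz.
- exact: mlin_head Gl sz.
move=> v w; apply: (IH (fun s => F (_ :: s)) (fun s => G (_ :: s))) => //.
- exact: mlin_cons Fl.
- exact: mlin_cons Gl.
- by move=> ps szp; apply: (FG ((v, w) :: ps)); rewrite /= szp.
Qed.

Lemma tmap2_bilin V1 V2 V W1 W2 W (F : V1 -> V2 -> V) (G : W1 -> W2 -> W) :
  bilin F -> bilin G -> bilin (tmap2 F G).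
Proof. by move=> Fb Gb; rewrite /tmap2; lin_tac. Qed.

Lemma tmap2_tens V1 V2 V W1 W2 W (F : V1 -> V2 -> V) (G : W1 -> W2 -> W)
    v1 w1 v2 w2 : bilin F -> bilin G ->
  tmap2 F G (v1 \ox w1) (v2 \ox w2) = F v1 v2 \ox G w1 w2.
Proof.
by move=> Fb Gb; rewrite /tmap2 tlift_tens ?tlift_tens//; lin_tac.
Qed.

Lemma bilin_comp (X Y Z : vectType K) :
  bilin (fun (S : 'Hom(Y, Z)) (T : 'Hom(X, Y)) => (S \o T)%VF).
Proof. by lin_tac. Qed.

End Multilinear.

Section Trace.
Variable K : fieldType.

Lemma lin_lfun_tr (V : vectType K) : lin (lfun_tr (V := V) : 'End(V) -> K^o).
Proof.
move=> k S T; rewrite /lfun_tr scaler_sumr -big_split; apply: eq_bigr => i _.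
by rewrite add_lfunE scale_lfunE linearP.
Qed.

(** Both traces are the same double sum of products of matrix coefficients. The spaces may differ,
    as is needed to compare traces on a summand and on the direct sum. *)
Lemma lfun_trC (V W : vectType K) (A : 'Hom(V, W)) (B : 'Hom(W, V)) :
  lfun_tr (A \o B)%VF = lfun_tr (B \o A)%VF.
Proof.
have tr2 (U1 U2 : vectType K) (S : 'Hom(U1, U2)) (T : 'Hom(U2, U1)) :
    lfun_tr (T \o S)%VF = \sum_(i < \dim {:U1}) \sum_(j < \dim {:U2})
      coord (vbasis {:U2}) j (S (vbasis {:U1})`_i) *
      coord (vbasis {:U1}) i (T (vbasis {:U2})`_j).
  apply: eq_bigr => i _; rewrite comp_lfunE.
  rewrite [in LHS](coord_vbasis (memvf (S _))) !linear_sum.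
  by apply: eq_bigr => j _; rewrite !linearZ.
rewrite !tr2 exchange_big; apply: eq_bigr => i _; apply: eq_bigr => j _.
by rewrite mulrC.
Qed.

End Trace.

Lemma linfunE (K : fieldType) (V W : vectType K) (f : V -> W) v :
  lin f -> linfun f v = f v.
Proof.
move=> fl; pose fL := GRing.isLinear.Build K V W _ f fl.
pose f' : {linear V -> W} := HB.pack f fL.
by rewrite -[f]/(f' : V -> W) lfunE.
Qed.

Section Actions.
Variables (K : fieldType) (H : hopfAlg K).
Implicit Types X Y Z : fdMod H.

Lemma bilin_fdmod_act X : bilin (fdmod_act X).
Proof. by case: (fdmod_rmod X). Qed.

Lemma bilin_modalg_act (B : modAlg H) : bilin (modalg_act (m := B)).
Proof. by case: (modalg_rmod B). Qed.

Lemma rmod_repE X x v : rmod_rep X x v = fdmod_act X v x.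
Proof.
pose f : X -> X := fdmod_act X ^~ x.
have fl : linear f by move=> k u w; apply: (bilin_fdmod_act X).1.
exact: linfunE.
Qed.

Lemma lin_rmod_rep X : lin (rmod_rep X).
Proof.
move=> k x y; apply/lfunP => v; rewrite add_lfunE scale_lfunE !rmod_repE.
exact: (bilin_fdmod_act X).2.
Qed.

Lemma rmod_repM X x y : rmod_rep X (x * y) = (rmod_rep X y \o rmod_rep X x)%VF.
Proof.
by apply/lfunP => v; rewrite comp_lfunE !rmod_repE; case: (fdmod_rmod X) => _ _ ->.
Qed.

Lemma rmod_rep1 X : rmod_rep X 1 = \1%VF.
Proof.
by apply/lfunP => v; rewrite id_lfunE rmod_repE; case: (fdmod_rmod X) => _ ->.
Qed.

End Actions.

Ltac lin_hook ::= match goal with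
  | |- bilin _ => exact: bilin_modalg_act
  | |- bilin _ => exact: bilin_fdmod_act
  | |- lin (@antipodeV _ _) => exact: lin_antipodeV
  | |- lin (fun x => @antipodeV ?K ?H (@?a x)) =>
      apply: (lin_comp (g := a) (@lin_antipodeV K H))
  | |- lin (fun x => @modalg_act ?K ?H ?B (@?a x) ?b) =>
      apply: (lin_bilinl (a := a) b (@bilin_modalg_act K H B))
  | |- lin (fun x => @modalg_act ?K ?H ?B ?a (@?b x)) =>
      apply: (lin_bilinr (b := b) a (@bilin_modalg_act K H B))
  | |- lin (fun x => @umul ?K ?B (@?a x) ?b) =>
      apply: (lin_bilinl (a := a) b (@umul_bilin K B))
  | |- lin (fun x => @umul ?K ?B ?a (@?b x)) =>
      apply: (lin_bilinr (b := b) a (@umul_bilin K B))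
  | |- lin (fun x => @fdmod_act ?K ?H ?X (@?a x) ?b) =>
      apply: (lin_bilinl (a := a) b (@bilin_fdmod_act K H X))
  | |- lin (fun x => @fdmod_act ?K ?H ?X ?a (@?b x)) =>
      apply: (lin_bilinr (b := b) a (@bilin_fdmod_act K H X))
  | |- lin (fun x => @rmod_rep ?K ?H ?X (@?a x)) =>
      apply: (lin_comp (g := a) (@lin_rmod_rep K H X))
  | |- lin (fun x => @lfun_tr ?K ?V (@?a x)) =>
      apply: (lin_comp (g := a) (@lin_lfun_tr K V))
  end.

(** * Operators with coefficients in an H-module: action, product, blocks *)

Section HomTensor.
Variables (K : fieldType) (H : hopfAlg K).
Implicit Types (X Y Z : fdMod H) (U V W : lmodType K).

(** The formula of [homB_act] for an arbitrary coefficient space: it serves for B itself and for the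
    tensor powers of B in which [mu] takes its values. *)
Definition hom_act W (aW : W -> H -> W) X Y (t : tensor 'Hom(X, Y) W) (x : H) :
    tensor 'Hom(X, Y) W :=
  tlift (fun T w => sweedler3 (fun x0 x1 x2 =>
    (rmod_rep Y x0 \o T \o rmod_rep X (antipodeV x2))%VF \ox aW w x1) x) t.

Lemma bilin_hom_act W (aW : W -> H -> W) X Y :
  bilin aW -> bilin (hom_act aW (X := X) (Y := Y)).
Proof. by move=> aWb; rewrite /hom_act; lin_tac. Qed.

Lemma hom_act_tens W (aW : W -> H -> W) X Y (T : 'Hom(X, Y)) w x : bilin aW ->
  hom_act aW (T \ox w) x = sweedler3 (fun x0 x1 x2 =>
    (rmod_rep Y x0 \o T \o rmod_rep X (antipodeV x2))%VF \ox aW w x1) x.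
Proof. by move=> aWb; rewrite /hom_act tlift_tens//; lin_tac. Qed.

Definition hom_mul V W U (m : V -> W -> U) X Y Z (s : tensor 'Hom(Y, Z) V)
    (t : tensor 'Hom(X, Y) W) : tensor 'Hom(X, Z) U :=
  tmap2 (fun S T => (S \o T)%VF) m s t.

Lemma bilin_hom_mul V W U (m : V -> W -> U) X Y Z :
  bilin m -> bilin (hom_mul m (X := X) (Y := Y) (Z := Z)).
Proof. by move=> mb; apply: tmap2_bilin => //; apply: bilin_comp. Qed.

Lemma hom_mul_tens V W U (m : V -> W -> U) X Y Z (S : 'Hom(Y, Z))
    (T : 'Hom(X, Y)) v w : bilin m ->
  hom_mul m (S \ox v) (T \ox w) = (S \o T)%VF \ox m v w.
Proof. by move=> mb; apply: tmap2_tens => //; apply: bilin_comp. Qed.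

(** In (s <| x_0)(t <| x_1) the last operator of the first factor meets the first of the second.
    Since pi is an antihomomorphism they compose to pi(a S^-1(q_1)) for neighbouring legs q_1, a,
    which contracts to a counit. *)
Lemma hom_act_mul V W U (aV : V -> H -> V) (aW : W -> H -> W) (aU : U -> H -> U)
    (m : V -> W -> U) X Y Z (s : tensor 'Hom(Y, Z) V) (t : tensor 'Hom(X, Y) W) x :
  bilin aV -> bilin aW -> bilin aU -> bilin m ->
  (forall v w x, aU (m v w) x = sweedler2 (fun x0 x1 => m (aV v x0) (aW w x1)) x) ->
  hom_act aU (hom_mul m s t) x =
  sweedler2 (fun x0 x1 => hom_mul m (hom_act aV s x0) (hom_act aW t x1)) x.
Proof.
move=> aVb aWb aUb mb aUm.
have hVb := bilin_hom_act Y Z aVb; have hWb := bilin_hom_act X Y aWb.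
have hUb := bilin_hom_act X Z aUb.
have hmb := bilin_hom_mul X Y Z mb.
move: s; apply: lin_tens_ext => [||S v]; [by lin_tac|by lin_tac|].
move: t; apply: lin_tens_ext => [||T w]; [by lin_tac|by lin_tac|].
rewrite hom_mul_tens// hom_act_tens//.
transitivity (sweedler2 (fun q r => sweedler2 (fun q0 q1 => sweedler2 (fun a z =>
    sweedler2 (fun a0 a1 => sweedler2 (fun b1 b2 =>
    (rmod_rep Z a0 \o S \o rmod_rep Y (a * antipodeV q1) \o T \o
       rmod_rep X (antipodeV b2))%VF \ox m (aV v a1) (aW w b1)) z) q0) r) q) x).
  rewrite (sweedler_contract (Z' := fun q0 z => sweedler2 (fun a0 a1 =>
    sweedler2 (fun b1 b2 => (rmod_rep Z a0 \o (S \o T) \o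
       rmod_rep X (antipodeV b2))%VF \ox m (aV v a1) (aW w b1)) z) q0));
    [|by move=> *; lin_tac|by move=> *; lin_tac|by lin_tac|]; last first.
    move=> q0 u z; rewrite (sweedler_antipodeVr (f := fun r => sweedler2
      (fun a0 a1 => sweedler2 (fun b1 b2 => (rmod_rep Z a0 \o S \o
      rmod_rep Y r \o T \o rmod_rep X (antipodeV b2))%VF
      \ox m (aV v a1) (aW w b1)) z) q0)); last by lin_tac.
    congr (_ *: _); do 2![apply: eq_sweedler => ? ?].
    by rewrite rmod_rep1 comp_lfun1r !comp_lfunA.
  rewrite (sweedler_coassoc (F := fun a0 a1 z => sweedler2 (fun b1 b2 =>
    (rmod_rep Z a0 \o (S \o T) \o rmod_rep X (antipodeV b2))%VF
    \ox m (aV v a1) (aW w b1)) z)); last by lin_tac.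
  apply: eq_sweedler => a0 y.
  rewrite -(sweedler_coassoc (F := fun a1 b1 b2 => (rmod_rep Z a0 \o (S \o T) \o
    rmod_rep X (antipodeV b2))%VF \ox m (aV v a1) (aW w b1))); last by lin_tac.
  apply: eq_sweedler => y' b2.
  rewrite aUm (sweedler_lin _ _ (f := fun r => _ \ox r))//.
  by lin_tac.
apply: eq_sweedler => q r; rewrite !hom_act_tens//.
rewrite /sweedler3 -(sweedler_coassoc (F := fun a0 a1 a2 =>
  (rmod_rep Z a0 \o S \o rmod_rep Y (antipodeV a2))%VF \ox aV v a1));
  last by lin_tac.
rewrite (sweedler_lin _ _ (f := fun s => hom_mul m s _)); last by lin_tac.
apply: eq_sweedler => q0 q1; rewrite (sweedler_lin _ _ (f := hom_mul m _));
  last by lin_tac.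
apply: eq_sweedler => a z.
rewrite (sweedler_lin _ _ (f := fun s => hom_mul m s _)); last by lin_tac.
apply: eq_sweedler => a0 a1; rewrite (sweedler_lin _ _ (f := hom_mul m _));
  last by lin_tac.
apply: eq_sweedler => b1 b2; rewrite hom_mul_tens// rmod_repM.
by rewrite !comp_lfunA.
Qed.

Lemma sweedler_counit2 V (v : V) (x : H) :
  sweedler2 (fun x0 x1 => counit x0 *: (counit x1 *: v)) x = counit x *: v.
Proof. by rewrite (sweedler_counitl (f := fun y => counit y *: v))//; lin_tac. Qed.

Lemma hom_mul_inv V W U (aV : V -> H -> V) (aW : W -> H -> W) (aU : U -> H -> U)
    (m : V -> W -> U) X Y Z (s : tensor 'Hom(Y, Z) V) (t : tensor 'Hom(X, Y) W) :
  bilin aV -> bilin aW -> bilin aU -> bilin m ->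
  (forall v w x, aU (m v w) x = sweedler2 (fun x0 x1 => m (aV v x0) (aW w x1)) x) ->
  rinvariant (hom_act aV (X := Y) (Y := Z)) s ->
  rinvariant (hom_act aW (X := X) (Y := Y)) t ->
  rinvariant (hom_act aU (X := X) (Y := Z)) (hom_mul m s t).
Proof.
move=> aVb aWb aUb mb aUm si ti x; have hmb := bilin_hom_mul X Y Z mb.
rewrite (hom_act_mul _ _ _ aVb aWb)//.
rewrite -sweedler_counit2.
apply: eq_sweedler => x0 x1; rewrite si ti.
rewrite (linZ (f := fun s => hom_mul m s _)); last by lin_tac.
by rewrite linZ//; lin_tac.
Qed.

Definition hom_conj W X X' Y Y' (A : 'Hom(X', Y')) (A' : 'Hom(Y, X))
    (t : tensor 'Hom(X, X') W) : tensor 'Hom(Y, Y') W :=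
  tlift (fun T w => (A \o T \o A')%VF \ox w) t.

Lemma lin_hom_conj W X X' Y Y' (A : 'Hom(X', Y')) (A' : 'Hom(Y, X)) :
  lin (hom_conj (W := W) A A').
Proof. by rewrite /hom_conj; lin_tac. Qed.

Lemma hom_conj_tens W X X' Y Y' (A : 'Hom(X', Y')) (A' : 'Hom(Y, X)) T (w : W) :
  hom_conj A A' (T \ox w) = (A \o T \o A')%VF \ox w.
Proof. by rewrite /hom_conj tlift_tens//; lin_tac. Qed.

Definition equivariant X Y (A : 'Hom(X, Y)) : Prop :=
  forall x, (A \o rmod_rep X x)%VF = (rmod_rep Y x \o A)%VF.

Lemma hom_conj_act W (aW : W -> H -> W) X X' Y Y' (A : 'Hom(X', Y'))
    (A' : 'Hom(Y, X)) t x : bilin aW -> equivariant A -> equivariant A' ->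
  hom_act aW (hom_conj A A' t) x = hom_conj A A' (hom_act aW t x).
Proof.
move=> aWb Ae A'e; have hb := bilin_hom_act X X' aWb.
have hb' := bilin_hom_act Y Y' aWb; have cl := lin_hom_conj (W := W) A A'.
move: t; apply: lin_tens_ext => [||T w]; [by lin_tac|by lin_tac|].
rewrite hom_conj_tens !hom_act_tens// /sweedler3 (sweedler_lin _ _ cl).
apply: eq_sweedler => x0 y; rewrite (sweedler_lin _ _ cl).
apply: eq_sweedler => x1 x2; rewrite hom_conj_tens !comp_lfunA Ae.
by rewrite -!comp_lfunA A'e.
Qed.

Lemma hom_conj_inv W (aW : W -> H -> W) X X' Y Y' (A : 'Hom(X', Y'))
    (A' : 'Hom(Y, X)) t : bilin aW -> equivariant A -> equivariant A' ->
  rinvariant (hom_act aW (X := X) (Y := X')) t ->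
  rinvariant (hom_act aW (X := Y) (Y := Y')) (hom_conj A A' t).
Proof.
move=> aWb Ae A'e ti x; rewrite hom_conj_act// ti linZ//.
exact: lin_hom_conj.
Qed.

(** With [hom_conj_mul0] this is block matrix multiplication: the inner maps are a projection and an
    inclusion, composing to 1 for matching blocks and to 0 otherwise. *)
Lemma hom_conj_mul V W U (m : V -> W -> U) X X' Y Y' Z Z' (A : 'Hom(X', Y'))
    (A' : 'Hom(Y, X)) (C : 'Hom(X, Y)) (C' : 'Hom(Z, Z')) s t : bilin m ->
  (A' \o C)%VF = \1%VF ->
  hom_mul m (hom_conj A A' s) (hom_conj C C' t) = hom_conj A C' (hom_mul m s t).
Proof.
move=> mb A'C; have hb := bilin_hom_mul Z Y Y' mb.
have hb' := bilin_hom_mul Z' X X' mb; have cl := lin_hom_conj (W := U) A C'.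
have cl1 := lin_hom_conj (W := V) A A'; have cl2 := lin_hom_conj (W := W) C C'.
move: s; apply: lin_tens_ext => [||S v]; [by lin_tac|by lin_tac|].
move: t; apply: lin_tens_ext => [||T w]; [by lin_tac|by lin_tac|].
rewrite !hom_conj_tens !hom_mul_tens// hom_conj_tens !comp_lfunA.
by rewrite -(comp_lfunA _ A' C) A'C comp_lfun1r.
Qed.

Lemma hom_conj_mul0 V W U (m : V -> W -> U) X X' Y Y' X2 Z Z' (A : 'Hom(X', Y'))
    (A' : 'Hom(Y, X)) (C : 'Hom(X2, Y)) (C' : 'Hom(Z, Z')) s t : bilin m ->
  (A' \o C)%VF = 0 ->
  hom_mul m (hom_conj A A' s) (hom_conj C C' t) = 0.
Proof.
move=> mb A'C; have hb := bilin_hom_mul Z Y Y' mb.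
have cl1 := lin_hom_conj (W := V) A A'; have cl2 := lin_hom_conj (W := W) C C'.
have z0 (V1 V2 : lmodType K) : lin (fun _ : V1 => 0 : V2).
  by move=> k ? ?; rewrite scaler0 addr0.
move: s; apply: lin_tens_ext => [||S v]; [by lin_tac|exact: z0|].
move: t; apply: lin_tens_ext => [||T w]; [by lin_tac|exact: z0|].
rewrite !hom_conj_tens !hom_mul_tens// !comp_lfunA.
rewrite -(comp_lfunA _ A' C) A'C comp_lfun0r !comp_lfun0l.
by rewrite (lin0 (f := fun a => a \ox _))//; lin_tac.
Qed.

End HomTensor.

(** * The map Psi *)

Section PsiTheory.
Variables (K : fieldType) (H : hopfAlg K) (B : modAlg H).
Implicit Types X Y : fdMod H.

(** The operators are composed while the algebra entries stay apart in the tensor power. By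
    [Psi_tau] this single tensor is all that [Psi] sees, and invariance and block decompositions can
    be stated for it. *)
Fixpoint mu X n (s : seq (homB B X X)) : tensor 'Hom(X, X) (tpow B n) :=
  if n is m.+1 return tensor 'Hom(X, X) (tpow B n)
  then hom_mul (@tens _ B (tpow B m)) (head 0 s) (mu m (behead s)) else head 0 s.

Definition tau X n (f : chain H B n -> K) (x : H)
    (z : tensor 'Hom(X, X) (tpow B n)) : K^o :=
  tlift (fun T w => sweedler2 (fun x0 x1 =>
    f (x0 \ox w) * lfun_tr (rmod_rep X (antipodeV x1) \o T)%VF : K^o) x) z.

Lemma bilin_tau X n (f : chain H B n -> K) :
  lin (f : chain H B n -> K^o) -> bilin (tau (X := X) f).
Proof. by move=> fl; rewrite /tau; lin_tac. Qed.

Lemma tau_tens X n (f : chain H B n -> K) x (T : 'Hom(X, X)) w :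
  lin (f : chain H B n -> K^o) ->
  tau f x (T \ox w) = sweedler2 (fun x0 x1 =>
    f (x0 \ox w) * lfun_tr (rmod_rep X (antipodeV x1) \o T)%VF : K^o) x.
Proof. by move=> fl; rewrite /tau tlift_tens//; lin_tac. Qed.

Lemma mlin_mu X n : mlin n (@mu X n).
Proof.
elim: n => [|n IH]; first by move=> [|//] [|//] _.
have hb := bilin_hom_mul X X X (@tens_bilin _ B (tpow B n)).
apply: mlinS => [v|s sz] /=; last by lin_tac.
by move=> s1 s2 sz; have := IH _ _ sz => Hl; lin_tac.
Qed.

Lemma mu_pure X n (ps : seq ('Hom(X, X) * B)) : size ps = n.+1 ->
  mu n [seq p.1 \ox p.2 | p <- ps] =
  foldr (fun p T => p.1 \o T)%VF \1%VF ps \ox tpure n [seq p.2 | p <- ps].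
Proof.
elim: n ps => [|n IH] [//|p ps] [sz] /=.
  by case: ps sz => //= _; rewrite comp_lfun1r.
by rewrite IH// hom_mul_tens//; apply: tens_bilin.
Qed.

Lemma tens_mlift_mu X n (g : 'Hom(X, X) -> tpow B n -> K^o)
    (s : seq (homB B X X)) : bilin g -> size s = n.+1 ->
  tens_mlift (fun ps => g (foldr (fun p T => p.1 \o T)%VF \1%VF ps)
    (tpure n [seq p.2 | p <- ps])) s = tlift g (mu n s).
Proof.
elim: n g s => [|n IH] g [//|t s] gb [sz].
  case: s sz => //= _; congr tlift.
  by apply/funext => T; apply/funext => b /=; rewrite comp_lfun1r.
transitivity (tlift (fun T b => tlift (fun T' w => g (T \o T')%VF (b \ox w))
    (mu n s)) t).
  apply: eq_bigr => -[T b] _ /=.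
  apply: (IH (fun T' w => g (T \o T')%VF (b \ox w)))=> //; lin_tac.
have gl : lin (tlift g) by lin_tac.
rewrite /= /hom_mul /tmap2 [RHS](lin_sum gl); apply: eq_bigr => p _.
rewrite [RHS](lin_sum gl); apply: eq_bigr => q _.
by rewrite tlift_tens.
Qed.

Section OneCochain.
Variables (n : nat) (f : chain H B n -> K).
Hypothesis fl : lin (f : chain H B n -> K^o).

Lemma chain_liftP (V U : lmodType K) m (F : H -> seq V -> U) :
  (forall x, mlin m (F x)) ->
  (forall s, size s = m.+1 -> lin (fun x => F x s)) ->
  lin (chain_lift F : chain H V m -> U) /\
  forall x s, size s = m.+1 -> chain_lift F (chain_pure m x s) = F x s.
Proof.
move=> F1 F2.
have Fb : bilin (fun x => tpow_lift (n := m) (F x)).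
  apply: bilinP => [w|x]; first exact: tpow_lift_fun.
  by case: (tpow_liftP (F1 x)).
split=> [k x y|x s sz]; first exact: tlift_linear.
by rewrite /chain_lift /chain_pure tlift_tens//; case: (tpow_liftP (F1 x)) => _ ->.
Qed.

Lemma mlin_chain_pure (V : lmodType K) m x : mlin m (@chain_pure K H V m x).
Proof.
by apply: mlin_comp (@mlin_tpure _ _ _); lin_tac.
Qed.

Lemma mlin_tau_mu X x : mlin n (fun s => tau f x (@mu X n s)).
Proof.
have tb := bilin_tau X fl.
by apply: mlin_comp (@mlin_mu _ _); lin_tac.
Qed.

Lemma Psi_tau X x s : size s = n.+1 ->
  Psi (X := X) f (chain_pure n x s) = tau f x (mu n s).
Proof.
move=> sz; have tb := bilin_tau X fl.
pose F (x : H) (s : seq (homB B X X)) : K^o := tens_mlift (fun s =>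
  sweedler2 (fun x0 x1 => f (chain_pure n x0 [seq p.2 | p <- s]) *
    lfun_tr (rmod_rep X (antipodeV x1) \o
             foldr (fun p T => p.1 \o T) \1 s)%VF : K^o) x) s.
have FE y r : size r = n.+1 -> F y r = tau f y (mu n r).
  move=> szr; apply: (tens_mlift_mu (g := fun T w => sweedler2 (fun x0 x1 =>
    f (x0 \ox w) * lfun_tr (rmod_rep X (antipodeV x1) \o T)%VF : K^o) y)) => //.
  by lin_tac.
rewrite -FE//; apply: (chain_liftP (F := F) _ _).2 => // [y|r szr].
  apply: eq_mlin (@mlin_tau_mu X y) => r szr.
  by rewrite FE.
apply: (eq_lin (f := fun y => tau f y (mu n r))) => [y|]; first by rewrite FE.
by lin_tac.
Qed.

Lemma Psi_pure X x (ps : seq ('Hom(X, X) * B)) : size ps = n.+1 ->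
  Psi f (chain_pure n x ([seq p.1 \ox p.2 | p <- ps] : seq (homB B X X))) =
  sweedler2 (fun x0 x1 => f (chain_pure n x0 [seq p.2 | p <- ps]) *
    lfun_tr (rmod_rep X (antipodeV x1) \o
             foldr (fun p T => p.1 \o T) \1 ps)%VF : K^o) x.
Proof. by move=> sz; rewrite Psi_tau ?size_map// mu_pure// tau_tens. Qed.

Lemma mlin_Psi X x : mlin n (fun s => Psi (X := X) f (chain_pure n x s) : K^o).
Proof.
apply: eq_mlin (@mlin_tau_mu X x) => s sz.
by rewrite Psi_tau.
Qed.

Lemma lin_Psi X s : size s = n.+1 ->
  lin (fun x => Psi (X := X) f (chain_pure n x s) : K^o).
Proof.
move=> sz; apply: (eq_lin (f := fun y => tau f y (mu n s))) => [y|].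
  by rewrite Psi_tau.
by have tb := bilin_tau X fl; lin_tac.
Qed.

Lemma face_mulP i : (i <= n)%N ->
  lin (face_mul i f : chain H B n.+1 -> K^o) /\
  forall x s, size s = n.+2 -> face_mul i f (chain_pure n.+1 x s) =
    f (chain_pure n x (take i s ++ umul s`_i s`_i.+1 :: drop i.+2 s)).
Proof.
move=> in_; apply: (chain_liftP (U := K^o)) => [x|s sz].
  apply: (mlin_contract (F := fun s => f (chain_pure n x s) : K^o)) => //.
    exact: umul_bilin.
  exact: (mlin_comp fl (@mlin_chain_pure B n _)).
by rewrite /chain_pure; lin_tac.
Qed.

Lemma cycP : lin (cyc f : chain H B n -> K^o) /\
  forall x s, size s = n.+1 -> cyc f (chain_pure n x s) = sweedler2 (fun x0 x1 =>
    f (chain_pure n x0 (modalg_act (last 0 s) x1 :: take n s))) x.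
Proof.
apply: (chain_liftP (U := K^o)) => [x|s sz].
  apply: mlin_sum => p.
  apply: (mlin_cycle (A := modalg_act ^~ p.2) (F := fun s =>
    f (chain_pure n p.1 s) : K^o)); first by lin_tac.
  exact: (mlin_comp fl (@mlin_chain_pure B n _)).
have cb : bilin (fun x0 x1 =>
    f (chain_pure n x0 (modalg_act (last 0 s) x1 :: take n s)) : K^o).
  apply: bilinP => [b|a]; first by rewrite /chain_pure; lin_tac.
  have szt : size (take n s) = n by rewrite size_take sz ltnSn.
  have hl := mlin_head (@mlin_chain_pure B n a) szt.
  have al : lin (modalg_act (last 0 s)) by lin_tac.
  exact: (lin_comp fl (lin_comp hl al)).
by lin_tac.
Qed.

End OneCochain.
End PsiTheory.

(** * Compatibility of Psi with faces, rotation and invariance *)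

Section PsiCochains.
Variables (K : fieldType) (H : hopfAlg K) (B : modAlg H).
Implicit Types X Y : fdMod H.

Definition contract V (m : V -> V -> V) (x0 : V) i (s : seq V) : seq V :=
  take i s ++ m (nth x0 s i) (nth x0 s i.+1) :: drop i.+2 s.

Lemma foldr_comp_acc X (ps : seq ('Hom(X, X) * B)) (S : 'Hom(X, X)) :
  (foldr (fun p T => p.1 \o T) S ps =
   foldr (fun p T => p.1 \o T) \1 ps \o S)%VF.
Proof.
by elim: ps => [|p ps IH] /=; rewrite ?comp_lfun1l// IH comp_lfunA.
Qed.

Lemma bilin_homB_mul X Y Z : bilin (@homB_mul K H B X Y Z).
Proof. exact: (bilin_hom_mul X Y Z (@umul_bilin K B)). Qed.

Lemma map_contract_pure X (ps : seq ('Hom(X, X) * B)) i : (i.+1 < size ps)%N ->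
  contract (@homB_mul K H B X X X) 0 i [seq p.1 \ox p.2 | p <- ps] =
  [seq p.1 \ox p.2 | p <- contract (fun p q => ((p.1 \o q.1)%VF, umul p.2 q.2))
    (\1%VF, 0) i ps].
Proof.
move=> ilt; rewrite /contract map_cat map_take /= -map_drop.
rewrite !(nth_map (\1%VF, 0))// ?(ltnW ilt)//.
by rewrite [homB_mul _ _](hom_mul_tens _ _ _ _ (@umul_bilin K B)).
Qed.

Lemma foldr_contract X (ps : seq ('Hom(X, X) * B)) i : (i.+1 < size ps)%N ->
  (foldr (fun p T => p.1 \o T) \1 (contract (fun p q => (p.1 \o q.1, umul p.2 q.2))
    (\1, 0) i ps) = foldr (fun p T => p.1 \o T) \1 ps)%VF.
Proof.
elim: i ps => [|i IH] [|p [|q ps]]//= ilt.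
  by rewrite /contract /= drop0 comp_lfunA.
by congr (_ \o _)%VF; apply: (IH (q :: ps)).
Qed.

Lemma map_contract_snd X (ps : seq ('Hom(X, X) * B)) i : (i.+1 < size ps)%N ->
  [seq p.2 | p <- contract (fun p q => ((p.1 \o q.1)%VF, umul p.2 q.2))
    (\1%VF, 0) i ps] = contract umul 0 i [seq p.2 | p <- ps].
Proof.
move=> ilt; rewrite /contract map_cat map_take /= -map_drop.
by rewrite !(nth_map (\1%VF, 0))// ?(ltnW ilt).
Qed.

Lemma size_contract V (m : V -> V -> V) x0 i n s : (i <= n)%N -> size s = n.+2 ->
  size (contract m x0 i s) = n.+1.
Proof.
move=> in_ sz; rewrite /contract size_cat /= size_take size_drop sz.
by case: ifP; lia.
Qed.

Lemma take_rcons_size (V : Type) n (s : seq V) v :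
  size s = n -> take n (rcons s v) = s.
Proof. by move=> sz; rewrite -cats1 take_size_cat. Qed.

Section OneCochain.
Variables (n : nat) (f : chain H B n -> K).
Hypothesis fl : lin (f : chain H B n -> K^o).

(** On pure tensors the trace depends only on the product T_0 ... T_{n+1}, which is unchanged when
    two neighbours are multiplied. *)
Lemma Psi_face X i x (s : seq (homB B X X)) : (i <= n)%N -> size s = n.+2 ->
  Psi (face_mul i f) (chain_pure n.+1 x s) =
  Psi f (chain_pure n x (contract (@homB_mul K H B X X X) 0 i s)).
Proof.
move=> in_; have [gl gP] := face_mulP fl in_; move: s.
apply: (mlin_tens_ext (U := K^o) (n := n.+1)
  (F := fun s => Psi (face_mul i f) (chain_pure n.+1 x s))
  (G := fun s => Psi f (chain_pure n x (contract (@homB_mul K H B X X X) 0 i s)))).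
- exact: mlin_Psi.
- apply: (mlin_contract (F := fun s => Psi f (chain_pure n x s) : K^o)) => //.
    exact: bilin_homB_mul.
  exact: mlin_Psi.
move=> ps sz; have ilt : (i.+1 < size ps)%N by rewrite sz ltnS.
rewrite Psi_pure// map_contract_pure// Psi_pure//; last exact: size_contract.
apply: eq_sweedler => x0 x1.
by rewrite gP ?size_map// foldr_contract// map_contract_snd.
Qed.

(** The trace property brings the last operator T to the front. On the other side the twisted action
    on T produces pi(x_2 S^-1(x_1)), which contracts to a counit and leaves the same expression. *)
Lemma Psi_cyc X x (s : seq (homB B X X)) a : size s = n ->
  Psi (cyc f) (chain_pure n x (rcons s a)) =
  sweedler2 (fun x0 x1 => Psi f (chain_pure n x0 (homB_act a x1 :: s))) x.
Proof.
have [cl cP] := cycP fl; have hb := bilin_hom_act X X (@bilin_modalg_act K H B).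
(* The right side is restated for one sequence, through its last entry and its first n entries, so
   that [mlin_tens_ext] applies. *)
pose G (r : seq (homB B X X)) : K^o := sweedler2 (fun x0 x1 =>
  Psi f (chain_pure n x0 (homB_act (last 0 r) x1 :: take n r)) : K^o) x.
move=> sz; transitivity (G (rcons s a)); last first.
  rewrite /G last_rcons take_rcons_size//.
have : size (rcons s a) = n.+1 by rewrite size_rcons sz.
move: (rcons s a) => r; move: r {s sz a}.
apply: (mlin_tens_ext (U := K^o) (n := n) (G := G)
  (F := fun s => Psi (cyc f) (chain_pure n x s))).
- exact: mlin_Psi.
- apply: mlin_sum => p; apply: (mlin_cycle (A := fun a => homB_act a p.2)
    (F := fun s => Psi f (chain_pure n p.1 s) : K^o)); last exact: mlin_Psi.
  by case: hb => hl _ k u v; apply: hl.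
move=> ps; case/lastP: ps => [//|qs [T b]]; rewrite size_rcons => -[sz].
rewrite Psi_pure ?size_rcons ?sz//.
rewrite /G !map_rcons last_rcons take_rcons_size ?size_map//=.
set Q := (foldr (fun p T => p.1 \o T) \1 qs)%VF.
set bs := [seq p.2 | p <- qs].
have szbs : size bs = n by rewrite size_map.
have hl x0 := mlin_head (@mlin_chain_pure K H B n x0) szbs.
pose F x0 (v : B) : K^o := f (chain_pure n x0 (v :: bs)).
have Fb : bilin F.
  apply: bilinP => [v|u]; last exact: lin_comp fl (hl u).
  by rewrite /F /chain_pure; lin_tac.
transitivity (sweedler2 (fun x0 x1 => sweedler2 (fun u v => F u (modalg_act b v)
    * lfun_tr (T \o (rmod_rep X (antipodeV x1) \o Q))%VF : K^o) x0) x).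
  apply: eq_sweedler => x0 x1.
  rewrite cP ?size_rcons ?size_map ?sz// last_rcons take_rcons_size//.
  rewrite foldr_rcons foldr_comp_acc /= comp_lfun1r -/Q.
  rewrite comp_lfunA lfun_trC; set t := lfun_tr _.
  have rl : lin (fun y : K^o => (y : K) * t : K^o) by lin_tac.
  exact: (sweedler_lin _ _ rl).
rewrite (sweedler_coassoc (F := fun u v x1 => F u (modalg_act b v)
    * lfun_tr (T \o (rmod_rep X (antipodeV x1) \o Q))%VF : K^o)); last by lin_tac.
transitivity (sweedler2 (fun x0 r => sweedler2 (fun u v =>
    sweedler2 (fun a z => sweedler2 (fun c d => F u (modalg_act b c) *
    lfun_tr (rmod_rep X (a * antipodeV v) \o (T \o (rmod_rep X (antipodeV d)
     \o Q)))%VF : K^o) z) r) x0) x).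
  rewrite (sweedler_contract (Z' := fun u z => sweedler2 (fun c d =>
    F u (modalg_act b c) * lfun_tr (T \o (rmod_rep X (antipodeV d)
      \o Q))%VF : K^o) z));
    [|by move=> *; lin_tac|by move=> *; lin_tac|by lin_tac|]; first by [].
  move=> u w z; rewrite (sweedler_antipodeVr (f := fun r => sweedler2 (fun c d =>
    F u (modalg_act b c) * lfun_tr (rmod_rep X r \o (T \o (rmod_rep X
    (antipodeV d) \o Q)))%VF : K^o) z)); last by lin_tac.
  congr (_ *: _); apply: eq_sweedler => c d.
  by rewrite rmod_rep1 comp_lfun1l.
apply: eq_sweedler => x0 x1.
rewrite [homB_act _ _](hom_act_tens _ _ _ (@bilin_modalg_act K H B)).
pose L (t : homB B X X) : K^o := Psi f (chain_pure n x0
  (t :: [seq p.1 \ox p.2 | p <- qs])).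
have Ll : lin L by apply: (mlin_head (mlin_Psi fl x0)); rewrite size_map.
rewrite -[RHS]/(L _) /sweedler3 (sweedler_lin _ _ Ll) sweedler_exchange.
apply: eq_sweedler => a z; rewrite (sweedler_lin _ _ Ll) sweedler_exchange.
apply: eq_sweedler => c d.
rewrite /L (Psi_pure fl x0 (ps := (_, _) :: qs)) /= ?sz//.
apply: eq_sweedler => u v; rewrite -/Q -/bs rmod_repM !comp_lfunA.
by [].
Qed.

End OneCochain.

Section Invariance.
Variables (X : fdMod H) (n : nat).

Lemma bilin_tpow_act m : bilin (@tpow_act K H B (@modalg_act K H B) m).
Proof.
elim: m => [|m IH] /=; first exact: bilin_modalg_act.
by rewrite /tensor_act; lin_tac.
Qed.

Lemma tpow_act_tens m (b : B) (w : tpow B m) x :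
  tpow_act (@modalg_act K H B) (n := m.+1) (b \ox w) x =
  sweedler2 (fun x0 x1 => modalg_act b x0 \ox
    tpow_act (@modalg_act K H B) w x1) x.
Proof.
by have tb := bilin_tpow_act m; rewrite /= /tensor_act tlift_tens//; lin_tac.
Qed.

Lemma mu_inv m (s : seq (homB B X X)) : size s = m.+1 ->
  (forall i, (i <= m)%N -> homB_inv s`_i) ->
  rinvariant (hom_act (@tpow_act K H B (@modalg_act K H B) m) (X := X) (Y := X))
    (mu m s).
Proof.
elim: m s => [|m IH] [//|t s] [sz] si; first exact: (si 0%N).
apply: (hom_mul_inv (bilin_modalg_act B) (bilin_tpow_act m)
  (bilin_tpow_act m.+1)).
- exact: tens_bilin.
- exact: tpow_act_tens.
- exact: (si 0%N).
- by apply: IH => // i im; apply: (si i.+1).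
Qed.

Variable f : chain H B n -> K.
Hypothesis fc : is_cochain f.

Lemma tau_adj (z : tensor 'Hom(X, X) (tpow B n)) (w y : H) :
  rinvariant (hom_act (@tpow_act K H B (@modalg_act K H B) n) (X := X) (Y := X)) z ->
  tau f (adj_act w y) z = counit y *: tau f w z.
Proof.
case: fc => [fl' fi] zi; have fl : lin (f : chain H B n -> K^o) := fl'.
have tb := bilin_tau X fl; have ab := bilin_tpow_act n.
have hb := bilin_hom_act X X ab.
have adjl : lin (@adj_act K H w) by rewrite /adj_act; lin_tac.
(* Invariance of [z] is spent here, letting y_0 act on [w] and y_1 on [z]. Only after this may [z]
   be replaced by a pure tensor, which need not be invariant. *)
have -> : tau f (adj_act w y) z = sweedler2 (fun y0 y1 =>
    tau f (adj_act w y0) (hom_act (tpow_act (@modalg_act K H B) (n := n)) z y1)) y.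
  have tl : lin (fun y => tau f (adj_act w y) z) by lin_tac.
  rewrite -(sweedler_counitr y tl); apply: eq_sweedler => y0 y1.
  by rewrite zi linZ//; lin_tac.
move: z {zi}; apply: lin_tens_ext => [||S v]; [by lin_tac|by lin_tac|].
rewrite tau_tens//.
pose F w0 b : K^o := f (w0 \ox tpow_act (@modalg_act K H B) v b).
pose c w0 : K^o := f (w0 \ox v).
pose t r : K^o := lfun_tr (rmod_rep X r \o S)%VF.
have Fb : bilin F by rewrite /F; lin_tac.
have cl : lin c by rewrite /c; lin_tac.
have tl : lin t by rewrite /t; lin_tac.
have := sweedler_adj_trace w y Fb cl tl; rewrite /c /t => <-; last first.
  move=> w0 y0; rewrite -[RHS]fi /chain_act /tensor_act tlift_tens; last first.
    by rewrite /adj_act; lin_tac.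
  rewrite (sweedler_lin _ _ fl) -(sweedler_coassoc (F := fun p1 q0 b =>
    F (antipodeV p1 * w0 * q0) b)); last by lin_tac.
  apply: eq_sweedler => y1 b; rewrite /adj_act.
  by rewrite (sweedler_lin _ _ (f := fun r => f (r \ox _) : K^o))//; lin_tac.
apply: eq_sweedler => y0 y1.
pose L w0 : K^o := tau f w0 (hom_act (tpow_act (@modalg_act K H B) (n := n))
  (S \ox v) y1).
have Ll : lin L by rewrite /L; lin_tac.
rewrite -[LHS]/(L _) /adj_act (sweedler_lin _ _ Ll); apply: eq_sweedler => p q.
rewrite /L; set r := antipodeV p * w * q; rewrite hom_act_tens// /sweedler3.
have tr : lin (tau (X := X) f r) by lin_tac.
rewrite (sweedler_lin _ _ tr) [RHS]sweedler_exchange.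
apply: eq_sweedler => a z; rewrite (sweedler_lin _ _ tr) [RHS]sweedler_exchange.
apply: eq_sweedler => b d; rewrite tau_tens//; apply: eq_sweedler => w0 w1.
rewrite !rmod_repM comp_lfunA lfun_trC !comp_lfunA.
by [].
Qed.

End Invariance.
End PsiCochains.

(** * The algebra of invariants *)

Section Invariants.
Variables (K : fieldType) (H : hopfAlg K) (B : modAlg H).
Implicit Types X Y Z : fdMod H.

Lemma homB_mul_tens X Y Z (S : 'Hom(Y, Z)) (T : 'Hom(X, Y)) (a b : B) :
  homB_mul (S \ox a : homB B Y Z) (T \ox b : homB B X Y) =
  (S \o T)%VF \ox umul a b.
Proof. exact: hom_mul_tens (@umul_bilin K B). Qed.

Lemma homB_mulA X1 X2 X3 X4 (r : homB B X3 X4) (s : homB B X2 X3)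
    (t : homB B X1 X2) : homB_mul r (homB_mul s t) = homB_mul (homB_mul r s) t.
Proof.
have b1 := bilin_homB_mul B X1 X3 X4; have b2 := bilin_homB_mul B X1 X2 X3.
have b3 := bilin_homB_mul B X1 X2 X4; have b4 := bilin_homB_mul B X2 X3 X4.
move: r; apply: lin_tens_ext => [||T a]; [by lin_tac|by lin_tac|].
move: s; apply: lin_tens_ext => [||T' b]; [by lin_tac|by lin_tac|].
move: t; apply: lin_tens_ext => [||T'' c]; [by lin_tac|by lin_tac|].
by rewrite !homB_mul_tens comp_lfunA umulA.
Qed.

Lemma homB_mul1l X Y (t : homB B X Y) : homB_mul (homB1 B Y) t = t.
Proof.
have b1 := bilin_homB_mul B X Y Y.
move: t; apply: lin_tens_ext => [||T b]; [by lin_tac|by lin_tac|].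
rewrite homB_mul_tens.
by rewrite comp_lfun1l umul1l.
Qed.

Lemma homB_mul1r X Y (t : homB B X Y) : homB_mul t (homB1 B X) = t.
Proof.
have b1 := bilin_homB_mul B X X Y.
move: t; apply: lin_tens_ext => [||T b]; [by lin_tac|by lin_tac|].
rewrite homB_mul_tens.
by rewrite comp_lfun1r umul1r.
Qed.

(** A separate name to carry the ring structure. It is only a possibly trivial ring, because X or B
    may be zero. *)
Definition endB X : Type := homB B X X.
HB.instance Definition _ X := GRing.Zmodule.on (endB X).

Lemma endB_mulDl X : left_distributive (@homB_mul K H B X X X) +%R.
Proof.
by move=> r s t; have [bl _] := bilin_homB_mul B X X X; apply: linD (bl t) r s.
Qed.

Lemma endB_mulDr X : right_distributive (@homB_mul K H B X X X) +%R.
Proof.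
by move=> r s t; have [_ br] := bilin_homB_mul B X X X; apply: linD (br r) s t.
Qed.

HB.instance Definition _ X := GRing.Zmodule_isPzRing.Build (endB X)
  (@homB_mulA X X X X) (@homB_mul1l X X) (@homB_mul1r X X)
  (@endB_mulDl X) (@endB_mulDr X).

Lemma homB_mul_inv X Y Z (s : homB B Y Z) (t : homB B X Y) :
  homB_inv s -> homB_inv t -> homB_inv (homB_mul s t).
Proof.
apply: (hom_mul_inv (bilin_modalg_act B) (bilin_modalg_act B)
  (bilin_modalg_act B)); first exact: umul_bilin.
exact: modalg_actM.
Qed.

(** The middle leg acts on the unit of B by the counit, and pi(x_0) pi(S^-1(x_1)) = pi(S^-1(x_1)
    x_0) is again a counit. *)
Lemma homB1_inv X : homB_inv (homB1 B X).
Proof.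
move=> x; rewrite [homB_act _ _](hom_act_tens _ _ _ (bilin_modalg_act B)).
transitivity (sweedler2 (fun x0 x' => sweedler2 (fun x1 x2 =>
  counit x1 *: (rmod_rep X (antipodeV x2 * x0) \ox uone : homB B X X)) x') x).
  apply: eq_sweedler => x0 x'; apply: eq_sweedler => x1 x2.
  rewrite modalg_act1 comp_lfun1r rmod_repM linZ//; lin_tac.
transitivity (sweedler2 (fun x0 x' =>
    (rmod_rep X (antipodeV x' * x0) \ox uone : homB B X X)) x).
  apply: eq_sweedler => x0 x'; rewrite (sweedler_counitl (f := fun r =>
    (rmod_rep X (antipodeV r * x0) \ox uone : homB B X X)))//; lin_tac.
rewrite (sweedler_antipodeVl (f := fun r =>
  (rmod_rep X r \ox uone : homB B X X))); last by lin_tac.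
by rewrite rmod_rep1.
Qed.

Lemma homB_inv0 X Y : homB_inv (0 : homB B X Y).
Proof.
move=> x; rewrite scaler0.
have [bl _] := bilin_hom_act X Y (bilin_modalg_act B).
exact: (lin0 (bl x)).
Qed.

Lemma homB_invB X Y (s t : homB B X Y) :
  homB_inv s -> homB_inv t -> homB_inv (s - t).
Proof.
move=> si ti x; have [bl _] := bilin_hom_act X Y (bilin_modalg_act B).
rewrite [s - t]addrC -scaleN1r [LHS](bl x (-1) t s).
by rewrite [hom_act _ _ _]ti [hom_act _ _ _]si scalerDr !scalerA mulrC.
Qed.

Definition inv_pred X : {pred endB X} := fun t => `[< @homB_inv K H B X X t >].

Lemma inv_subring_closed X : subring_closed (@inv_pred X).
Proof.
split=> [|s t /asboolP si /asboolP ti|s t /asboolP si /asboolP ti]; apply/asboolP.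
- exact: homB1_inv.
- exact: homB_invB.
- exact: homB_mul_inv.
Qed.

Section InvB.
Variable X : fdMod H.

HB.instance Definition _ :=
  GRing.isSubringClosed.Build _ (@inv_pred X) (@inv_subring_closed X).

Record invB := InvB { invB_val :> endB X; invB_valP : invB_val \in @inv_pred X }.

HB.instance Definition _ := [isSub for invB_val].
HB.instance Definition _ := [Choice of invB by <:].
HB.instance Definition _ := 
  GRing.SubChoice_isSubPzRing.Build _ _ invB (@inv_subring_closed X).

End InvB.

Definition mkinv X (t : homB B X X) (ti : homB_inv t) : invB X :=
  InvB (introT (asboolP _) ti : (t : endB X) \in @inv_pred X).

Lemma invB_inv X (a : invB X) : @homB_inv K H B X X (invB_val a).
Proof. by have /asboolP := invB_valP a. Qed.

Section OnInvariants.
Variables (X : fdMod H) (n : nat) (f : chain H B n -> K).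

Definition phi (x : H) (s : seq (invB X)) : K :=
  Psi f (chain_pure n x (map (@invB_val X) s : seq (homB B X X))).

Lemma phiD x : is_cochain f -> multiadditive n (phi x).
Proof.
case=> fl _ s1 s2 sz a b; rewrite /phi !map_cat /=.
by rewrite (linD (mlin_Psi (X := X) fl x _)) ?size_map.
Qed.

Lemma inv_nth m (s : seq (invB X)) : size s = m.+1 ->
  forall i, (i <= m)%N ->
  homB_inv (map (@invB_val X) s : seq (homB B X X))`_i.
Proof.
move=> sz i im; rewrite (nth_map 0) ?sz ?ltnS//.
exact: invB_inv.
Qed.

Lemma phi_RH (s : seq (invB X)) : is_cochain f -> size s = n.+1 ->
  (fun x => phi x s) \in @RH_pred K H.
Proof.
move=> fc sz; have [fl _] := fc; apply/asboolP; split.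
  by apply: (lin_Psi fl); rewrite size_map.
move=> w y; rewrite /phi !Psi_tau ?size_map//.
by apply: tau_adj => //; apply: mu_inv (inv_nth sz); rewrite size_map.
Qed.

Lemma phi_cyc x a (s : seq (invB X)) :
  lin (f : chain H B n -> K^o) -> size s = n ->
  Psi (cyc f) (chain_pure n x (map (@invB_val X) (rcons s a) : seq (homB B X X)))
  = phi x (a :: s).
Proof.
move=> fl sz; rewrite map_rcons Psi_cyc ?size_map//.
have sz' : size (map (@invB_val X) s) = n by rewrite size_map.
have pl : lin (fun x => phi x (a :: s) : K^o).
  by apply: (lin_Psi fl); rewrite /= size_map sz.
rewrite -(sweedler_counitr _ pl); apply: eq_sweedler => x0 x1.
have al := mlin_head (mlin_Psi (X := X) fl x0) sz'.
by rewrite invB_inv (linZ al).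
Qed.

End OnInvariants.

Lemma tau_sum X n (I : Type) (r : seq I) (F : I -> chain H B n -> K) x z :
  tau (X := X) (\sum_(i <- r) F i) x z = \sum_(i <- r) tau (F i) x z.
Proof.
elim: r => [|i r IH].
  rewrite !big_nil /tau /tlift big1// => p _; rewrite /sweedler2 /tlift big1//.
  by move=> q _; rewrite mul0r.
rewrite !big_cons -IH /tau /tlift -big_split /=; apply: eq_bigr => p _.
rewrite -big_split /=; apply: eq_bigr => q _.
by rewrite -mulrDl.
Qed.

Lemma tauZ X n c (f : chain H B n -> K) x z :
  tau (X := X) (fun y => c * f y) x z = c * tau f x z.
Proof.
rewrite /tau /tlift [RHS]mulr_sumr; apply: eq_bigr => p _.
rewrite [RHS]mulr_sumr; apply: eq_bigr => q _.
by rewrite mulrA.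
Qed.

Lemma map_contract V V' (g : V -> V') m m' x0 y0 i s : (i.+1 < size s)%N ->
  (forall a b, g (m a b) = m' (g a) (g b)) ->
  map g (contract m x0 i s) = contract m' y0 i (map g s).
Proof.
move=> ilt gm; rewrite /contract map_cat map_take /= -map_drop gm.
by rewrite !(nth_map x0)// (ltnW ilt).
Qed.

(** Connects the recursion used at ring level with the indexed faces of [hochb]; m + 1 entries have
    m contractions. *)
Lemma bar_sum (A : pzRingType) (F : seq A -> K) pre s m : size s = m.+1 ->
  bar F pre s = \sum_(i < m) (-1) ^+ i * F (pre ++ contract *%R 0 i s).
Proof.
elim: m s pre => [|m IH] [|a [|b s]]// pre sz; first by rewrite big_ord0.
case: sz => sz.
rewrite big_ord_recl /= mul1r; congr (_ + _); first by rewrite /contract /= drop0.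
rewrite -[LHS]/(- bar F (rcons pre a) (b :: s)) IH /= ?sz// -sumrN.
apply: eq_bigr => i _; rewrite exprS mulN1r mulNr cat_rcons.
by [].
Qed.

Lemma lin_face n i (f : chain H B n -> K) : lin (f : chain H B n -> K^o) ->
  lin (face i f : chain H B n.+1 -> K^o).
Proof.
move=> fl; rewrite /face; case: ifP => [im|_]; first by case: (face_mulP fl im).
by have [gl _] := face_mulP fl (leq0n n); case: (cycP gl).
Qed.

Lemma phi_face_mul X n i (f : chain H B n -> K) x (s : seq (invB X)) :
  lin (f : chain H B n -> K^o) -> (i <= n)%N -> size s = n.+2 ->
  phi (face_mul i f) x s = phi f x (contract *%R 0 i s).
Proof.
move=> fl im sz; rewrite /phi Psi_face ?size_map//; congr (Psi f (chain_pure n x _)).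
by rewrite (map_contract (m' := @homB_mul K H B X X X) _ (0 : homB B X X))// sz ltnS.
Qed.

(** The faces up to n give [bar]. The last face is the rotation of face 0; on invariants the
    rotation is untwisted, so this face is the wrap-around term of [hoch]. *)
Lemma phi_hochb X n (f : chain H B n -> K) x a s b :
  lin (f : chain H B n -> K^o) -> size s = n ->
  phi (hochb f) x (a :: rcons s b : seq (invB X)) =
  hoch n (phi (X := X) f x) a s b.
Proof.
move=> fl sz; have szr : size (a :: rcons s b) = n.+2 by rewrite /= size_rcons sz.
have hl : lin (hochb f : chain H B n.+1 -> K^o).
  rewrite /hochb; apply: (eq_lin (f := fun z =>
    \sum_(i < n.+2) (-1) ^+ i * face i f z : K^o)) => [z|].
    by rewrite fct_sumE.
  by apply: lin_sumf => i; apply: lin_mulKr; apply: lin_face.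
rewrite {1}/phi Psi_tau ?size_map//; set z := mu _ _.
rewrite /hochb tau_sum big_ord_recr /=.
rewrite /hoch (bar_sum _ _ (m := n.+1))//; congr (_ + _).
  apply: eq_bigr => i _; rewrite tauZ /z -Psi_tau ?size_map//; last exact: lin_face.
  congr (_ * _); have im : (i <= n)%N by rewrite -ltnS.
  by rewrite /face im [LHS]phi_face_mul.
rewrite tauZ /z -Psi_tau ?size_map//; last exact: lin_face.
rewrite /face ltnn; congr (_ * _).
have [gl _] := face_mulP fl (leq0n n).
rewrite -[map _ _]/(map (@invB_val X) (rcons (a :: s) b)).
rewrite phi_cyc//=; last by rewrite sz.
by rewrite phi_face_mul//= ?sz// /contract /= drop0.
Qed.

Lemma phi_cyclic X n (f : chain H B n -> K) x : is_cyclic_cochain f ->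
  cyclic n (phi (X := X) f x).
Proof.
move=> [[fl _] fc] a s sz; have [cl _] := cycP fl.
rewrite -{1}fc /cyclam /phi Psi_tau; last by rewrite size_map size_rcons sz.
  rewrite tauZ -Psi_tau//; last by rewrite size_map size_rcons sz.
  by rewrite phi_cyc.
by apply: lin_mulKr.
Qed.

Lemma phi0 X n x (s : seq (invB X)) : size s = n.+1 ->
  phi (0 : chain H B n -> K) x s = 0.
Proof.
move=> sz; rewrite /phi Psi_tau ?size_map//; last first.
  by move=> k u v; rewrite scaler0 addr0.
have := tau_sum (X := X) [::] (fun _ : nat => 0 : chain H B n -> K) x
  (mu n (map (@invB_val X) s)).
by rewrite !big_nil.
Qed.

Lemma phi_closed X n (f : chain H B n -> K) x : is_cyclic_cocycle f ->
  hclosed n (phi (X := X) f x).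
Proof.
move=> [[[fl _] _] bf] a s b sz; rewrite -phi_hochb// bf phi0//.
by rewrite /= size_rcons sz.
Qed.

Lemma phiB X n (f g : chain H B n -> K) x (s : seq (invB X)) :
  is_cochain f -> is_cochain g -> size s = n.+1 ->
  phi (f - g) x s = phi f x s - phi g x s.
Proof.
move=> [fl _] [gl _] sz.
have hl : lin (f - g : chain H B n -> K^o).
  move=> k u v; rewrite -[LHS]/(f _ - g _) fl gl opprD addrACA.
  by congr (_ + _); rewrite -[RHS]/(k * (f u - g u)) mulrBr.
rewrite /phi !Psi_tau ?size_map//.
rewrite /tau /tlift -sumrB; apply: eq_bigr => p _.
rewrite -sumrB; apply: eq_bigr => q _; rewrite /= -mulrBl.
by [].
Qed.

End Invariants.

(** * Block matrices over a direct sum of modules *)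

Section DirectSums.
Variables (K : fieldType) (H : hopfAlg K) (B : modAlg H).
Variables (X1 X2 : fdMod H).
Local Notation D := (dsum X1 X2).
Local Notation in1 := (dsum_in1 X1 X2).
Local Notation in2 := (dsum_in2 X1 X2).
Local Notation pr1 := (dsum_pr1 X1 X2).
Local Notation pr2 := (dsum_pr2 X1 X2).

Lemma dsum_in1E v : in1 v = (v, 0) :> X1 * X2.
Proof.
by rewrite /dsum_in1 linfunE// => k u w; congr (_, _); rewrite /= ?scaler0 addr0.
Qed.

Lemma dsum_in2E v : in2 v = (0, v) :> X1 * X2.
Proof.
by rewrite /dsum_in2 linfunE// => k u w; congr (_, _); rewrite /= ?scaler0 addr0.
Qed.

Lemma dsum_pr1E (v : X1 * X2) : pr1 v = v.1.
Proof. by rewrite /dsum_pr1 linfunE. Qed.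

Lemma dsum_pr2E (v : X1 * X2) : pr2 v = v.2.
Proof. by rewrite /dsum_pr2 linfunE. Qed.

Lemma dsum_pr1_in1 : (pr1 \o in1)%VF = \1%VF.
Proof. by apply/lfunP => v; rewrite comp_lfunE dsum_in1E dsum_pr1E id_lfunE. Qed.

Lemma dsum_pr2_in2 : (pr2 \o in2)%VF = \1%VF.
Proof. by apply/lfunP => v; rewrite comp_lfunE dsum_in2E dsum_pr2E id_lfunE. Qed.

Lemma dsum_pr1_in2 : (pr1 \o in2)%VF = 0.
Proof. by apply/lfunP => v; rewrite comp_lfunE dsum_in2E dsum_pr1E zero_lfunE. Qed.

Lemma dsum_pr2_in1 : (pr2 \o in1)%VF = 0.
Proof. by apply/lfunP => v; rewrite comp_lfunE dsum_in1E dsum_pr2E zero_lfunE. Qed.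

Lemma dsum_in_pr : (in1 \o pr1)%VF + (in2 \o pr2)%VF = \1%VF.
Proof.
apply/lfunP => -[v w]; rewrite add_lfunE !comp_lfunE dsum_in1E dsum_in2E id_lfunE.
by rewrite dsum_pr1E dsum_pr2E; congr (_, _); rewrite /= ?addr0 ?add0r.
Qed.

Lemma act0 (X : fdMod H) x : fdmod_act X 0 x = 0.
Proof. by have [bl _] := bilin_fdmod_act X; exact: (lin0 (bl x)). Qed.

Lemma equivariant_in1 : equivariant in1.
Proof.
move=> x; apply/lfunP => v; rewrite !comp_lfunE !rmod_repE !dsum_in1E.
by congr (_, _); rewrite /= act0.
Qed.

Lemma equivariant_in2 : equivariant in2.
Proof.
move=> x; apply/lfunP => v; rewrite !comp_lfunE !rmod_repE !dsum_in2E.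
by congr (_, _); rewrite /= act0.
Qed.

Lemma equivariant_pr1 : equivariant pr1.
Proof. by move=> x; apply/lfunP => v; rewrite !comp_lfunE !rmod_repE !dsum_pr1E. Qed.

Lemma equivariant_pr2 : equivariant pr2.
Proof. by move=> x; apply/lfunP => v; rewrite !comp_lfunE !rmod_repE !dsum_pr2E. Qed.

(** Equivariance moves A to the left of pi(S^-1(x_1)), and the trace property then brings A' next to
    A, where they cancel. Hence a diagonal block contributes its own trace. *)
Lemma tau_conj n (f : chain H B n -> K) (X Y : fdMod H) (A : 'Hom(X, Y))
    (A' : 'Hom(Y, X)) x z : lin (f : chain H B n -> K^o) ->
  equivariant A -> (A' \o A)%VF = \1%VF ->
  tau f x (hom_conj A A' z) = tau f x z.
Proof.
move=> fl Ae A'A; have tX := bilin_tau X fl; have tY := bilin_tau Y fl.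
have cl := lin_hom_conj (W := tpow B n) A A'.
move: z; apply: lin_tens_ext => [||T w]; [by lin_tac|by lin_tac|].
rewrite hom_conj_tens !tau_tens//; apply: eq_sweedler => x0 x1.
congr (_ * _); rewrite !comp_lfunA -Ae [LHS]lfun_trC !comp_lfunA A'A comp_lfun1l.
by [].
Qed.

Lemma mu_diag n (ps : seq (homB B X1 X1 * homB B X2 X2)) : size ps = n.+1 ->
  mu n [seq homB_diag p.1 p.2 | p <- ps] =
  hom_conj in1 pr1 (mu n [seq p.1 | p <- ps]) +
  hom_conj in2 pr2 (mu n [seq p.2 | p <- ps]).
Proof.
elim: n ps => [|n IH] [//|p ps] [sz]; first by case: ps sz.
rewrite /= IH// /homB_diag.
set b := @tens _ _ _; have mb : bilin b := @tens_bilin _ B (tpow B n).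
have [hl hr] := bilin_hom_mul D D D mb.
rewrite [LHS](linD (hl _)) !(linD (hr _)).
rewrite [hom_mul b (homB_conj in1 _ _) (hom_conj in1 _ _)]
  (hom_conj_mul _ _ _ _ mb dsum_pr1_in1).
rewrite [hom_mul b (homB_conj in2 _ _) (hom_conj in2 _ _)]
  (hom_conj_mul _ _ _ _ mb dsum_pr2_in2).
rewrite [hom_mul b (homB_conj in1 _ _) (hom_conj in2 _ _)]
  (hom_conj_mul0 _ _ _ _ mb dsum_pr1_in2).
rewrite [hom_mul b (homB_conj in2 _ _) (hom_conj in1 _ _)]
  (hom_conj_mul0 _ _ _ _ mb dsum_pr2_in1).
by rewrite addr0 add0r.
Qed.

Let mb := @umul_bilin K B.

Lemma conj_inv (X X' Y Y' : fdMod H) (A : 'Hom(X', Y')) (A' : 'Hom(Y, X))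
    (t : homB B X X') : equivariant A -> equivariant A' -> homB_inv t ->
  homB_inv (homB_conj A A' t).
Proof. by move=> Ae A'e; apply: hom_conj_inv (bilin_modalg_act B) Ae A'e. Qed.

Lemma homB_invD (X Y : fdMod H) (s t : homB B X Y) :
  homB_inv s -> homB_inv t -> homB_inv (s + t).
Proof.
move=> si ti; rewrite -[t]opprK -[- t]sub0r; apply: homB_invB => //.
by apply: homB_invB => //; apply: homB_inv0.
Qed.

Lemma homB_diag_inv s1 s2 : homB_inv s1 -> homB_inv s2 ->
  homB_inv (@homB_diag K H B X1 X2 s1 s2).
Proof.
move=> i1 i2; apply: homB_invD; apply: conj_inv => //.
- exact: equivariant_in1.
- exact: equivariant_pr1.
- exact: equivariant_in2.
- exact: equivariant_pr2.
Qed.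

Definition diag (a : invB B X1) (b : invB B X2) : invB B D :=
  mkinv (homB_diag_inv (invB_inv a) (invB_inv b)).

(** With [down], the strictly triangular blocks: these are the square-zero elements fed to the
    ring-level results. *)
Definition up (t : homB B X2 X1) (ti : homB_inv t) : invB B D :=
  mkinv (conj_inv equivariant_in1 equivariant_pr2 ti).

Definition down (t : homB B X1 X2) (ti : homB_inv t) : invB B D :=
  mkinv (conj_inv equivariant_in2 equivariant_pr1 ti).

Lemma phi_diag n (f : chain H B n -> K) x (ps : seq (invB B X1 * invB B X2)) :
  lin (f : chain H B n -> K^o) -> size ps = n.+1 ->
  phi f x [seq diag p.1 p.2 | p <- ps] =
  phi f x [seq p.1 | p <- ps] + phi f x [seq p.2 | p <- ps].
Proof.
move=> fl sz; rewrite /phi !Psi_tau ?size_map//.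
pose qs : seq (homB B X1 X1 * homB B X2 X2) :=
  [seq (invB_val p.1 : homB B X1 X1, invB_val p.2 : homB B X2 X2) | p <- ps].
have -> : map (@invB_val K H B D) [seq diag p.1 p.2 | p <- ps] =
  [seq homB_diag q.1 q.2 | q <- qs] by rewrite -!map_comp.
rewrite mu_diag ?size_map//.
have [_ tr] := bilin_tau D fl; rewrite (linD (tr x)).
rewrite (tau_conj _ _ fl equivariant_in1 dsum_pr1_in1).
rewrite (tau_conj _ _ fl equivariant_in2 dsum_pr2_in2).
by rewrite /qs -!map_comp.
Qed.

Lemma invB_eq (X : fdMod H) (a b : invB B X) :
  (invB_val a : homB B X X) = invB_val b -> a = b.
Proof. exact: val_inj. Qed.

Lemma diagM a b a' b' : diag a b * diag a' b' = diag (a * a') (b * b').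
Proof.
apply: invB_eq.
rewrite -[LHS]/(homB_mul (homB_diag (invB_val a) (invB_val b))
  (homB_diag (invB_val a') (invB_val b'))).
rewrite /homB_diag; have [hl hr] := bilin_homB_mul B D D D.
rewrite [LHS](linD (hl _)) !(linD (hr _)).
rewrite [homB_mul (homB_conj in1 _ _) (homB_conj in1 _ _)]
  (hom_conj_mul _ _ _ _ mb dsum_pr1_in1).
rewrite [homB_mul (homB_conj in2 _ _) (homB_conj in2 _ _)]
  (hom_conj_mul _ _ _ _ mb dsum_pr2_in2).
rewrite [homB_mul (homB_conj in1 _ _) (homB_conj in2 _ _)]
  (hom_conj_mul0 _ _ _ _ mb dsum_pr1_in2).
rewrite [homB_mul (homB_conj in2 _ _) (homB_conj in1 _ _)]
  (hom_conj_mul0 _ _ _ _ mb dsum_pr2_in1).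
by rewrite addr0 add0r.
Qed.

Lemma diagB a b a' b' : diag a b - diag a' b' = diag (a - a') (b - b').
Proof.
have cB (X Y X' Y' : fdMod H) (A : 'Hom(X, Y)) (A' : 'Hom(X', Y')) s t :
    homB_conj A A' (s - t) = homB_conj A A' s - homB_conj A A' t :> homB B _ _.
  have cl := lin_hom_conj (W := B) A A'.
  by rewrite -scaleN1r [LHS](linD cl) (linZ cl) scaleN1r.
apply: invB_eq.
rewrite -[LHS]/(homB_diag (invB_val a) (invB_val b) -
  homB_diag (invB_val a') (invB_val b')).
by rewrite /= /homB_diag [in RHS]cB [in RHS]cB opprD addrACA.
Qed.

Lemma diag1 : diag 1 1 = 1.
Proof.
apply: invB_eq.
rewrite -[LHS]/(hom_conj in1 pr1 (\1%VF \ox (uone : B)) +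
  hom_conj in2 pr2 (\1%VF \ox (uone : B))).
rewrite -[RHS]/((\1%VF : 'End(D)) \ox (uone : B)) -dsum_in_pr.
rewrite !hom_conj_tens !comp_lfun1r.
by have [tl _] := @tens_bilin K 'Hom(D, D) B; rewrite (linD (tl _)).
Qed.

Lemma up_up s t (si : homB_inv s) (ti : homB_inv t) : up si * up ti = 0.
Proof. by apply: invB_eq; apply: (hom_conj_mul0 _ _ _ _ mb dsum_pr2_in1). Qed.

Lemma down_down s t (si : homB_inv s) (ti : homB_inv t) : down si * down ti = 0.
Proof. by apply: invB_eq; apply: (hom_conj_mul0 _ _ _ _ mb dsum_pr1_in2). Qed.

Lemma up_down s t (si : homB_inv s) (ti : homB_inv t) (a : invB B X1) :
  homB_mul s t = invB_val a -> up si * down ti = diag a 0.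
Proof.
move=> st; apply: invB_eq; rewrite /= /homB_diag.
rewrite [homB_conj in2 _ 0](lin0 (lin_hom_conj (W := B) in2 pr2)) addr0 -st.
exact: (hom_conj_mul in1 pr1 s t mb dsum_pr2_in2).
Qed.

Lemma down_up s t (si : homB_inv s) (ti : homB_inv t) (b : invB B X2) :
  homB_mul s t = invB_val b -> down si * up ti = diag 0 b.
Proof.
move=> st; apply: invB_eq; rewrite /= /homB_diag.
rewrite [homB_conj in1 _ 0](lin0 (lin_hom_conj (W := B) in1 pr1)) add0r -st.
exact: (hom_conj_mul in2 pr2 s t mb dsum_pr1_in1).
Qed.

Lemma diag_up a b t (ti : homB_inv t) :
  diag a b * up ti = up (homB_mul_inv (invB_inv a) ti).
Proof.
apply: invB_eq.
rewrite -[LHS]/(homB_mul (homB_diag (invB_val a) (invB_val b))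
  (homB_conj in1 pr2 t)).
rewrite /homB_diag; have [hl hr] := bilin_homB_mul B D D D.
rewrite [LHS](linD (hl _)).
rewrite [homB_mul (homB_conj in1 _ _) (homB_conj in1 _ _)]
  (hom_conj_mul _ _ _ _ mb dsum_pr1_in1).
rewrite [homB_mul (homB_conj in2 _ _) (homB_conj in1 _ _)]
  (hom_conj_mul0 _ _ _ _ mb dsum_pr2_in1).
by rewrite addr0.
Qed.

Lemma down_diag a b t (ti : homB_inv t) :
  down ti * diag a b = down (homB_mul_inv ti (invB_inv a)).
Proof.
apply: invB_eq.
rewrite -[LHS]/(homB_mul (homB_conj in2 pr1 t)
  (homB_diag (invB_val a) (invB_val b))).
rewrite /homB_diag; have [hl hr] := bilin_homB_mul B D D D.
rewrite [LHS](linD (hr _)).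
rewrite [homB_mul (homB_conj in2 _ _) (homB_conj in1 _ _)]
  (hom_conj_mul _ _ _ _ mb dsum_pr1_in1).
rewrite [homB_mul (homB_conj in2 _ _) (homB_conj in2 _ _)]
  (hom_conj_mul0 _ _ _ _ mb dsum_pr1_in2).
by rewrite addr0.
Qed.

End DirectSums.

(** * Invariant elements as equivariant B-linear maps *)

Section Isomorphisms.
Variables (K : fieldType) (H : hopfAlg K) (B : modAlg H).
Implicit Types X Y Z : fdMod H.

Lemma bilin_lfun_app (U V : vectType K) :
  bilin (fun (T : 'Hom(U, V)) (v : U) => T v).
Proof. by lin_tac. Qed.

Lemma bilin_homB_app X Y : bilin (@homB_app K H B X Y).
Proof. exact: tmap2_bilin (bilin_lfun_app _ _) (@umul_bilin K B). Qed.

Lemma homB_app_tens X Y (T : 'Hom(X, Y)) (b : B) (v : X) (c : B) :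
  homB_app (T \ox b : homB B X Y) (v \ox c) = T v \ox umul b c.
Proof. exact: tmap2_tens (bilin_lfun_app _ _) (@umul_bilin K B). Qed.

Lemma homB_app_mul X Y Z (s : homB B Y Z) (t : homB B X Y) z :
  homB_app (homB_mul s t) z = homB_app s (homB_app t z).
Proof.
have b1 := bilin_homB_mul B X Y Z; have b2 := bilin_homB_app X Y.
have b3 := bilin_homB_app Y Z; have b4 := bilin_homB_app X Z.
move: s; apply: lin_tens_ext => [||S a]; [by lin_tac|by lin_tac|].
move: t; apply: lin_tens_ext => [||T b]; [by lin_tac|by lin_tac|].
move: z; apply: lin_tens_ext => [||v c]; [by lin_tac|by lin_tac|].
by rewrite homB_mul_tens !homB_app_tens comp_lfunE umulA.
Qed.

Lemma homB_app1 X (z : tensor X B) : homB_app (homB1 B X) z = z.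
Proof.
have b2 := bilin_homB_app X X.
move: z; apply: lin_tens_ext => [||v c]; [by lin_tac|by lin_tac|].
by rewrite homB_app_tens id_lfunE umul1l.
Qed.

(** The operator e_i^* (x) w for the dual basis; summing over i with w the image of e_i rebuilds any
    operator. *)
Definition rank1 (U V : vectType K) (i : 'I_(\dim {:U})) (w : V) : 'Hom(U, V) :=
  linfun (fun u => coord (vbasis {:U}) i u *: w).

Lemma rank1E (U V : vectType K) i (w : V) (u : U) :
  rank1 i w u = coord (vbasis {:U}) i u *: w.
Proof.
rewrite /rank1 linfunE// => k x y.
by rewrite linearP scalerDl scalerA.
Qed.

Lemma lin_rank1 (U V : vectType K) i : lin (@rank1 U V i).
Proof.
move=> k x y; apply/lfunP => u; rewrite add_lfunE scale_lfunE !rank1E.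
by rewrite scalerDr !scalerA mulrC.
Qed.

Lemma lfun_rank1 (U V : vectType K) (T : 'Hom(U, V)) :
  T = \sum_(i < \dim {:U}) rank1 i (T (vbasis {:U})`_i).
Proof.
apply/lfunP => u; rewrite sum_lfunE {1}(coord_vbasis (memvf u)) linear_sum.
by apply: eq_bigr => i _; rewrite rank1E linearZ.
Qed.

(* A B-linear map is determined by its values on e_i (x) 1, for a basis (e_i)
   of X; see [homB_ofK]. *)
Definition homB_of X Y (F : tensor X B -> tensor Y B) : homB B X Y :=
  \sum_(i < \dim {:X})
    tlift (fun v b => rank1 i v \ox b) (F ((vbasis {:X})`_i \ox uone)).

Lemma bilin_rank1_tens X Y (i : 'I_(\dim {:X})) :
  bilin (fun (v : Y) (b : B) => rank1 (U := X) i v \ox b).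
Proof. by have rl := @lin_rank1 X Y i; lin_tac. Qed.

Lemma homB_appK X Y (s : homB B X Y) : homB_of (homB_app s) = s.
Proof.
have b2 := bilin_homB_app X Y; rewrite /homB_of.
have rb i := @bilin_rank1_tens X Y i.
move: s; apply: lin_tens_ext => [||T b]; last first.
- transitivity (\sum_(i < \dim {:X}) rank1 i (T (vbasis {:X})`_i) \ox b).
    apply: eq_bigr => i _; rewrite homB_app_tens umul1r.
    exact: tlift_tens (rb i).
  have [tl _] := @tens_bilin K 'Hom(X, Y) B.
  by rewrite -(lin_sum (tl b)) -lfun_rank1.
- exact: lin_id.
apply: lin_sumf => i; have ri := rb i.
exact: (lin_tlift (t := fun s => homB_app s _) ri (b2.1 _)).
Qed.

Lemma homB_app_inj X Y (s t : homB B X Y) :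
  (forall z, homB_app s z = homB_app t z) -> s = t.
Proof. by move=> /funext st; rewrite -(homB_appK s) st homB_appK. Qed.

Definition rmulB X (z : tensor X B) (b : B) : tensor X B :=
  tlift (fun v c => v \ox umul c b) z.

Lemma homB_ofK X Y (F : tensor X B -> tensor Y B) : lin F ->
  (forall z b, F (rmulB z b) = rmulB (F z) b) ->
  forall z, homB_app (homB_of F) z = F z.
Proof.
move=> Fl FB; have b2 := bilin_homB_app X Y.
apply: lin_tens_ext => [||v c]; [by lin_tac|by lin_tac|].
have al : lin (fun s => homB_app s (v \ox c)) := b2.1 _.
rewrite /homB_of (lin_sum al) {2}(coord_vbasis (memvf v)).
have tl : lin (fun v : X => F (v \ox c)) by lin_tac.
rewrite (lin_sum tl); apply: eq_bigr => i _; rewrite (linZ tl).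
have -> : (vbasis {:X})`_i \ox c = rmulB ((vbasis {:X})`_i \ox (uone : B)) c.
  by rewrite /rmulB tlift_tens ?umul1l//; lin_tac.
rewrite FB; move: (F _) => y; have rb := @bilin_rank1_tens X Y i.
have rl : bilin (fun (w : Y) (b : B) => w \ox umul b c) by lin_tac.
rewrite /rmulB; move: y; apply: lin_tens_ext => [||w b].
- have tl' : lin (tlift (fun (v : Y) (b : B) => rank1 i v \ox b)) by lin_tac.
  exact: (lin_comp al tl').
- by lin_tac.
rewrite !tlift_tens// homB_app_tens rank1E.
have [sl _] := @tens_bilin K Y B.
by rewrite (linZ (sl _)).
Qed.

Local Notation act X := (@tensor_act K H X B (fdmod_act X) (@modalg_act K H B)).

Lemma bilin_act X : bilin (act X).
Proof. by rewrite /tensor_act; lin_tac. Qed.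

Lemma act_tens X (v : X) (b : B) x :
  act X (v \ox b) x =
  sweedler2 (fun x0 x1 => fdmod_act X v x0 \ox modalg_act b x1) x.
Proof. by rewrite /tensor_act tlift_tens//; lin_tac. Qed.

Lemma actM X z x y : act X z (x * y) = act X (act X z x) y.
Proof.
have ab := bilin_act X; have a1 : lin (fun z => act X z y) := ab.1 y.
move: z; apply: lin_tens_ext => [||v b]; [by lin_tac|by lin_tac|].
rewrite !act_tens (sweedler_lin _ _ a1) sweedlerM; last by lin_tac.
apply: eq_sweedler => x0 x1; rewrite act_tens; apply: eq_sweedler => y0 y1.
case: (fdmod_rmod X) => _ _ ->.
by case: (modalg_rmod B) => _ _ ->.
Qed.

Lemma act1 X z : act X z 1 = z.
Proof.
have ab := bilin_act X; have a1 : lin (fun z => act X z 1) := ab.1 1.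
move: z; apply: lin_tens_ext => [||v b]; [by lin_tac|by lin_tac|].
rewrite act_tens sweedler1; last by lin_tac.
case: (fdmod_rmod X) => _ -> _.
by case: (modalg_rmod B) => _ -> _.
Qed.

Lemma homB_app_act X Y (s : homB B X Y) z x :
  act Y (homB_app s z) x =
  sweedler2 (fun x0 x1 => homB_app (homB_act s x0) (act X z x1)) x.
Proof.
have aX := bilin_act X; have aY := bilin_act Y.
have pb := bilin_homB_app X Y; have hb := bilin_hom_act X Y (bilin_modalg_act B).
have ay : lin (fun z => act Y z x) := aY.1 x.
have hb' : bilin (@homB_act K H B X Y) := hb.
move: s; apply: lin_tens_ext => [||T b]; [by lin_tac|by lin_tac|].
move: z; apply: lin_tens_ext => [||v c]; [by lin_tac|by lin_tac|].
rewrite homB_app_tens act_tens.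
transitivity (sweedler2 (fun q r => sweedler2 (fun q0 q1 => sweedler2 (fun a z =>
    sweedler2 (fun a0 a1 =>
    rmod_rep Y a0 (T (rmod_rep X (a * antipodeV q1) v)) \ox
      umul (modalg_act b a1) (modalg_act c z)) q0) r) q) x).
  rewrite (sweedler_contract (Z' := fun q0 z => sweedler2 (fun a0 a1 =>
    rmod_rep Y a0 (T v) \ox umul (modalg_act b a1) (modalg_act c z)) q0));
    [|by move=> *; lin_tac|by move=> *; lin_tac|by lin_tac|]; last first.
    move=> q0 u z; rewrite (sweedler_antipodeVr (f := fun r => sweedler2
      (fun a0 a1 => rmod_rep Y a0 (T (rmod_rep X r v)) \ox
      umul (modalg_act b a1) (modalg_act c z)) q0)); last by lin_tac.
    congr (_ *: _); apply: eq_sweedler => a0 a1.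
    by rewrite rmod_rep1 id_lfunE.
  rewrite (sweedler_coassoc (F := fun a0 a1 z => rmod_rep Y a0 (T v) \ox
      umul (modalg_act b a1) (modalg_act c z))); last by lin_tac.
  apply: eq_sweedler => a0 y; rewrite modalg_actM rmod_repE.
  by rewrite (sweedler_lin _ _ (f := fun r => _ \ox r))//; lin_tac.
apply: eq_sweedler => q r.
rewrite [homB_act _ _](hom_act_tens _ _ _ (bilin_modalg_act B)) act_tens.
rewrite /sweedler3 -(sweedler_coassoc (F := fun a0 a1 a2 => (rmod_rep Y a0 \o T \o
  rmod_rep X (antipodeV a2))%VF \ox modalg_act b a1)); last by lin_tac.
have pl z : lin (fun s => homB_app s z) := pb.1 z.
have pr s : lin (homB_app s) := pb.2 s.
rewrite (sweedler_lin _ _ (pl _)); apply: eq_sweedler => q0 q1.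
rewrite (sweedler_lin _ _ (pl _)) sweedler_exchange; apply: eq_sweedler => a0 a1.
rewrite (sweedler_lin _ _ (pr _)); apply: eq_sweedler => a z.
rewrite homB_app_tens !comp_lfunE rmod_repM comp_lfunE.
by rewrite (rmod_repE a).
Qed.

(** Inserting S^-1(x_2) x_1 before z gives (s <| x) z = (s (z <| S^-1(x_1))) <| x_0. Equivariance
    moves the action of x_0 inside, where S^-1(x_1) x_0 is a counit. *)
Lemma homB_inv_app X Y (s : homB B X Y) :
  (forall z x, homB_app s (act X z x) = act Y (homB_app s z) x) -> homB_inv s.
Proof.
move=> se x; apply: homB_app_inj => z.
have aX := bilin_act X; have aY := bilin_act Y.
have pb := bilin_homB_app X Y; have hb := bilin_hom_act X Y (bilin_modalg_act B).
have hb' : bilin (@homB_act K H B X Y) := hb.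
have pl z : lin (fun s => homB_app s z) := pb.1 z.
have pr s : lin (homB_app s) := pb.2 s.
have Fl : lin (fun x => homB_app (homB_act s x) z).
  exact: (lin_comp (pl z) (hb'.2 s)).
rewrite -[LHS](sweedler_counitr x Fl).
transitivity (sweedler2 (fun x0 x' => sweedler2 (fun x1 x2 =>
    homB_app (homB_act s x0) (act X z (antipodeV x2 * x1))) x') x).
  apply: eq_sweedler => x0 x'.
  rewrite (sweedler_antipodeVl (f := fun r => homB_app (homB_act s x0) (act X z r)));
    last exact: (lin_comp (pr _) (aX.2 z)).
  by rewrite act1.
rewrite -(sweedler_coassoc (F := fun x0 x1 x2 =>
    homB_app (homB_act s x0) (act X z (antipodeV x2 * x1)))); last first.
  split=> a b.
  - exact: (lin_comp (pl _) (hb'.2 s)).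
  - apply: (lin_comp (pr _)); apply: (lin_comp (aX.2 z)); lin_tac.
  - apply: (lin_comp (pr _)); apply: (lin_comp (aX.2 z)); lin_tac.
transitivity (sweedler2 (fun y x2 => homB_app s (act X z (antipodeV x2 * y))) x).
  apply: eq_sweedler => y x2; rewrite actM se homB_app_act.
  by apply: eq_sweedler => x0 x1; rewrite actM.
rewrite (sweedler_antipodeVl (f := fun r => homB_app s (act X z r)));
  last exact: (lin_comp (pr _) (aX.2 z)).
by rewrite act1 (linZ (pl z)).
Qed.

(** Since s is invariant and st = 1, t <| x = (t <| x_0)(s <| x_1) t = ((ts) <| x) t, and ts = 1 is
    invariant. *)
Lemma homB_inverse_inv X Y (s : homB B X Y) (t : homB B Y X) :
  homB_mul s t = homB1 B Y -> homB_mul t s = homB1 B X -> homB_inv s -> homB_inv t.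
Proof.
move=> st ts si x; have hb := bilin_hom_act Y X (bilin_modalg_act B).
have hb' : bilin (@homB_act K H B Y X) := hb.
have ml := bilin_homB_mul B Y X X; have mr := bilin_homB_mul B Y Y X.
transitivity (homB_mul (homB_act (homB_mul t s) x) t); last first.
  by rewrite ts homB1_inv (linZ (ml.1 _)) homB_mul1l.
rewrite [homB_act (homB_mul t s) x](hom_act_mul t s x (bilin_modalg_act B)
  (bilin_modalg_act B) (bilin_modalg_act B) (@umul_bilin K B) (@modalg_actM _ _ B)).
rewrite (sweedler_lin _ _ (ml.1 t)) -[LHS](sweedler_counitr x (hb'.2 t)).
have m2 := bilin_homB_mul B X Y X.
apply: eq_sweedler => x0 x1; rewrite [hom_act _ s _]si.
rewrite [hom_mul _ _ _](linZ (m2.2 _)) (linZ (ml.1 t)).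
by rewrite -homB_mulA st homB_mul1r.
Qed.

(** Turns a module isomorphism into mutually inverse invariant elements, so that isomorphic units
    become conjugate blocks of X (+) Y. *)
Lemma unit_isoP X Y (u : homB B X X) (u' : homB B Y Y) : unit_iso u u' ->
  exists (g : homB B X Y) (g' : homB B Y X), [/\ homB_inv g, homB_inv g',
    homB_mul g' g = homB1 B X, homB_mul g g' = homB1 B Y &
    homB_mul (homB_mul g u) g' = u'].
Proof.
case=> F [[Fl [G FK GK] FB Fe] Fu].
have Gl : lin G by move=> k x y; apply: (can_inj FK); rewrite [RHS]Fl !GK.
have GB z b : G (rmulB z b) = rmulB (G z) b.
  by apply: (can_inj FK); rewrite [RHS]FB !GK.
have gE := homB_ofK Fl FB; have g'E := homB_ofK Gl GB.
have g'g : homB_mul (homB_of G) (homB_of F) = homB1 B X.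
  by apply: homB_app_inj => z; rewrite homB_app_mul gE g'E FK homB_app1.
have gg' : homB_mul (homB_of F) (homB_of G) = homB1 B Y.
  by apply: homB_app_inj => z; rewrite homB_app_mul gE g'E GK homB_app1.
have gi : homB_inv (homB_of F) by apply: homB_inv_app => z x; rewrite !gE Fe.
exists (homB_of F), (homB_of G); split=> //; first exact: homB_inverse_inv gi.
by apply: homB_app_inj => z; rewrite !homB_app_mul g'E gE Fu GK.
Qed.

End Isomorphisms.

(** * The pairings *)

Section PresentedGroupLift.
Variables (G : Type) (rel : seq G -> seq G -> Prop) (Z : zmodType) (v : G -> Z).
Hypothesis vrel : forall s t, rel s t -> \sum_(g <- s) v g = \sum_(g <- t) v g.

Definition pres_sum (s : seq (bool * G)) : Z :=
  \sum_(p <- s) (if p.1 then - v p.2 else v p.2).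

Definition pres_lift (y : presgroup rel) : Z := pres_sum (presrepr y).

Lemma pres_liftE s : pres_lift (presclass rel s) = pres_sum s.
Proof.
suff cong s1 s2 : abcong (pres_base rel) s1 s2 -> pres_sum s1 = pres_sum s2.
  by apply/cong/presclassP/presclass_repr.
rewrite /pres_sum; elim=> {s s1 s2} [s t|//|//|s t u _ -> _ ->//||].
- case=> [{}s {}t /vrel st|b g]; first by rewrite !big_map.
  by rewrite !big_cons !big_nil /=; case: b; rewrite /= addr0 ?addNr ?subrr.
- by move=> s t s' t' _ e _ e'; rewrite !big_cat /= e e'.
- by move=> s t; rewrite !big_cat /= addrC.
Qed.

Lemma pres_liftD y y' : pres_lift (presadd y y') = pres_lift y + pres_lift y'.
Proof. by rewrite /presadd pres_liftE /pres_sum big_cat. Qed.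

Lemma pres_lift_gen g : pres_lift (presgen rel g) = v g.
Proof. by rewrite pres_liftE /pres_sum big_seq1. Qed.

End PresentedGroupLift.

Section Pairing.
Variables (K : fieldType) (H : hopfAlg K) (B : modAlg H).
Hypothesis char0 : [pchar K] =i pred0.
Implicit Types X Y : fdMod H.

Lemma cocycleE m (f : cocycle B m) : is_cyclic_cocycle f.
Proof. by case: f => f /= /asboolP. Qed.

Lemma cocycle_cochain m (f : cocycle B m) : is_cochain f.
Proof. by have [[]] := cocycleE f. Qed.

Lemma RH_ext (g g' : RH H) : (forall h, g h = g' h) -> g = g'.
Proof. by move=> gg'; apply: val_inj; apply/funext. Qed.

Lemma RH_add (g g' : RH H) h : (g + g') h = g h + g' h.
Proof. by []. Qed.

(** The pairings evaluate a class at its chosen representative, which differs from any given cocycle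
    of the class by a coboundary. *)
Lemma HC_repr m (V : Type) (v : cocycle B m -> V) (f : cocycle B m) :
  (forall f f' : cocycle B m, is_cyclic_coboundary (f - f' : cocycle B m) ->
     v f = v f') ->
  v (repr (HC_class f)) = v f.
Proof.
move=> vb; apply: vb.
have : repr (HC_class f) - f \in @coboundary_pred K H B m.
  by rewrite Quotient.idealrBE reprK.
by move=> /asboolP.
Qed.

Lemma HC_reprD m (x y : HC B m) : HC_class (repr x + repr y) = x + y.
Proof. by rewrite /HC_class raddfD /= !reprK. Qed.

Lemma diagD X1 X2 (a a' : invB B X1) (b b' : invB B X2) :
  diag a b + diag a' b' = diag (a + a') (b + b').
Proof.
have d0 : diag (0 : invB B X1) (0 : invB B X2) = 0.
  by have := diagB (0 : invB B X1) (0 : invB B X2) 0 0; rewrite !subrr => <-.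
rewrite -[diag a' b']opprK -[- diag a' b']sub0r -d0 diagB diagB.
by rewrite !sub0r !opprK.
Qed.

Lemma invB_mulE X (a b : invB B X) :
  (invB_val (a * b) : homB B X X) = homB_mul (invB_val a) (invB_val b).
Proof. by []. Qed.

Lemma inverses_uniq X (u v w : invB B X) : inverses u v -> inverses u w -> v = w.
Proof.
by move=> [_ vu] [uw _]; rewrite -[v]mulr1 -uw mulrA vu mul1r.
Qed.

Section Even.
Variable n : nat.

Definition idem_elt X (p : invIdem B X) : invB B X := mkinv (invIdem_inv p).

Lemma idem_eltE X (p : invIdem B X) : idem_elt p * idem_elt p = idem_elt p.
Proof. by apply: invB_eq; apply: invIdem_idem. Qed.

Definition val0 (f : cocycle B n.*2) (g : {X : fdMod H & invIdem B X}) : RH H :=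
  MkRH (phi_RH (cocycle_cochain f) (size_nseq n.*2.+1 (idem_elt (projT2 g)))).

Lemma pair0_diag X1 X2 (f : chain H B n.*2 -> K) x (a : invB B X1)
    (b : invB B X2) : is_cochain f ->
  pair0 n (phi f x) (diag a b) = pair0 n (phi f x) a + pair0 n (phi f x) b.
Proof.
move=> [fl _]; rewrite /pair0.
have := phi_diag x fl (size_nseq n.*2.+1 (a, b)).
by rewrite !map_nseq.
Qed.

Lemma pair0_0 X (f : chain H B n.*2 -> K) x : is_cochain f ->
  pair0 n (phi f x) (0 : invB B X) = 0.
Proof.
move=> fc; apply: (multiadd0 (phiD x fc) (s1 := [::])).
by rewrite size_nseq.
Qed.

Lemma val0_rel (f : cocycle B n.*2) s t : K0_rel s t ->
  \sum_(g <- s) val0 f g = \sum_(g <- t) val0 f g.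
Proof.
have fz := cocycleE f; have [fc _] := fz; have fo := cocycle_cochain f.
case=> [X X' p p' [g [g' [gi g'i gg' g'g]]]|X1 X2 p1 p2 p pE].
  rewrite !big_seq1; apply: RH_ext => x.
  rewrite -[LHS]/(pair0 n (phi f x) (idem_elt p)).
  rewrite -[RHS]/(pair0 n (phi f x) (idem_elt p')).
  (* As off-diagonal blocks, [g] and [g'] lie in one ring and have square zero, while their products
     are diag(p, 0) and diag(0, p'). *)
  have ud : up g'i * down gi = diag (idem_elt p) 0 by apply: up_down.
  have du : down gi * up g'i = diag 0 (idem_elt p') by apply: down_up.
  have := pair0_equiv char0 (phiD x fo) (phi_cyclic x fc) (phi_closed x fz)
    (down_down gi gi) (up_up g'i g'i).
  rewrite ud du !diagM !idem_eltE !mulr0 => /(_ erefl erefl).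
  by rewrite !pair0_diag// !pair0_0// addr0 add0r.
rewrite big_seq1 big_cons big_seq1; apply: RH_ext => x; rewrite RH_add.
rewrite -[LHS]/(pair0 n (phi f x) (idem_elt p)).
have -> : idem_elt p = diag (idem_elt p1) (idem_elt p2).
  by apply: invB_eq; rewrite /= -pE.
exact: pair0_diag.
Qed.

Lemma val0_coboundary (f f' : cocycle B n.*2) g :
  is_cyclic_coboundary (f - f' : cocycle B n.*2) -> val0 f g = val0 f' g.
Proof.
move=> fb; apply: RH_ext => x; apply/eqP; rewrite -subr_eq0.
case: g => X p; set e := idem_elt p.
have <- : phi (f - f' : chain H B n.*2 -> K) x (nseq n.*2.+1 e) =
    val0 f (existT _ X p) x - val0 f' (existT _ X p) x.
  rewrite phiB ?size_nseq//; exact: cocycle_cochain.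
have {fb} : is_cyclic_coboundary (f - f' : chain H B n.*2 -> K) by [].
move: (f - f' : chain H B n.*2 -> K) => F.
(* In degree 0 the only coboundary is 0. Otherwise the primitive has odd degree 2m + 1, as
   [pair0_coboundary] requires. *)
case: (n) F => [|m] F.
  by move=> ->; rewrite phi0 ?size_nseq.
move=> [h [hc ->]]; have [[hl _] _] := hc.
have -> : nseq m.+1.*2.+1 e = e :: rcons (nseq m.*2.+1 e) e.
  by rewrite rcons_nseq.
rewrite phi_hochb ?size_nseq//; apply/eqP.
by apply: pair0_coboundary => //; [apply: idem_eltE|apply: phi_cyclic].
Qed.

Lemma val0D (f f' : cocycle B n.*2) g : val0 (f + f') g = val0 f g + val0 f' g.
Proof.
apply/eqP; rewrite -subr_eq; apply/eqP; apply: RH_ext => x.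
have := phiB x (cocycle_cochain (f + f')) (cocycle_cochain f')
  (size_nseq n.*2.+1 (idem_elt (projT2 g))).
have -> : ((f + f' : cocycle B n.*2) : chain H B n.*2 -> K) -
    (f' : chain H B n.*2 -> K) = f.
  exact: (addrK (f' : chain H B n.*2 -> K)).
by move/esym.
Qed.

Lemma even_pairing : exists pairing : HC B n.*2 -> K0 B -> RH H,
  [/\ forall x x' y, pairing (x + x') y = pairing x y + pairing x' y,
      forall x y y', pairing x (presadd y y') = pairing x y + pairing x y' &
      forall (f : cocycle B n.*2) X (p : invIdem B X) (h : H),
        pairing (HC_class f) (K0_class p) h =
        Psi f (chain_pure n.*2 h (nseq n.*2.+1 (p : homB B X X)))].
Proof.
exists (fun x y => pres_lift (val0 (repr x)) y); split.
- move=> x x' y; rewrite /pres_lift /pres_sum -big_split; apply: eq_bigr => p _ /=.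
  (* Chosen representatives need not be additive: the one of a sum differs from the sum of the
     chosen ones by a coboundary, which does not change the value. *)
  have vE : val0 (repr (x + x')) p.2 = val0 (repr x) p.2 + val0 (repr x') p.2.
    rewrite -val0D -HC_reprD (HC_repr (v := val0 ^~ p.2))// => f f'.
    exact: val0_coboundary.
  by rewrite vE; case: p.1; rewrite ?opprD.
- by move=> x y y'; apply: pres_liftD; apply: val0_rel.
- move=> f X p h; rewrite pres_lift_gen; last exact: val0_rel.
  rewrite (HC_repr (v := val0 ^~ _)) => [|f1 f2]; last exact: val0_coboundary.
  by rewrite -[LHS]/(phi f h (nseq n.*2.+1 (idem_elt p))) /phi map_nseq.
Qed.

End Even.
Section Odd.
Variable n : nat.

Definition unit_elt X (u : invUnit B X) : invB B X := mkinv (invUnit_inv u).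

(** Only existence of an inverse in End(X) (x) B is recorded, so one is chosen; [homB_inverse_inv]
    places it in the subring of invariants. *)
Definition unit_inv X (u : invUnit B X) : invB B X :=
  let uv := svalP (cid (invUnit_unit u)) in
  mkinv (homB_inverse_inv uv.1 uv.2 (invUnit_inv u)).

Lemma unit_inverses X (u : invUnit B X) : inverses (unit_elt u) (unit_inv u).
Proof.
rewrite /unit_inv; case: cid => v /= [uv vu].
by split; apply: invB_eq.
Qed.

Lemma unit_invE X (u : invUnit B X) v : homB_inverse u v ->
  (invB_val (unit_inv u) : homB B X X) = v.
Proof.
case=> uv vu; have vi := homB_inverse_inv uv vu (invUnit_inv u).
rewrite -[RHS]/(invB_val (mkinv vi) : homB B X X); congr invB_val.
by apply: inverses_uniq (unit_inverses u) _; split; apply: invB_eq.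
Qed.

Lemma size_altS X (x y : invB B X) : size (alt x y n.+1) = n.*2.+2.
Proof. by rewrite size_alt. Qed.

Definition val1 (f : cocycle B n.*2.+1) (g : {X : fdMod H & invUnit B X}) : RH H :=
  MkRH (phi_RH (cocycle_cochain f)
    (size_altS (unit_elt (projT2 g) - 1) (unit_inv (projT2 g) - 1))).

Lemma pair1_diag X1 X2 (f : chain H B n.*2.+1 -> K) x (a a' : invB B X1)
    (b b' : invB B X2) : is_cochain f ->
  pair1 n (phi f x) (diag a b) (diag a' b') =
  pair1 n (phi f x) a a' + pair1 n (phi f x) b b'.
Proof.
move=> [fl _]; rewrite /pair1 -diag1 !diagB.
have := phi_diag (ps := flatten (nseq n.+1 [:: (a' - 1, b' - 1); (a - 1, b - 1)]))
  x fl.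
rewrite !map_flatten !map_nseq => -> //.
by rewrite size_flatten /shape map_nseq sumn_nseq mul2n.
Qed.

Lemma pair1_1 X (f : chain H B n.*2.+1 -> K) x : is_cochain f ->
  pair1 n (phi f x) (1 : invB B X) 1 = 0.
Proof.
move=> fc; rewrite /pair1 subrr; apply: (multiadd0 (phiD x fc) (s1 := [::])).
by rewrite /= -/(alt _ _ _) size_alt.
Qed.

Lemma inverses_diag X1 X2 (a a' : invB B X1) (b b' : invB B X2) :
  inverses a a' -> inverses b b' -> inverses (diag a b) (diag a' b').
Proof. by move=> [aa a'a] [bb b'b]; split; rewrite diagM ?aa ?a'a ?bb ?b'b diag1. Qed.

(** The concrete form of [pair1_swap]: g carries the block v of X1 to the block w = g v g^-1 of X2.
    The choice U = 1 serves the isomorphism relation, and U = diag(u, 1) with X1 = X2 the product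
    relation. *)
Lemma pair1_transport X1 X2 (f : cocycle B n.*2.+1) x (U U' : invB B (dsum X1 X2))
    (v v' : invB B X1) (w w' : invB B X2) (g : homB B X1 X2) (g' : homB B X2 X1) :
  homB_inv g -> homB_inv g' ->
  homB_mul g' g = homB1 B X1 -> homB_mul g g' = homB1 B X2 ->
  homB_mul (homB_mul g (invB_val v)) g' = invB_val w ->
  homB_mul (homB_mul g (invB_val v')) g' = invB_val w' ->
  inverses v v' -> inverses U U' ->
  pair1 n (phi f x) (U * diag 1 w) (diag 1 w' * U') =
  pair1 n (phi f x) (U * diag v 1) (diag v' 1 * U').
Proof.
move=> gi g'i g'g gg' gv gv' [vv' v'v] UU'.
have fz := cocycleE f; have [fc _] := fz; have fo := cocycle_cochain f.
have := pair1_swap char0 (phiD x fo) (phi_cyclic x fc) (phi_closed x fz)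
  (u := U) (u' := U') (e1 := diag 1 0) (e2 := diag 0 1) (v := diag v 0)
  (v' := diag v' 0) (g := down gi) (g' := up g'i) UU'.
rewrite !diagD !addr0 !add0r diag1 !diagM !mul0r !mul1r !mulr1 vv' v'v.
rewrite (up_down _ _ (a := 1))// (down_up _ _ (b := 1))//.
rewrite down_down up_up !down_diag (down_up _ _ (b := w))//.
rewrite (down_up _ _ (b := w'))// !diagD !addr0 !add0r.
by move=> ->.
Qed.

Lemma val1_rel (f : cocycle B n.*2.+1) s t : K1_rel s t ->
  \sum_(g <- s) val1 f g = \sum_(g <- t) val1 f g.
Proof.
have fz := cocycleE f; have [fc _] := fz; have fo := cocycle_cochain f.
have i1 X : inverses (1 : invB B X) 1 by split; rewrite mulr1.
case=> [X X' u u' iso|X u v w uvw|X1 X2 u1 u2 T w Ti wE].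
- rewrite !big_seq1; apply: RH_ext => x.
  rewrite -[LHS]/(pair1 n (phi f x) (unit_elt u) (unit_inv u)).
  rewrite -[RHS]/(pair1 n (phi f x) (unit_elt u') (unit_inv u')).
  have [g [g' [gi g'i g'g gg' gu]]] := unit_isoP iso.
  have [uv vu] := unit_inverses u.
  (* The element g u^-1 g^-1, which must be the inverse of u' = g u g^-1 by uniqueness. *)
  pose w := mkinv (homB_mul_inv (homB_mul_inv gi (invB_inv (unit_inv u))) g'i).
  have cancel (r : homB B X' X) : homB_mul g' (homB_mul g r) = r.
    by rewrite homB_mulA g'g homB_mul1l.
  have wE : unit_inv u' = w.
    apply: inverses_uniq (unit_inverses u') _; split; apply: invB_eq.
      rewrite invB_mulE /= -gu -!homB_mulA cancel.
      rewrite (homB_mulA (invUnit_val u)).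
      have -> : homB_mul (invUnit_val u) (invB_val (unit_inv u)) = homB1 B X.
        by have e := congr1 (@invB_val K H B X) uv.
      by rewrite homB_mul1l gg'.
    rewrite invB_mulE /= -gu -!homB_mulA cancel.
    rewrite (homB_mulA (invB_val (unit_inv u))).
    have -> : homB_mul (invB_val (unit_inv u)) (invUnit_val u) = homB1 B X.
      by have e := congr1 (@invB_val K H B X) vu.
    by rewrite homB_mul1l gg'.
  have := pair1_transport f x (v := unit_elt u)
    (v' := unit_inv u) (w := unit_elt u') (w' := w) gi g'i g'g gg'
    gu erefl (unit_inverses u) (i1 (dsum X X')).
  by rewrite !mul1r !mulr1 !pair1_diag// !pair1_1// add0r addr0 wE.
- rewrite big_cons !big_seq1; apply: RH_ext => x; rewrite RH_add.
  rewrite -[RHS]/(pair1 n (phi f x) (unit_elt w) (unit_inv w)).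
  rewrite -[LHS]/(pair1 n (phi f x) (unit_elt u) (unit_inv u) +
    pair1 n (phi f x) (unit_elt v) (unit_inv v)).
  have wE : unit_elt w = unit_elt u * unit_elt v.
    by apply: invB_eq; rewrite /= -uvw.
  have wE' : unit_inv w = unit_inv v * unit_inv u.
    apply: inverses_uniq (unit_inverses w) _; rewrite wE.
    exact: inversesM (unit_inverses u) (unit_inverses v).
  have h1 := homB1_inv B X.
  have c1 (r : homB B X X) : homB_mul (homB_mul (homB1 B X) r) (homB1 B X) = r.
    by rewrite homB_mul1l homB_mul1r.
  (* With g = g' = 1 on X (+) X this compares diag(u, v) with diag(uv, 1). *)
  have := pair1_transport f x (v := unit_elt v) (w := unit_elt v)
    (w' := unit_inv v) h1 h1 (homB_mul1l _) (homB_mul1l _) (c1 _) (c1 _)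
    (unit_inverses v) (inverses_diag (unit_inverses u) (i1 X)).
  rewrite !diagM !mulr1 !mul1r !pair1_diag// !pair1_1// addr0 wE wE'.
  by move=> <-.
- rewrite big_cons !big_seq1; apply: RH_ext => x; rewrite RH_add.
  rewrite -[RHS]/(pair1 n (phi f x) (unit_elt w) (unit_inv w)).
  rewrite -[LHS]/(pair1 n (phi f x) (unit_elt u1) (unit_inv u1) +
    pair1 n (phi f x) (unit_elt u2) (unit_inv u2)).
  rewrite -pair1_diag//.
  have iD := inverses_diag (unit_inverses u1) (unit_inverses u2).
  (* Factoring the triangular matrix as diag(u1, u2)(1 + N) forces this choice; [N] is strictly
     upper triangular, hence of square zero. *)
  pose N := diag (unit_inv u1) (unit_inv u2) * up Ti.
  have NN : N * N = 0 by rewrite /N diag_up up_up.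
  have wN : unit_elt w = diag (unit_elt u1) (unit_elt u2) * (1 + N).
    rewrite mulrDr mulr1 /N mulrA; have [-> _] := iD; rewrite mul1r.
    by apply: invB_eq; rewrite /= -wE.
  have wN' : unit_inv w = (1 - N) * diag (unit_inv u1) (unit_inv u2).
    apply: inverses_uniq (unit_inverses w) _; rewrite wN.
    exact: inversesM iD (inverses_nilp NN).
  rewrite wN wN'; apply/esym.
  exact: (pair1_mulr char0 (phiD x fo) (phi_cyclic x fc) (phi_closed x fz) iD NN).
Qed.

Lemma val1_coboundary (f f' : cocycle B n.*2.+1) g :
  is_cyclic_coboundary (f - f' : cocycle B n.*2.+1) -> val1 f g = val1 f' g.
Proof.
move=> fb; apply: RH_ext => x; apply/eqP; rewrite -subr_eq0.
case: g => X u; set e := alt (unit_elt u - 1) (unit_inv u - 1) n.+1.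
have <- : phi (f - f' : chain H B n.*2.+1 -> K) x e =
    val1 f (existT _ X u) x - val1 f' (existT _ X u) x.
  rewrite phiB ?size_altS//; exact: cocycle_cochain.
have {fb} [h [hc ->]] : is_cyclic_coboundary (f - f' : chain H B n.*2.+1 -> K) by [].
have [[hl _] _] := hc; rewrite /e altS phi_hochb ?size_alt//; apply/eqP.
have [uv vu] := unit_inverses u.
apply: (pair1_coboundary (phiD x hc.1) (phi_cyclic x hc)).
  by rewrite alt_pair_mul.
by rewrite (alt_pair_mul vu) addrC.
Qed.

Lemma val1D (f f' : cocycle B n.*2.+1) g : val1 (f + f') g = val1 f g + val1 f' g.
Proof.
apply/eqP; rewrite -subr_eq; apply/eqP; apply: RH_ext => x.
have := phiB x (cocycle_cochain (f + f')) (cocycle_cochain f')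
  (size_altS (unit_elt (projT2 g) - 1) (unit_inv (projT2 g) - 1)).
have -> : ((f + f' : cocycle B n.*2.+1) : chain H B n.*2.+1 -> K) -
    (f' : chain H B n.*2.+1 -> K) = f.
  exact: (addrK (f' : chain H B n.*2.+1 -> K)).
by move/esym.
Qed.

Lemma odd_pairing : exists pairing : HC B n.*2.+1 -> K1 B -> RH H,
  [/\ forall x x' y, pairing (x + x') y = pairing x y + pairing x' y,
      forall x y y', pairing x (presadd y y') = pairing x y + pairing x y' &
      forall (f : cocycle B n.*2.+1) X (u : invUnit B X) (v : homB B X X) (h : H),
        homB_inverse u v ->
        pairing (HC_class f) (K1_class u) h =
        Psi f (chain_pure n.*2.+1 h
          (flatten (nseq n.+1 [:: v - homB1 B X; (u : homB B X X) - homB1 B X])))].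
Proof.
exists (fun x y => pres_lift (val1 (repr x)) y); split.
- move=> x x' y; rewrite /pres_lift /pres_sum -big_split; apply: eq_bigr => p _ /=.
  have vE : val1 (repr (x + x')) p.2 = val1 (repr x) p.2 + val1 (repr x') p.2.
    rewrite -val1D -HC_reprD (HC_repr (v := val1 ^~ p.2))// => f f'.
    exact: val1_coboundary.
  by rewrite vE; case: p.1; rewrite ?opprD.
- by move=> x y y'; apply: pres_liftD; apply: val1_rel.
- move=> f X u v h uv; rewrite pres_lift_gen; last exact: val1_rel.
  rewrite (HC_repr (v := val1 ^~ _)) => [|f1 f2]; last exact: val1_coboundary.
  (* By uniqueness of inverses the chosen inverse is the given [v]. *)
  rewrite -(unit_invE uv) /= /phi /alt map_flatten map_nseq.
  by [].
Qed.

End Odd.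
End Pairing.

Theorem theorem2p2 (R : realType) (H : hopfAlg R[i]) (B : modAlg H) (n : nat) :
  (exists pairing : HC B (2 * n) -> K0 B -> RH H,
    [/\ forall x x' y, pairing (x + x') y = pairing x y + pairing x' y,
        forall x y y',
          pairing x (presadd y y') = pairing x y + pairing x y' &
        forall (f : cocycle B (2 * n)) (X : fdMod H) (p : invIdem B X) (h : H),
          pairing (HC_class f) (K0_class p) h =
          Psi f (chain_pure (2 * n) h (nseq (2 * n).+1 (p : homB B X X)))]) /\
  (exists pairing : HC B (2 * n).+1 -> K1 B -> RH H,
    [/\ forall x x' y, pairing (x + x') y = pairing x y + pairing x' y,
        forall x y y',
          pairing x (presadd y y') = pairing x y + pairing x y' &
        forall (f : cocycle B (2 * n).+1) (X : fdMod H) (u : invUnit B X)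
            (v : homB B X X) (h : H), homB_inverse u v ->
          pairing (HC_class f) (K1_class u) h =
          Psi f (chain_pure (2 * n).+1 h
            (flatten (nseq n.+1 [:: v - homB1 B X; (u : homB B X X) - homB1 B X])))]).
Proof.
have char0 : [pchar R[i]] =i pred0 := Num.Theory.pchar_num _.
rewrite mul2n; split; [exact: even_pairing | exact: odd_pairing].
Qed.
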